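(* Let $1<p<\infty$, let $k$ be a polynomial that is not identically $0$, let $\phi$ be the functional with kernel $k$, let $F\in A^p$ be the extremal function for $k$, and let $K(z)=\frac1z\int_0^z k(\zeta)\,d\zeta$. Then $F\in H^p$ and for every (analytic) polynomial $h$, \[ \frac{1}{2\pi}\int_0^{2\pi} |F(e^{i\theta})|^p h(e^{i\theta})\,d\theta = \frac{1}{2\pi\|\phi\|}\int_0^{2\pi} F\Big[\frac p2\, h\,\overline{k} + \Big(1-\frac p2\Big)(zh)'\,\overline{K}\Big]\,d\theta, \] where in the right-hand integral all functions are evaluated at $z=e^{i\theta}$ (boundary values).
   Context: $\mathbb{D}$ is the open unit disc and $\sigma$ is normalized area measure on $\mathbb{D}$. For $1<p<\infty$, $A^p$ is the Bergman space of analytic $f$ on $\mathbb{D}$ with $\|f\|_{A^p}=(\int_{\mathbb{D}}|f|^p\,d\sigma)^{1/p}<\infty$, and $H^p$ is the Hardy space of analytic $f$ with $\|f\|_{H^p}=\sup_{0<r<1}(\frac1{2\pi}\int_0^{2\pi}|f(re^{i\theta})|^p d\theta)^{1/p}<\infty$; $H^p$ functions have radial boundary values $f(e^{i\theta})$ a.e. Let $q=p/(p-1)$. For $k\in A^q$, $k\not\equiv0$, the functional with kernel $k$ is $\phi(f)=\int_{\mathbb{D}} f\,\overline{k}\,d\sigma$ on $A^p$, with norm $\|\phi\|$ in $(A^p)^*$. The extremal function for $k$ is the unique $F\in A^p$ with $\|F\|_{A^p}=1$ and $\operatorname{Re}\phi(F)=\sup_{\|g\|_{A^p}=1}\operatorname{Re}\phi(g)=\|\phi\|$.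 *)

(* Defs.v *)
From HB Require Import structures.
From mathcomp Require Import all_boot all_order all_algebra.
From mathcomp Require Import all_classical all_reals all_analysis.
From mathcomp Require Import complex.
Set Implicit Arguments. Unset Strict Implicit. Unset Printing Implicit Defensive.
Import Order.TTheory GRing.Theory Num.Theory.
Import numFieldNormedType.Exports.
Local Open Scope classical_set_scope.
Local Open Scope ring_scope.
Local Open Scope complex_scope.

Section BergmanDefs.
Variable R : realType.
Local Notation C := R[i].

Definition leb1 := @lebesgue_measure R.
Definition leb2 := (@lebesgue_measure R \x @lebesgue_measure R)%E.

Definition cplx (xy : R * R) : C := xy.1 +i* xy.2.

Definition expi (t : R) : C := cos t +i* sin t.

Definition Disc : set (R * R) := [set xy | xy.1 ^+ 2 + xy.2 ^+ 2 < 1].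

Definition circ_dom : set R := [set t | 0 <= t <= pi *+ 2].

Definition cintegral d (T : measurableType d) (mu : {measure set T -> \bar R})
  (D : set T) (g : T -> C) : C :=
  (\int[mu]_(x in D) complex.Re (g x)) +i* (\int[mu]_(x in D) complex.Im (g x)).

Definition ccvg (T : Type) (F : set_system T) (g : T -> C) (l : C) : Prop :=
  ((fun x => complex.Re (g x)) @ F --> complex.Re l) /\ ((fun x => complex.Im (g x)) @ F --> complex.Im l).

Definition analytic_disc (f : C -> C) : Prop :=
  exists a : nat -> C, forall z : C, Normc.normc z < 1 ->
    ccvg \oo (fun N : nat => \sum_(n < N) a n * z ^+ n) (f z).

(* int_D |f|^p dsigma, sigma = normalized area measure dA / pi *)
Definition Ap_int (p : R) (f : C -> C) : \bar R :=
  (pi^-1)%:E * (\int[leb2]_(xy in Disc) (Normc.normc (f (cplx xy)) `^ p)%:E)%E.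

Definition in_Ap (p : R) (f : C -> C) : Prop :=
  analytic_disc f /\ (Ap_int p f < +oo)%E.

Definition Ap_norm (p : R) (f : C -> C) : R := fine (Ap_int p f) `^ p^-1.

Definition in_Hp (p : R) (f : C -> C) : Prop :=
  analytic_disc f /\
  exists M : R, forall r : R, 0 < r < 1 ->
    (((pi *+ 2)^-1)%:E *
      (\int[leb1]_(t in circ_dom) (Normc.normc (f (r%:C * expi t)) `^ p)%:E)
    <= M%:E)%E.

Definition phi (k : {poly C}) (f : C -> C) : C :=
  (pi^-1)%:C * cintegral leb2 Disc (fun xy => f (cplx xy) * conjc k.[cplx xy]).

Definition Ap_sphere (p : R) : set (C -> C) :=
  [set g | in_Ap p g /\ Ap_norm p g = 1].

Definition phi_norm (p : R) (k : {poly C}) : R :=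
  sup [set Normc.normc (phi k g) | g in Ap_sphere p].

Definition extremal (p : R) (k : {poly C}) (F : C -> C) : Prop :=
  Ap_sphere p F /\
  complex.Re (phi k F) = sup [set complex.Re (phi k g) | g in Ap_sphere p] /\
  complex.Re (phi k F) = phi_norm p k.

(* K(z) = (1/z) int_0^z k(zeta) dzeta = int_0^1 k(t z) dt *)
Definition Kfun (k : {poly C}) (z : C) : C :=
  cintegral leb1 [set t : R | 0 <= t <= 1] (fun t => k.[t%:C * z]).

Definition radial_limit (F : C -> C) (Fb : R -> C) : Prop :=
  {ae leb1, forall t : R,
     ccvg (at_left 1) (fun r : R => F (r%:C * expi t)) (Fb t)}.

End BergmanDefs.

(* Main.v *)
(* With [G w = |w|^(p-2) conj w], convexity of [|w|^p] gives the variational identity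
   [||phi|| int g G(F) = phi g] (normalized area) for all [g] in A^p.  Tested on the rotations
   [F_t(z) = F(e^(it) z)] and [F_(-t)], it shows that [int (F_t - F) (G(F_t) - G(F))] only
   involves finitely many moments of [F], since [k] is a polynomial, and is O(t^2).  Strong
   monotonicity of [G] turns this into control of [|F_t - F| |F|^(p-1) / t], so that
   [z F' |F|^(p-1)] is integrable on the disc, and differentiating the identity for
   [g = z^j F_t] at [t = 0] computes [int z^j (z F') G(F)].
   On almost every radius [F' |F|^(p-1)] is then integrable: [|F|^p] is bounded there by an
   integrable function of the angle and [F] has a limit.  Hence [F] is in H^p, and Green's formula
   writes the integral of [|F|^p e^(ijt)] over the circle as
   [int z^j ((2j+2) |F|^p + p (z F') G(F))].  Both terms are known combinations of the
   moments [int z^j F conj(z)^m], which are multiples of the Fourier coefficients of the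
   boundary values of [z^j F]. *)
Require Import Defs.
From HB Require Import structures.
From mathcomp Require Import all_boot all_order all_algebra.
From mathcomp Require Import all_classical all_reals all_analysis.
From mathcomp Require Import measurable_realfun complex.
From mathcomp Require Import ring lra.
Import Order.TTheory GRing.Theory Num.Theory.
Import numFieldNormedType.Exports.
Local Open Scope classical_set_scope.
Local Open Scope ring_scope.
Local Open Scope complex_scope.
Set Implicit Arguments. Unset Strict Implicit. Unset Printing Implicit Defensive.

(** * Polar coordinates in the plane, from one-dimensional substitutions *)

Section substitution.
Context {R : realType}.
Local Notation mu := (@lebesgue_measure R).
Local Open Scope ereal_scope.

(** Nothing is known in advance about [F] near the circle, so its derivative cannot be put into the
    variational identity; only rotations of [F], which stay in A^p, can be tested. Rotation
    invariance of area rewrites the pairing of [F] with [G(F_t)] as that of [F_(-t)] with [G(F)], so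
    the second difference is a value of one linear functional, in which a rotation multiplies the
    moment of order [m] by [e^(imt)]. For [p <> 2] the monotonicity of [G] does not control
    [|a - b|^2] uniformly in [a] and [b]. It does control [|a - b|^2 |a|^(2p-2)] up to the factor
    [|a|^p + |b|^p], in one form for [p < 2] and [p > 2]. The difference quotients are then bounded
    by [l X_t + Y_t / l] with [X_t] bounded in mean only: there is no dominating function, and the
    free weight [l] takes its place. Differentiating [|F|^p] along a radius yields only the real
    part of [z F' G(F)]. The imaginary part belongs to the angular derivative, whose integral over
    each circle vanishes; trading one for the other turns the [j + 2] of the radial computation into
    [2j + 2]. *)

Lemma ge0_integral_affine (a b : R) (f : R -> \bar R) : (0 < a)%R ->
  measurable_fun [set: R] f -> (forall x, 0 <= f x) ->
  \int[mu]_x f x = a%:E * \int[mu]_x f (a * x + b)%R.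
Proof.
move=> a0 mf f0.
pose g : measurableTypeR R -> measurableTypeR R := fun x => (a * x + b)%R.
have mg : measurable_fun setT g.
  by apply: measurable_funD => //; exact: measurable_funM.
pose A : {nonneg R} := NngNum (ltW a0).
pose pm : {measure set (measurableTypeR R) -> \bar R} :=
  measure_function_pushforward__canonical__measure_function_Measure mu mg.
pose m : {measure set (measurableTypeR R) -> \bar R} := mscale A pm.
(* The image of Lebesgue measure under the affine map, scaled by [a], gives each half-open interval
   its length, and this characterizes Lebesgue measure. *)
have E : forall B, measurable B -> mu B = m B.
  apply: lebesgue_measure_unique => _ [[c d]] _ <- /=.
  rewrite /m /mscale /= /pushforward.
  rewrite (_ : g @^-1` _ = `](a^-1 * (c - b))%R, (a^-1 * (d - b))%R]%classic); last first.
    apply/seteqP; split => x /=; rewrite /g !in_itv/= => /andP[h1 h2].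
      by rewrite ltr_pdivrMl// ler_pdivlMl// ltrBlDr lerBrDr h1 h2.
    by move: h1 h2; rewrite ltr_pdivrMl// ler_pdivlMl// ltrBlDr lerBrDr => -> ->.
  rewrite !lebesgue_measure_itv/= !lte_fin.
  rewrite ltr_pM2l ?invr_gt0// ltrD2r.
  case: ifPn => _; last by rewrite mule0.
  rewrite !EFinN -!EFinB -EFinM; congr EFin.
  by field; rewrite gt_eqF.
rewrite (@eq_measure_integral _ _ _ setT m)//; last first.
  by move=> B mB _; exact: E.
rewrite /m ge0_integral_mscale// /pm /=.
by rewrite ge0_integral_pushforward.
Qed.

Lemma ge0_integralN (f : R -> \bar R) :
  measurable_fun [set: R] f -> (forall x, 0 <= f x) ->
  \int[mu]_x f x = \int[mu]_x f (- x)%R.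
Proof.
move=> mf f0.
rewrite [RHS](_ : _ = \int[mu]_(x in (-%R : _ -> measurableTypeR R) @^-1` setT)
  (f \o (-%R : R -> measurableTypeR R)) x)//.
rewrite -ge0_integral_pushforward//.
by apply: eq_measure_integral => //= A mA AS; exact/esym/lebesgue_measureN.
Qed.

End substitution.

Section atan_substitution.
Context {R : realType}.
Local Notation mu := (@lebesgue_measure R).
Local Open Scope ereal_scope.

Lemma cvg_ge0_integral_symm_itv (f : R -> R) : continuous f -> (forall x, 0 <= f x)%R ->
  \int[mu]_(x in `[(- n%:R)%R, n%:R%R]%classic) (f x)%:E @[n --> \oo] --> \int[mu]_x (f x)%:E.
Proof.
move=> cf f0.
rewrite [X in _ --> \int[mu]_(_ in X) _](_ : _ = \bigcup_n `[(- n%:R)%R, n%:R%R]%classic).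
  apply: ge0_nondecreasing_set_cvg_integral => //=.
  - move=> m n mn; apply/subsetPset; apply: subset_itvScc.
      by rewrite bnd_simp lerN2 ler_nat.
    by rewrite bnd_simp ler_nat.
  - by move=> i; apply/measurable_EFinP; apply: measurable_funTS;
      exact: continuous_measurable_fun.
  - by move=> i x _; rewrite lee_fin.
apply/esym/seteqP; split => // x _.
exists (Num.truncn `|x|).+1 => //=; rewrite in_itv/= -ler_norml.
exact/ltW/truncnS_gt.
Qed.

Lemma bigcup_atan_itv :
  \bigcup_n `[atan (- n%:R)%R, @atan R n%:R%R]%classic = `](- (pi / 2)), (pi / 2)[%classic%R.
Proof.
apply/seteqP; split => x.
  case=> n _ /=; rewrite !in_itv/= => /andP[h1 h2].
  by rewrite (lt_le_trans (atan_gtNpi2 _) h1) (le_lt_trans h2 (atan_ltpi2 _)).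
rewrite /= in_itv/= => hx.
exists (Num.truncn `|tan x|).+1 => //=; rewrite in_itv/=.
have /ltW : (`|tan x| < (Num.truncn `|tan x|).+1%:R)%R by exact: truncnS_gt.
rewrite ler_norml => /andP[h1 h2].
have xE : x = atan (tan x) by rewrite tanK// in_itv.
by apply/andP; split; [rewrite [leRHS]xE|rewrite [leLHS]xE]; exact: le_atan.
Qed.

(** Substitution on [[-n, n]], followed by monotone convergence on both sides: the images under
    [atan] exhaust the open interval. *)
Lemma ge0_integral_atan (g : R -> R) : continuous g -> (forall x, 0 <= g x)%R ->
  \int[mu]_(t in `](- (pi / 2)), (pi / 2)[%classic%R) (g t)%:E =
  \int[mu]_t (g (atan t) * (1 + t ^+ 2)^-1)%:E.
Proof.
move=> cg g0.
have cvgr : \int[mu]_(x in `[(- n%:R)%R, n%:R%R]%classic) (g (atan x) * (1 + x ^+ 2)^-1)%:E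
    @[n --> \oo] --> \int[mu]_x (g (atan x) * (1 + x ^+ 2)^-1)%:E.
  apply: cvg_ge0_integral_symm_itv => x.
    apply: cvgM; last exact: continuous_oneDsqrV.
    by apply: continuous_comp; [exact: continuous_atan|exact: cg].
  by rewrite mulr_ge0// invr_ge0 addr_ge0// sqr_ge0.
rewrite -bigcup_atan_itv.
apply/esym; apply: cvg_unique cvgr _ => //.
rewrite (_ : (fun n => _) = fun n => \int[mu]_(x in `[atan (- n%:R)%R, @atan R n%:R%R]%classic) (g x)%:E).
  apply: ge0_nondecreasing_set_cvg_integral => //=.
  - move=> m n mn; apply/subsetPset; apply: subset_itvScc.
      by rewrite bnd_simp; apply: le_atan; rewrite lerN2 ler_nat.
    by rewrite bnd_simp; apply: le_atan; rewrite ler_nat.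
  - by move=> i; apply/measurable_EFinP; apply: measurable_funTS;
      exact: continuous_measurable_fun.
  - by move=> i x _; rewrite lee_fin.
apply/funext => n.
rewrite (@integration_by_substitution_increasing _ (@atan R) g (- n%:R)%R n%:R%R)//.
- apply: eq_integral => x _ /=; congr EFin.
  rewrite /= -[in LHS](derive1_atan x).
  by [].
- by rewrite (@le_trans _ _ 0%R)// ?oppr_le0.
- by move=> x y _ _; exact: lt_atan.
- move=> x _.
  rewrite (_ : derive1 (@atan R) = (fun x => (@oneDsqr R x)^-1)%R); first exact: continuous_oneDsqrV.
  by apply/funext => y; rewrite derive1_atan.
- rewrite (_ : derive1 (@atan R) = (fun x => (@oneDsqr R x)^-1)%R); last by apply/funext => y; rewrite derive1_atan.
  by apply/cvg_ex; eexists; apply: cvg_at_right_filter; exact: continuous_oneDsqrV.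
- rewrite (_ : derive1 (@atan R) = (fun x => (@oneDsqr R x)^-1)%R); last by apply/funext => y; rewrite derive1_atan.
  by apply/cvg_ex; eexists; apply: cvg_at_left_filter; exact: continuous_oneDsqrV.
- split.
  + by move=> x _; exact: derivable_atan.
  + by apply: cvg_at_right_filter; exact: continuous_atan.
  + by apply: cvg_at_left_filter; exact: continuous_atan.
- by apply: continuous_subspaceT.
Qed.

Lemma sin_atan (t : R) : sin (atan t) = (t * cos (atan t))%R.
Proof.
have c0 : cos (atan t) != 0%R.
  by apply/lt0r_neq0/cos_gt0_pihalf; rewrite atan_gtNpi2 atan_ltpi2.
by rewrite -{2}[t]atanK /tan divfK.
Qed.

Lemma cos2_atan (t : R) : (cos (atan t) ^+ 2 = (1 + t ^+ 2)^-1)%R.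
Proof.
rewrite cos_atan exprVn sqr_sqrtr// addr_ge0// sqr_ge0//.
Qed.

End atan_substitution.

Section polar_half.
Context {R : realType}.
Local Notation mu := (@lebesgue_measure R).
Local Open Scope ereal_scope.

(** The two-dimensional Jacobian is split into one-dimensional ones, with Tonelli between them. [K]
    is the integrand in the coordinates abscissa and slope ([y = x t], factor [x]), [L] the one in
    radius and slope ([x = r cos (atan t)], total factor [r cos^2 (atan t) = r / (1 + t^2)]); the
    substitution of [atan] turns slope into angle and consumes [1 / (1 + t^2)]. This last
    substitution is the reason for the continuity hypothesis. *)
Lemma polar_right_half (f : R * R -> R) :
  measurable_fun [set: R * R] f -> (forall z, 0 <= f z)%R ->
  (forall r, (0 < r)%R -> continuous (fun t => f (r * cos t, r * sin t))%R) ->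
  \int[(mu \x mu)]_z (if 0 < z.1 then f z else 0)%R%:E =
  \int[mu]_r \int[mu]_(t in `](- (pi / 2)), (pi / 2)[%classic%R)
     (if 0 < r then r * f (r * cos t, r * sin t) else 0)%R%:E.
Proof.
move=> mf f0 cf.
pose K (z : R * R) : R := (if 0 < z.1 then z.1 * f (z.1, z.1 * z.2) else 0)%R.
pose L (z : R * R) : R := (if 0 < z.1 then z.1 * (1 + z.2 ^+ 2)^-1 *
   f (z.1 * cos (atan z.2), z.1 * sin (atan z.2)) else 0)%R.
have mpos : measurable_fun [set: R * R] (fun z : R * R => (0 < z.1)%R).
  exact: measurable_fun_ltr.
have mH : measurable_fun [set: R * R] (fun z => if 0 < z.1 then f z else 0)%R.
  exact: measurable_fun_ifT.
have mK : measurable_fun setT K.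
  apply: measurable_fun_ifT => //.
  apply: measurable_funM => //; apply: measurableT_comp => //.
  apply: measurable_fun_pair => //; apply: measurable_funM => //.
have matan : measurable_fun [set: R] (@atan R).
  by apply: continuous_measurable_fun; exact: continuous_atan.
have mL : measurable_fun setT L.
  apply: measurable_fun_ifT => //.
  apply: measurable_funM.
    apply: measurable_funM => //.
    apply: (@measurableT_comp _ _ _ _ _ _ (fun x : R => (1 + x ^+ 2)^-1)%R) => //.
    apply: continuous_measurable_fun; exact: continuous_oneDsqrV.
  apply: measurableT_comp => //.
  apply: measurable_fun_pair; apply: measurable_funM => //.
    apply: (@measurableT_comp _ _ _ _ _ _ (@cos R)).
      by apply: continuous_measurable_fun; exact: continuous_cos.
    by apply: measurableT_comp.
  apply: (@measurableT_comp _ _ _ _ _ _ (@sin R)).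
    by apply: continuous_measurable_fun; exact: continuous_sin.
  by apply: measurableT_comp.
rewrite fubini_tonelli1//=; last 2 first.
- by apply/measurable_EFinP.
- by move=> z; rewrite lee_fin; case: ifP.
transitivity (\int[mu]_x \int[mu]_t (K (x, t))%:E).
  apply: eq_integral => x _; rewrite /fubini_F /K /=.
  have [x0|x0] := boolP (0 < x)%R; last by [].
  rewrite (@ge0_integral_affine _ x 0)//.
  - rewrite -ge0_integralZl//.
    + by apply: eq_integral => t _; rewrite addr0 EFinM.
    + apply/measurable_EFinP; apply: measurableT_comp => //.
      by apply: measurable_fun_pair => //; apply: measurable_funD.
    + by move=> t _; rewrite lee_fin.
    + by rewrite lee_fin ltW.
  - by apply/measurable_EFinP; apply: measurableT_comp.
  - by move=> y; rewrite lee_fin.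
transitivity (\int[mu]_t \int[mu]_x (K (x, t))%:E).
  apply: (@fubini_tonelli _ _ _ _ _ mu mu (fun z => (K z)%:E)).
  - by apply/measurable_EFinP.
  - move=> z; rewrite lee_fin /K; case: ifP => // z0; rewrite mulr_ge0//.
    exact: ltW.
transitivity (\int[mu]_t \int[mu]_r (L (r, t))%:E).
  apply: eq_integral => t _.
  have ct : (0 < cos (atan t))%R.
    by apply: cos_gt0_pihalf; rewrite atan_gtNpi2 atan_ltpi2.
  rewrite (@ge0_integral_affine _ (cos (atan t)) 0)//; last 2 first.
  - by apply/measurable_EFinP; exact: measurableT_comp.
  - move=> x; rewrite lee_fin /K; case: ifP => // z0; rewrite mulr_ge0//.
    exact: ltW.
  rewrite -ge0_integralZl//.
  - apply: eq_integral => r _; rewrite addr0 /K /L /= pmulr_rgt0//.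
    rewrite -EFinM; congr EFin; case: ifPn => r0; last by rewrite mulr0.
    rewrite sin_atan -cos2_atan; rewrite -[(cos (atan t) * r * t)%R]mulrA.
    rewrite [(cos _ * (r * t))%R]mulrC -[(r * t * _)%R]mulrA [(cos _ * r)%R]mulrC.
    ring.
  - apply/measurable_EFinP; apply: (measurableT_comp mK).
    by apply: measurable_fun_pair => //; apply: measurable_funD.
  - move=> x _; rewrite lee_fin /K; case: ifP => // z0; rewrite mulr_ge0//.
    exact: ltW.
  - by rewrite lee_fin ltW.
transitivity (\int[mu]_r \int[mu]_t (L (r, t))%:E).
  apply/esym/(@fubini_tonelli _ _ _ _ _ mu mu (fun z => (L z)%:E)).
  - by apply/measurable_EFinP.
  - move=> z; rewrite lee_fin /L; case: ifP => // z0; rewrite !mulr_ge0//.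
      exact: ltW.
    by rewrite invr_ge0 addr_ge0// sqr_ge0.
apply: eq_integral => r _.
have [r0|r0] := ltP 0%R r; last first.
  rewrite !integral0_eq// => t _; rewrite /L /= ?ltNge r0//.
rewrite (ge0_integral_atan (g := fun t => (r * f (r * cos t, r * sin t)))%R)//.
- apply: eq_integral => t _; rewrite /L /= r0; congr EFin; ring.
- by move=> t; apply: cvgM; [exact: cvg_cst|exact: cf].
- by move=> t; rewrite mulr_ge0// ltW.
Qed.

End polar_half.

Section periodic.
Context {R : realType}.
Local Notation mu := (@lebesgue_measure R).
Local Open Scope ereal_scope.

Lemma ge0_integral_shift (g : R -> \bar R) (a b c : R) :
  measurable_fun [set: R] g -> (forall x, 0 <= g x) ->
  \int[mu]_(t in `[a, b[%classic) g (t + c)%R =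
  \int[mu]_(t in `[(a + c)%R, (b + c)%R[%classic) g t.
Proof.
move=> mg g0.
rewrite integral_mkcond [RHS]integral_mkcond.
rewrite [RHS](@ge0_integral_affine _ 1 c)//.
- rewrite mul1e; apply: eq_integral => t _; rewrite mul1r !patchE.
  rewrite (_ : (t \in `[a, b[%classic) = ((t + c)%R \in `[(a + c)%R, (b + c)%R[%classic))//.
  by apply/idP/idP; rewrite !inE/= !in_itv/= lerD2r ltrD2r.
- by apply/(measurable_restrictT g) => //; exact: measurable_funTS.
- by move=> t; rewrite patchE; case: ifP.
Qed.

Lemma ge0_integral_itv_split (g : R -> \bar R) (a b c : R) : (a <= b <= c)%R ->
  measurable_fun [set: R] g -> (forall x, 0 <= g x) ->
  \int[mu]_(t in `[a, c[%classic) g t =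
  \int[mu]_(t in `[a, b[%classic) g t + \int[mu]_(t in `[b, c[%classic) g t.
Proof.
move=> /andP[ab bc] mg g0.
rewrite -ge0_integral_setU//=.
- by rewrite -itv_bndbnd_setU// bnd_simp.
- exact: measurable_funTS.
- apply/disj_setPS => x [/=]; rewrite !in_itv/= => /andP[_ h1] /andP[h2 _].
  by move: (lt_le_trans h1 h2); rewrite ltxx.
Qed.

Lemma ge0_integral_periodic (g : R -> \bar R) (c T : R) : (0 <= c <= T)%R ->
  measurable_fun [set: R] g -> (forall x, 0 <= g x) ->
  (forall x, g (x + T)%R = g x) ->
  \int[mu]_(t in `[0%R, T[%classic) g (t + c)%R = \int[mu]_(t in `[0%R, T[%classic) g t.
Proof.
move=> /andP[c0 cT] mg g0 gT.
rewrite ge0_integral_shift// add0r.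
rewrite (@ge0_integral_itv_split _ c T)//; last by rewrite cT lerDl.
rewrite [RHS](@ge0_integral_itv_split _ 0 c)//; last by rewrite c0.
rewrite addeC; congr (_ + _).
rewrite -[in LHS](add0r T) [X in `[_, X[](_ : _ = (c + T)%R) ?add0r 1?addrC//.
rewrite -[X in `[X, _[]add0r [in X in `[_, X[]addrC -ge0_integral_shift//.
by apply: eq_integral => t _; rewrite gT.
Qed.

Lemma ge0_integral_circ_shift (g : R -> \bar R) (c : R) : (0 <= c <= pi *+ 2)%R ->
  measurable_fun [set: R] g -> (forall x, 0 <= g x) ->
  (forall x, g (x + pi *+ 2)%R = g x) ->
  \int[mu]_(t in @circ_dom R) g (t + c)%R = \int[mu]_(t in @circ_dom R) g t.
Proof.
move=> c0 mg g0 gT.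
have E h : \int[mu]_(t in @circ_dom R) h t = \int[mu]_(t in `[0%R, (pi *+ 2)%R]%classic) h t.
  by congr (integral _ _ _); apply/seteqP; split => t /=; rewrite in_itv.
rewrite !E.
rewrite -!integral_itv_bndo_bndc; [exact: ge0_integral_periodic| |].
- exact: measurable_funTS.
- apply: measurable_funTS; apply: (measurableT_comp mg).
  by apply: measurable_funD.
Qed.

End periodic.

Section polar.
Context {R : realType}.
Local Notation mu := (@lebesgue_measure R).
Local Open Scope ereal_scope.

(** The right half circle and its translate by [pi] tile an interval of length [2 pi], and by
    periodicity any such interval does. *)
Lemma circ_half_split (g : R -> \bar R) :
  measurable_fun [set: R] g -> (forall x, 0 <= g x) ->
  (forall x, g (x + pi *+ 2)%R = g x) ->
  \int[mu]_(t in `](- (pi / 2)), (pi / 2)[%classic%R) g t +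
  \int[mu]_(t in `](- (pi / 2)), (pi / 2)[%classic%R) g (t + pi)%R =
  \int[mu]_(t in @circ_dom R) g t.
Proof.
move=> mg g0 gT.
have mg' c : measurable_fun [set: R] (fun t => g (t + c)%R).
  by apply: (measurableT_comp mg); apply: measurable_funD.
have p2 : (0 <= pi / 2 :> R)%R by rewrite divr_ge0// pi_ge0.
rewrite [X in X + _]integral_itv_obnd_cbnd; last exact: measurable_funTS.
rewrite [X in _ + X]integral_itv_obnd_cbnd; last exact: measurable_funTS.
rewrite ge0_integral_shift//.
rewrite (_ : - (pi / 2) + pi = pi / 2)%R; last by field.
rewrite (_ : pi / 2 + pi = - (pi / 2) + pi *+ 2)%R; last by field.
rewrite -ge0_integral_itv_split//; last first.
  apply/andP; split; first by rewrite (@le_trans _ _ 0%R)// oppr_le0.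
  by have := pi_ge0 R; lra.
have -> : \int[mu]_(t in @circ_dom R) g t = \int[mu]_(t in `[0%R, (pi *+ 2)%R[%classic) g t.
  rewrite integral_itv_bndo_bndc; last exact: measurable_funTS.
  by congr (integral _ _ _); apply/seteqP; split => t /=; rewrite in_itv.
transitivity (\int[mu]_(t in `[0%R, (pi *+ 2)%R[%classic) g (t - pi / 2)%R).
  by rewrite ge0_integral_shift// add0r [in RHS]addrC.
rewrite -[LHS](@ge0_integral_periodic _ (fun t => g (t - pi / 2)%R) (pi / 2) (pi *+ 2))//.
- by apply: eq_integral => t _; rewrite addrK.
- by have := pi_ge0 R; lra.
- by move=> x; rewrite addrAC gT.
Qed.

Lemma measurable_fun_partial_integral (P : R * R -> \bar R) (A : set R) :
  measurable A -> measurable_fun [set: R * R] P -> (forall z, 0 <= P z) ->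
  measurable_fun [set: R] (fun r => \int[mu]_(t in A) P (r, t)).
Proof.
move=> mA mP P0.
rewrite (_ : (fun r => _) = (fun r => \int[mu]_t (P \_ (setT `*` A)) (r, t))).
  apply: (@measurable_fun_fubini_tonelli_F _ _ _ _ _ mu (P \_ (setT `*` A))).
    apply/(measurable_restrictT P); first exact: measurableX.
    exact: measurable_funTS.
  by move=> z; rewrite patchE; case: ifP.
apply/funext => r; rewrite integral_mkcond; apply: eq_integral => t _.
rewrite !patchE; congr (if _ then _ else _).
by apply/idP/idP; rewrite !inE /=; tauto.
Qed.

(** The line [x = 0] is null, and [z |-> -z] exchanges the two remaining half planes. In polar
    coordinates this map is the shift of the angle by [pi], so the left half plane supplies the
    other half of the circle. *)
Lemma polar_ge0 (f : R * R -> R) :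
  measurable_fun [set: R * R] f -> (forall z, 0 <= f z)%R ->
  (forall r, (0 < r)%R -> continuous (fun t => f (r * cos t, r * sin t))%R) ->
  \int[(mu \x mu)]_z (f z)%:E =
  \int[mu]_r \int[mu]_(t in @circ_dom R)
     (if 0 < r then r * f (r * cos t, r * sin t) else 0)%R%:E.
Proof.
move=> mf f0 cf.
pose fN (z : R * R) := f (- z.1, - z.2)%R.
have mfN : measurable_fun [set: R * R] fN.
  by apply: (measurableT_comp mf); apply: measurable_fun_pair; apply: measurableT_comp.
have mpos : measurable_fun [set: R * R] (fun z : R * R => (0 < z.1)%R).
  exact: measurable_fun_ltr.
pose Phi x := \int[mu]_y (f (x, y))%:E.
have mPhi : measurable_fun [set: R] Phi.
  apply: (@measurable_fun_fubini_tonelli_F _ _ _ _ _ mu (fun z => (f z)%:E)).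
    exact/measurable_EFinP.
  by move=> z; rewrite lee_fin.
have Phi0 x : 0 <= Phi x by apply: integral_ge0 => y _; rewrite lee_fin.
have half (h : R * R -> R) : measurable_fun [set: R * R] h -> (forall z, 0 <= h z)%R ->
    \int[mu]_x (if (0 < x)%R then \int[mu]_y (h (x, y))%:E else 0) =
    \int[(mu \x mu)]_z (if 0 < z.1 then h z else 0)%R%:E.
  move=> mh h0; rewrite fubini_tonelli1//=.
  - apply: eq_integral => x _; rewrite /fubini_F /=.
    have [x0|x0] := boolP (0 < x)%R; first by [].
    by rewrite integral0.
  - apply/measurable_EFinP; exact: measurable_fun_ifT.
  - by move=> z; rewrite lee_fin; case: ifP.
have mltPhi : measurable_fun [set: R] (fun x => if (0 < x)%R then Phi x else 0).
  by apply: measurable_fun_ifT => //; exact: measurable_fun_ltr.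
have mgtPhi : measurable_fun [set: R] (fun x => if (x < 0)%R then Phi x else 0).
  by apply: measurable_fun_ifT => //; exact: measurable_fun_ltr.
rewrite fubini_tonelli1//=; last exact/measurable_EFinP.
transitivity (\int[mu]_x ((if (0 < x)%R then Phi x else 0) + (if (x < 0)%R then Phi x else 0))).
  have mD : measurable ([set: R] `\ 0%R) by exact: measurableD.
  rewrite -(@integral_setD1 _ _ 0%R setT)//; last exact: measurable_funTS.
  rewrite -[RHS](@integral_setD1 _ _ 0%R setT)//; last first.
    by apply: measurable_funTS; exact: emeasurable_funD.
  apply: eq_integral => x; rewrite inE /= => -[_ x0].
  have [x1|x1|x1] := ltgtP x 0%R; rewrite ?add0e ?adde0//.
rewrite ge0_integralD//; last 2 first.
- by move=> x _; case: ifP.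
- by move=> x _; case: ifP.
rewrite [X in _ + X]ge0_integralN//; last by move=> x; case: ifP.
rewrite [X in _ + X](_ : _ = \int[mu]_x (if (0 < x)%R then \int[mu]_y (fN (x, y))%:E else 0)); last first.
  apply: eq_integral => x _; rewrite oppr_lt0; case: ifPn => // x0.
  rewrite /Phi ge0_integralN//; last by move=> y; rewrite lee_fin.
  by apply/measurable_EFinP; apply: measurableT_comp.
rewrite /Phi !half//; last by move=> z; rewrite /fN.
rewrite !polar_right_half//; last 2 first.
- by move=> z; rewrite /fN.
- move=> r r0; have := cf _ r0 => cfr.
  have -> : (fun t => fN (r * cos t, r * sin t)%R) =
      (fun t => f (r * cos t, r * sin t)%R) \o (fun t => t + pi)%R.
    apply/funext => t; rewrite /fN /= cosDpi sinDpi; congr (f (_, _)); ring.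
  move=> t; apply: continuous_comp; last exact: cfr.
  by apply: cvgD => //; exact: cvg_cst.
have mP (g : R * R -> R) : measurable_fun [set: R * R] g ->
   measurable_fun [set: R * R] (fun z : R * R =>
     (if 0 < z.1 then z.1 * g (z.1 * cos z.2, z.1 * sin z.2) else 0)%R%:E).
  move=> mg; apply/measurable_EFinP; apply: measurable_fun_ifT => //.
  apply: measurable_funM => //; apply: (measurableT_comp mg).
  apply: measurable_fun_pair; apply: measurable_funM => //.
    apply: (@measurableT_comp _ _ _ _ _ _ (@cos R)) => //.
    by apply: continuous_measurable_fun; exact: continuous_cos.
  apply: (@measurableT_comp _ _ _ _ _ _ (@sin R)) => //.
  by apply: continuous_measurable_fun; exact: continuous_sin.
have P0 (g : R * R -> R) (z : R * R) : (forall z, 0 <= g z)%R ->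
    0 <= (if 0 < z.1 then z.1 * g (z.1 * cos z.2, z.1 * sin z.2) else 0)%R%:E.
  by move=> g0; rewrite lee_fin; case: ifP => // /ltW ?; rewrite mulr_ge0.
rewrite -ge0_integralD//.
- apply: eq_integral => r _.
  rewrite -circ_half_split.
  + congr (_ + _); apply: eq_integral => t _; rewrite /fN /= cosDpi sinDpi.
    by case: ifP => // _; congr ((_ * f (_, _))%:E); ring.
  + by have /= := @measurable_fun_pair2 _ _ _ _ _ _ _ r (mP f mf); apply.
  + by move=> t; apply: (P0 f (r, t)).
  + by move=> t; rewrite cosD2pi sinD2pi.
- by move=> x _; apply: integral_ge0 => t _; apply: (P0 f (x, t)).
- apply: (measurable_fun_partial_integral (P := fun z : R * R =>
     (if 0 < z.1 then z.1 * f (z.1 * cos z.2, z.1 * sin z.2) else 0)%R%:E)) => //.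
    exact: mP.
  by move=> z; exact: P0.
- by move=> x _; apply: integral_ge0 => t _; apply: (P0 fN (x, t)) => z; exact: f0.
- apply: (measurable_fun_partial_integral (P := fun z : R * R =>
     (if 0 < z.1 then z.1 * fN (z.1 * cos z.2, z.1 * sin z.2) else 0)%R%:E)) => //.
    exact: mP.
  by move=> z; apply: P0 => {}z; exact: f0.
Qed.
End polar.

(** * Complex numbers and componentwise limits *)

Section complex_basics.
Context {R : realType}.
Local Notation C := R[i].
Local Notation normc := (@Normc.normc R).
Implicit Types (z w : C) (r t : R).

Lemma normcE z : normc z = Num.sqrt (complex.Re z ^+ 2 + complex.Im z ^+ 2).
Proof. by case: z. Qed.

Lemma normc_ge0 z : 0 <= normc z.
Proof. by rewrite normcE sqrtr_ge0. Qed.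

Lemma normc_sqr z : normc z ^+ 2 = complex.Re z ^+ 2 + complex.Im z ^+ 2.
Proof. by rewrite normcE sqr_sqrtr// addr_ge0// sqr_ge0. Qed.

Lemma normc_real r : normc r%:C = `|r|.
Proof. by rewrite normcE /= expr0n/= addr0 sqrtr_sqr. Qed.

Lemma normc_gt0 z : (0 < normc z) = (z != 0).
Proof.
apply/idP/idP; first by apply: contraTneq => ->; rewrite Normc.normc0 ltxx.
move=> z0; rewrite lt_def normc_ge0 andbT.
by apply: contraNneq z0 => /Normc.eq0_normc ->.
Qed.

Lemma normc_sum (I : Type) (s : seq I) (P : pred I) (f : I -> C) :
  normc (\sum_(i <- s | P i) f i) <= \sum_(i <- s | P i) normc (f i).
Proof.
elim/big_rec2 : _ => [|i y x _ h]; first by rewrite Normc.normc0.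
by rewrite (le_trans (le_normcD _ _))// lerD2l.
Qed.

Lemma normcX z n : normc (z ^+ n) = normc z ^+ n.
Proof.
elim: n => [|n ih]; first by rewrite !expr0 Normc.normc1.
by rewrite !exprS Normc.normcM ih.
Qed.

Lemma normc_conjc z : normc (conjc z) = normc z.
Proof. by rewrite !normcE; case: z => a b /=; rewrite sqrrN. Qed.

Lemma normc_Re z : `|complex.Re z| <= normc z.
Proof. by rewrite normcE -sqrtr_sqr ler_wsqrtr// lerDl sqr_ge0. Qed.

Lemma normc_Im z : `|complex.Im z| <= normc z.
Proof. by rewrite normcE -sqrtr_sqr ler_wsqrtr// lerDr sqr_ge0. Qed.

Lemma Re_le_normc z : complex.Re z <= normc z.
Proof. exact: le_trans (ler_norm _) (normc_Re _). Qed.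

Lemma normc_le_ReIm z : normc z <= `|complex.Re z| + `|complex.Im z|.
Proof.
rewrite normcE -(@ger0_norm _ (`|_| + `|_|)) ?addr_ge0// -sqrtr_sqr ler_wsqrtr//.
rewrite sqrrD -!normrX !(ger0_norm (sqr_ge0 _)).
by rewrite -[leRHS]addrAC lerDl mulrn_wge0// mulr_ge0.
Qed.

Lemma normcB_sym z w : normc (z - w) = normc (w - z).
Proof. by rewrite -normcN opprB. Qed.

Lemma le_normcB z w : normc (z - w) <= normc z + normc w.
Proof. by rewrite (le_trans (le_normcD _ _))// normcN. Qed.

Lemma ler_dist_normc z w : `|normc z - normc w| <= normc (z - w).
Proof.
rewrite ler_norml; apply/andP; split.
  rewrite lerNl opprB lerBlDl -{1}[w](subKr z) (le_trans (le_normcB _ _))//.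
by rewrite lerBlDr -{1}[z](subrK w) le_normcD.
Qed.

Lemma ReD z w : complex.Re (z + w) = complex.Re z + complex.Re w.
Proof. by case: z w => [a b] [c d]. Qed.
Lemma ImD z w : complex.Im (z + w) = complex.Im z + complex.Im w.
Proof. by case: z w => [a b] [c d]. Qed.
Lemma ReN z : complex.Re (- z) = - complex.Re z.
Proof. by case: z. Qed.
Lemma ImN z : complex.Im (- z) = - complex.Im z.
Proof. by case: z. Qed.
Lemma ReM z w : complex.Re (z * w) =
  complex.Re z * complex.Re w - complex.Im z * complex.Im w.
Proof. by case: z w => [a b] [c d]. Qed.
Lemma ImM z w : complex.Im (z * w) =
  complex.Re z * complex.Im w + complex.Im z * complex.Re w.
Proof. by case: z w => [a b] [c d]. Qed.
Lemma complexP z w : complex.Re z = complex.Re w -> complex.Im z = complex.Im w -> z = w.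
Proof. by case: z w => [a b] [c d] /= -> ->. Qed.

Lemma ReMl r z : complex.Re (r%:C * z) = r * complex.Re z.
Proof. by rewrite ReM /= mul0r subr0. Qed.
Lemma ImMl r z : complex.Im (r%:C * z) = r * complex.Im z.
Proof. by rewrite ImM /= mul0r addr0. Qed.
Lemma Re_sum (I : Type) (s : seq I) (P : pred I) (f : I -> C) :
  complex.Re (\sum_(i <- s | P i) f i) = \sum_(i <- s | P i) complex.Re (f i).
Proof. by elim/big_rec2 : _ => // i y x _ <-; rewrite ReD. Qed.
Lemma Im_sum (I : Type) (s : seq I) (P : pred I) (f : I -> C) :
  complex.Im (\sum_(i <- s | P i) f i) = \sum_(i <- s | P i) complex.Im (f i).
Proof. by elim/big_rec2 : _ => // i y x _ <-; rewrite ImD. Qed.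

Lemma mul_conjc z : z * conjc z = (normc z ^+ 2)%:C.
Proof.
apply: complexP; rewrite ?ReM ?ImM normc_sqr /=; case: z => a b /=; ring.
Qed.

Lemma expiD (s t : R) : expi (s + t) = expi s * expi t.
Proof.
by apply: complexP; rewrite ?ReM ?ImM /= ?cosD ?sinD//; ring.
Qed.

Lemma expi0 : expi (0 : R) = 1.
Proof. by rewrite /expi cos0 sin0. Qed.

Lemma normc_expi t : normc (expi t) = 1.
Proof. by rewrite normcE /= cos2Dsin2 sqrtr1. Qed.

Lemma expiN t : expi (- t) = conjc (expi t).
Proof. by rewrite /expi cosN sinN. Qed.

Lemma expiX t n : expi t ^+ n = expi (t *+ n).
Proof.
elim: n => [|n ih]; first by rewrite expr0 mulr0n expi0.
by rewrite exprS ih mulrS expiD.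
Qed.

Lemma expiD2pi t : expi (t + pi *+ 2) = expi t.
Proof. by rewrite /expi cosD2pi sinD2pi. Qed.

Lemma expiNl t : expi (- t) * expi t = 1.
Proof. by rewrite -expiD addNr expi0. Qed.

End complex_basics.

Section ccvg_theory.
Context {R : realType}.
Local Notation C := R[i].
Local Notation normc := (@Normc.normc R).
Context {T : Type} {F : set_system T} {FF : Filter F}.
Implicit Types (f g : T -> C) (a b : C).

Lemma ccvg_cst a : ccvg F (fun=> a) a.
Proof. by split; exact: cvg_cst. Qed.

Lemma ccvgD f g a b : ccvg F f a -> ccvg F g b -> ccvg F (fun x => f x + g x) (a + b).
Proof.
move=> [fa1 fa2] [gb1 gb2]; split.
  rewrite (_ : (fun x => _) = fun x => complex.Re (f x) + complex.Re (g x)); last first.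
    by apply/funext => x; rewrite ReD.
  by rewrite ReD; exact: cvgD.
rewrite (_ : (fun x => _) = fun x => complex.Im (f x) + complex.Im (g x)); last first.
  by apply/funext => x; rewrite ImD.
by rewrite ImD; exact: cvgD.
Qed.

Lemma ccvgN f a : ccvg F f a -> ccvg F (fun x => - f x) (- a).
Proof.
move=> [fa1 fa2]; split.
  rewrite (_ : (fun x => _) = fun x => - complex.Re (f x)); last first.
    by apply/funext => x; rewrite ReN.
  by rewrite ReN; exact: cvgN.
rewrite (_ : (fun x => _) = fun x => - complex.Im (f x)); last first.
  by apply/funext => x; rewrite ImN.
by rewrite ImN; exact: cvgN.
Qed.

Lemma ccvgB f g a b : ccvg F f a -> ccvg F g b -> ccvg F (fun x => f x - g x) (a - b).
Proof. by move=> fa gb; apply: ccvgD => //; exact: ccvgN. Qed.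

Lemma ccvgM f g a b : ccvg F f a -> ccvg F g b -> ccvg F (fun x => f x * g x) (a * b).
Proof.
move=> [fa1 fa2] [gb1 gb2]; split.
  rewrite (_ : (fun x => _) = fun x => complex.Re (f x) * complex.Re (g x) -
     complex.Im (f x) * complex.Im (g x)); last by apply/funext => x; rewrite ReM.
  by rewrite ReM; apply: cvgB; exact: cvgM.
rewrite (_ : (fun x => _) = fun x => complex.Re (f x) * complex.Im (g x) +
   complex.Im (f x) * complex.Re (g x)); last by apply/funext => x; rewrite ImM.
by rewrite ImM; apply: cvgD; exact: cvgM.
Qed.

Lemma ccvg_conjc f a : ccvg F f a -> ccvg F (fun x => conjc (f x)) (conjc a).
Proof.
move=> [fa1 fa2]; split.
  rewrite (_ : (fun x => _) = fun x => complex.Re (f x)); last first.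
    by apply/funext => x; case: (f x).
  by move: fa1; case: (a).
rewrite (_ : (fun x => _) = fun x => - complex.Im (f x)); last first.
  by apply/funext => x; case: (f x).
by rewrite (_ : complex.Im _ = - complex.Im a); [exact: cvgN|case: (a)].
Qed.

Lemma ccvg_real (u : T -> R) (l : R) : u @ F --> l -> ccvg F (fun x => (u x)%:C) l%:C.
Proof. by move=> ul; split => //; exact: cvg_cst. Qed.

Lemma ccvgX f a n : ccvg F f a -> ccvg F (fun x => f x ^+ n) (a ^+ n).
Proof.
move=> fa; elim: n => [|n ih].
  by rewrite expr0; under eq_fun do rewrite expr0; exact: ccvg_cst.
by rewrite exprS; under eq_fun do rewrite exprS; exact: ccvgM.
Qed.

Lemma ccvgP f a : ccvg F f a <-> normc (f x - a) @[x --> F] --> (0 : R).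
Proof.
split.
  move=> [fa1 fa2].
  apply: (@squeeze_cvgr _ _ _ _ (cst 0) (fun x => `|complex.Re (f x) - complex.Re a| +
      `|complex.Im (f x) - complex.Im a|)).
  - apply: nearW => x; rewrite normc_ge0/=.
    by rewrite (le_trans (normc_le_ReIm _))// ReD ImD ReN ImN.
  - exact: cvg_cst.
  - rewrite -[X in _ --> X](addr0 0); apply: cvgD.
      rewrite -(@normr0 _ R) -(subrr (complex.Re a)).
      by apply: cvg_norm; apply: cvgB => //; exact: cvg_cst.
    rewrite -(@normr0 _ R) -(subrr (complex.Im a)).
    by apply: cvg_norm; apply: cvgB => //; exact: cvg_cst.
move=> h; split.
  apply: cvg_zero; apply: norm_cvg0.
  apply: (@squeeze_cvgr _ _ _ _ (cst 0) (fun x => normc (f x - a))) => //.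
  - apply: nearW => x; rewrite normr_ge0/=.
    by rewrite (le_trans _ (normc_Re _))// ReD ReN.
  - exact: cvg_cst.
apply: cvg_zero; apply: norm_cvg0.
apply: (@squeeze_cvgr _ _ _ _ (cst 0) (fun x => normc (f x - a))) => //.
- apply: nearW => x; rewrite normr_ge0/=.
  by rewrite (le_trans _ (normc_Im _))// ImD ImN.
- exact: cvg_cst.
Qed.

Lemma ccvg_normc f a : ccvg F f a -> normc (f x) @[x --> F] --> normc a.
Proof.
move=> /ccvgP h; apply: cvg_zero; apply: norm_cvg0.
apply: (@squeeze_cvgr _ _ _ _ (cst 0) (fun x => normc (f x - a))) => //.
- by apply: nearW => x; rewrite normr_ge0/= ler_dist_normc.
- exact: cvg_cst.
Qed.

Lemma ccvg_sum (I : Type) (s : seq I) (P : pred I) (f : I -> T -> C) (a : I -> C) :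
  (forall i, ccvg F (f i) (a i)) ->
  ccvg F (fun x => \sum_(i <- s | P i) f i x) (\sum_(i <- s | P i) a i).
Proof.
move=> fa; elim: s => [|i s ih].
  by rewrite big_nil; under eq_fun do rewrite big_nil; exact: ccvg_cst.
rewrite big_cons; under eq_fun do rewrite big_cons.
by case: ifP => _ //; exact: ccvgD.
Qed.

Lemma ccvg_norm_le f a (M : R) : ProperFilter F -> ccvg F f a ->
  (\forall x \near F, normc (f x) <= M) -> normc a <= M.
Proof.
move=> PF /ccvg_normc fa h; move/(cvg_lim (@Rhausdorff R)) : (fa) => <-.
by apply: limr_le => //; apply/cvg_ex; eexists; exact: fa.
Qed.

End ccvg_theory.

(** * Power series in the unit disc: uniform Taylor and Lipschitz estimates *)

Section power_series.
Context {R : realType}.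
Local Notation C := R[i].
Local Notation normc := (@Normc.normc R).

Lemma geometric_sum_le (s : R) N : 0 <= s -> s < 1 -> \sum_(n < N) s ^+ n <= (1 - s)^-1.
Proof.
move=> s0 s1; have s10 : 0 < 1 - s by rewrite subr_gt0.
rewrite -[leRHS]div1r ler_pdivlMr//.
have := @subrX1 R s N.
have sN : 0 <= s ^+ N by rewrite exprn_ge0.
nra.
Qed.

Lemma natM_geometric_le (s : R) n : 0 <= s -> s < 1 -> n%:R * s ^+ n <= (1 - s)^-1.
Proof.
move=> s0 s1; apply: le_trans (geometric_sum_le n s0 s1).
rewrite mulrC mulr_natr -[n in _ *+ n]card_ord -sumr_const.
by apply: ler_sum => i _; apply: ler_wiXn2l => //; [exact: ltW|exact: ltnW].
Qed.

(* Evaluating a bound at radius [s] while working at radius [s ^+ 4] leaves room for the polynomial factor. *)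
Lemma root4_radius (rho : R) : 0 <= rho -> rho < 1 ->
  exists s : R, [/\ 0 < s, s < 1 & rho <= s ^+ 4].
Proof.
move=> r0 r1; exists (1 - (1 - rho) / 4); split; [lra|lra|].
set x := (1 - rho) / 4.
have x0 : 0 <= x by rewrite /x; lra.
have x1 : x <= 1 by rewrite /x; lra.
have -> : rho = 1 - 4 * x by rewrite /x; field.
have h2 : 1 - 2 * x <= (1 - x) ^+ 2 by nra.
have [h|h] := leP (1 - 2 * x) 0.
  by rewrite (@le_trans _ _ 0) ?exprn_ge0//; lra.
have := ler_pM (ltW h) (ltW h) h2 h2.
rewrite -exprD; nra.
Qed.

Definition csum (c : nat -> C) : C :=
  (limn (fun N => \sum_(n < N) complex.Re (c n))) +i*
  (limn (fun N => \sum_(n < N) complex.Im (c n))).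

Lemma geometric_dominated_series (u : nat -> R) (B s : R) : 0 <= s -> s < 1 ->
  (forall n, `|u n| <= B * s ^+ n) -> cvgn (fun N => \sum_(n < N) u n).
Proof.
move=> s0 s1 uB.
have -> : (fun N => \sum_(n < N) u n) = series u.
  by apply/funext => N; rewrite /series/= big_mkord.
apply: normed_cvg.
apply: (@series_le_cvg _ _ (geometric B s)) => //= [n|].
  exact: le_trans (normr_ge0 _) (uB n).
by apply: is_cvg_geometric_series; rewrite ger0_norm.
Qed.

Lemma ccvg_csum (c : nat -> C) (B s : R) : 0 <= s -> s < 1 ->
  (forall n, normc (c n) <= B * s ^+ n) ->
  ccvg \oo (fun N => \sum_(n < N) c n) (csum c).
Proof.
move=> s0 s1 cB; split => /=.
  under eq_fun do rewrite Re_sum.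
  apply: (@geometric_dominated_series (fun n => complex.Re (c n)) B s) => // n.
  exact: le_trans (normc_Re _) (cB n).
under eq_fun do rewrite Im_sum.
apply: (@geometric_dominated_series (fun n => complex.Im (c n)) B s) => // n.
exact: le_trans (normc_Im _) (cB n).
Qed.

Lemma normc_geometric_sum (c : nat -> C) (B s : R) N : 0 <= s -> s < 1 ->
  (forall n, normc (c n) <= B * s ^+ n) ->
  normc (\sum_(n < N) c n) <= B * (1 - s)^-1.
Proof.
move=> s0 s1 cB; apply: (le_trans (normc_sum _ _ _)).
have B0 : 0 <= B by have := cB 0; rewrite expr0 mulr1; apply: le_trans; exact: normc_ge0.
apply: (@le_trans _ _ (\sum_(n < N) B * s ^+ n)); first by apply: ler_sum => i _.
by rewrite -mulr_sumr ler_wpM2l// geometric_sum_le.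
Qed.

Lemma normc_nat n : normc (n%:R : C) = n%:R.
Proof.
by rewrite -[n%:R : C](@rmorph_nat _ _ (real_complex R)) normc_real ger0_norm.
Qed.

(** The remainder satisfies a recursion: the one of order [n + 1] is [w] times the one of order [n]
    plus [n z^(n-1) (w - z)^2]. The factor [rho ^+ 2] on the left stands for the exponent [n - 2] on
    the right, which would be truncated for [n < 2]. *)
Lemma pow_taylor2 (z w : C) (rho : R) n : normc z <= rho -> normc w <= rho ->
  normc (w ^+ n - z ^+ n - n%:R * z ^+ n.-1 * (w - z)) * rho ^+ 2 <=
  n%:R ^+ 2 * rho ^+ n * normc (w - z) ^+ 2.
Proof.
move=> zr wr; have r0 : 0 <= rho by exact: le_trans (normc_ge0 _) zr.
elim: n => [|n ih].
  by rewrite !expr0 subrr !mul0r subr0 Normc.normc0 mul0r expr0n/= !mul0r.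
rewrite /=.
have -> : w ^+ n.+1 - z ^+ n.+1 - n.+1%:R * z ^+ n * (w - z) =
   w * (w ^+ n - z ^+ n - n%:R * z ^+ n.-1 * (w - z)) + n%:R * z ^+ n.-1 * (w - z) ^+ 2.
  case: n {ih} => [|n]; first by rewrite /=; ring.
  rewrite /= !exprS -natr1; ring.
have h1 := le_normcD (w * (w ^+ n - z ^+ n - n%:R * z ^+ n.-1 * (w - z)))
   (n%:R * z ^+ n.-1 * (w - z) ^+ 2).
have r2 : 0 <= rho ^+ 2 by rewrite sqr_ge0.
apply: (le_trans (ler_wpM2r r2 h1)).
rewrite mulrDl Normc.normcM.
set A := normc (_ - _ - _) in ih *; set d := normc (w - z) in ih *.
have A0 : 0 <= A by rewrite normc_ge0.
have d0 : 0 <= d by rewrite normc_ge0.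
have t1 : normc w * A * rho ^+ 2 <= n%:R ^+ 2 * rho ^+ n.+1 * d ^+ 2.
  rewrite -mulrA [rho ^+ n.+1]exprS; apply: (@le_trans _ _ (rho * (A * rho ^+ 2))).
    by apply: ler_wpM2r => //; rewrite mulr_ge0.
  by apply: (le_trans (ler_wpM2l r0 ih)); rewrite le_eqVlt; apply/orP; left; apply/eqP; ring.
have t2 : normc (n%:R * z ^+ n.-1 * (w - z) ^+ 2) * rho ^+ 2 <= n%:R * rho ^+ n.+1 * d ^+ 2.
  rewrite 2!Normc.normcM !normcX -/d.
  rewrite normc_nat.
  case: n {ih A0 t1 h1 A} => [|n]; first by rewrite !mul0r.
  rewrite /=.
  have h : normc z ^+ n * rho ^+ 2 <= rho ^+ n.+2.
    by rewrite -[n.+2]addn2 [leRHS]exprD ler_wpM2r// lerXn2r// nnegrE normc_ge0.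
  have -> : n.+1%:R * normc z ^+ n * d ^+ 2 * rho ^+ 2 =
    n.+1%:R * d ^+ 2 * (normc z ^+ n * rho ^+ 2) by ring.
  by rewrite [leRHS]mulrAC ler_wpM2l// mulr_ge0// sqr_ge0.
apply: (le_trans (lerD t1 t2)); rewrite -!mulrDl ler_wpM2r ?sqr_ge0//.
rewrite ler_wpM2r ?exprn_ge0// -natr1.
have : 0 <= n%:R :> R by []. nra.
Qed.

Variables (a : nat -> C) (F : C -> C).
Hypothesis aF : forall z : C, normc z < 1 ->
  ccvg \oo (fun N : nat => \sum_(n < N) a n * z ^+ n) (F z).

(** The series converges at the real point [s], so its terms there tend to 0; real and imaginary
    parts are bounded separately. *)
Lemma coef_bound (s : R) : 0 <= s -> s < 1 ->
  exists2 M : R, 0 <= M & forall n, normc (a n) * s ^+ n <= M.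
Proof.
move=> s0 s1.
have ns : normc (s%:C) < 1 by rewrite normc_real ger0_norm.
have [h1 h2] := aF ns.
have bnd (f : C -> R) : (forall z w, f (z + w) = f z + f w) -> f 0 = 0 ->
    (f \o (fun N : nat => \sum_(n < N) a n * s%:C ^+ n)) x @[x --> \oo] --> f (F s%:C) ->
    exists M : R, forall n, `|f (a n * s%:C ^+ n)| <= M.
  move=> fD f0 h.
  have : cvgn (series (fun n => f (a n * s%:C ^+ n))).
    apply/cvg_ex; exists (f (F s%:C)); apply: cvg_trans h; apply: near_eq_cvg.
    apply: nearW => N; rewrite /series /= big_mkord.
    by elim/big_rec2 : _ => [|i y x _ <-] //; rewrite fD.
  move=> /cvg_series_cvg_0 /cvgP /cvg_seq_bounded [M [Mr hM]].
  by exists (M + 1) => n; apply: (hM (M + 1)); rewrite ?ltrDl.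
have [M1 hM1] := bnd _ (@ReD R) erefl h1.
have [M2 hM2] := bnd _ (@ImD R) erefl h2.
exists (M1 + M2) => [|n].
  by have := lerD (hM1 0) (hM2 0); apply: le_trans; rewrite addr_ge0.
have -> : normc (a n) * s ^+ n = normc (a n * s%:C ^+ n).
  by rewrite Normc.normcM normcX normc_real ger0_norm.
by rewrite (le_trans (normc_le_ReIm _))// lerD.
Qed.

Lemma coef_geometric (rho : R) : 0 <= rho -> rho < 1 ->
  exists B s : R, [/\ 0 <= B, 0 < s, s < 1 &
    forall n, (n%:R + 1) ^+ 2 * normc (a n) * rho ^+ n <= B * s ^+ n].
Proof.
move=> r0 r1; have [s [s0 s1 rs]] := root4_radius r0 r1.
have [M M0 hM] := coef_bound (ltW s0) s1.
pose L := (1 - s)^-1 + 1.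
have L0 : 0 <= L by rewrite addr_ge0// invr_ge0 subr_ge0 ltW.
exists (M * L ^+ 2), s; split => //; first by rewrite mulr_ge0 ?sqr_ge0.
move=> n.
have sn0 : 0 <= s ^+ n by rewrite exprn_ge0 ?ltW.
have hn : (n%:R + 1) * s ^+ n <= L.
  rewrite mulrDl mul1r; apply: lerD; first by apply: natM_geometric_le => //; exact: ltW.
  by apply: exprn_ile1; exact: ltW.
have hrs : rho ^+ n <= (s ^+ n) ^+ 4 by rewrite -exprM mulnC exprM lerXn2r// nnegrE// exprn_ge0 // ltW.
have n0 : 0 <= n%:R + 1 :> R by rewrite addr_ge0.
apply: (@le_trans _ _ ((n%:R + 1) ^+ 2 * normc (a n) * (s ^+ n) ^+ 4)).
  by rewrite ler_wpM2l// mulr_ge0 ?sqr_ge0 ?normc_ge0.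
(* Of the four factors [s ^+ n], one bounds the coefficient, two absorb the square of [n + 1], and
   one is left as geometric ratio. *)
have -> : (n%:R + 1) ^+ 2 * normc (a n) * (s ^+ n) ^+ 4 =
  (normc (a n) * s ^+ n) * ((n%:R + 1) * s ^+ n) ^+ 2 * s ^+ n by ring.
rewrite ler_wpM2r// ler_pM//.
- by rewrite mulr_ge0// normc_ge0.
- by rewrite sqr_ge0.
- by rewrite lerXn2r// nnegrE// mulr_ge0.
Qed.

(** The derivative [F'], summed term by term; at [n = 0] the truncated exponent is harmless because
    of the factor [n%:R]. *)
Definition pderiv (z : C) : C := csum (fun n => n%:R * a n * z ^+ n.-1).

Lemma pderiv_term_bound (rho : R) : 0 < rho -> rho < 1 ->
  exists B s : R, [/\ 0 <= B, 0 < s, s < 1 &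
    forall z n, normc z <= rho -> normc (n%:R * a n * z ^+ n.-1) <= B * s ^+ n].
Proof.
move=> r0 r1; have [B [s [B0 s0 s1 hB]]] := coef_geometric (ltW r0) r1.
exists (B / rho), s; split => //; first by rewrite divr_ge0// ltW.
move=> z n zr; rewrite [leRHS]mulrAC ler_pdivlMr//; apply: le_trans (hB n).
rewrite !Normc.normcM normcX normc_nat.
case: n => [|n]; first by rewrite !mul0r !mulr_ge0 ?sqr_ge0 ?normc_ge0.
rewrite /= [rho ^+ n.+1]exprSr [leRHS]mulrA ler_wpM2r ?(ltW r0)//.
apply: ler_pM; rewrite ?mulr_ge0 ?normc_ge0 ?exprn_ge0 ?normc_ge0//.
- rewrite ler_wpM2r ?normc_ge0//.
  have : 0 <= n.+1%:R :> R by []. nra.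
- by rewrite lerXn2r// ?nnegrE ?normc_ge0// ltW.
Qed.

Lemma ccvg_pderiv z : normc z < 1 ->
  ccvg \oo (fun N => \sum_(n < N) n%:R * a n * z ^+ n.-1) (pderiv z).
Proof.
move=> z1.
have r0 : 0 < (normc z + 1) / 2 by have := normc_ge0 z; lra.
have r1 : (normc z + 1) / 2 < 1 by lra.
have [B [s [B0 s0 s1 hB]]] := pderiv_term_bound r0 r1.
apply: (ccvg_csum (ltW s0) s1) => n; apply: hB; lra.
Qed.

(** [pow_taylor2] summed against the coefficients. This uniform quadratic remainder is the only form
    in which complex differentiability enters: both Lipschitz bounds and the chain rule along curves
    are read off from it. *)
Lemma pseries_taylor2 (rho : R) : 0 < rho -> rho < 1 ->
  exists2 K : R, 0 <= K & forall z w, normc z <= rho -> normc w <= rho ->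
  normc (F w - F z - pderiv z * (w - z)) <= K * normc (w - z) ^+ 2.
Proof.
move=> r0 r1; have [B [s [B0 s0 s1 hB]]] := coef_geometric (ltW r0) r1.
exists (B / rho ^+ 2 * (1 - s)^-1).
  by rewrite mulr_ge0 ?divr_ge0 ?sqr_ge0// invr_ge0 subr_ge0 ltW.
move=> z w zr wr.
have z1 : normc z < 1 by exact: le_lt_trans zr r1.
have w1 : normc w < 1 by exact: le_lt_trans wr r1.
have h := ccvgB (ccvgB (aF w1) (aF z1)) (ccvgM (ccvg_pderiv z1) (ccvg_cst (w - z))).
apply: (ccvg_norm_le _ (h _ _ _ _)); apply: nearW => N.
rewrite mulr_suml -!sumrB.
rewrite [leRHS]mulrAC.
apply: (@normc_geometric_sum (fun n => a n * w ^+ n - a n * z ^+ n -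
  n%:R * a n * z ^+ n.-1 * (w - z)) _ s N (ltW s0) s1) => n.
have -> : a n * w ^+ n - a n * z ^+ n - n%:R * a n * z ^+ n.-1 * (w - z) =
  a n * (w ^+ n - z ^+ n - n%:R * z ^+ n.-1 * (w - z)) by ring.
rewrite Normc.normcM.
have r20 : 0 < rho ^+ 2 by rewrite exprn_gt0.
have -> : B / rho ^+ 2 * normc (w - z) ^+ 2 * s ^+ n =
  (B * s ^+ n * normc (w - z) ^+ 2) / rho ^+ 2 by ring.
rewrite ler_pdivlMr// -[leLHS]mulrA.
apply: (@le_trans _ _ (normc (a n) * (n%:R ^+ 2 * rho ^+ n * normc (w - z) ^+ 2))).
  by rewrite ler_wpM2l ?normc_ge0// pow_taylor2.
apply: (@le_trans _ _ ((n%:R + 1) ^+ 2 * normc (a n) * rho ^+ n * normc (w - z) ^+ 2)).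
  rewrite mulrA ler_wpM2r ?sqr_ge0// mulrA ler_wpM2r ?exprn_ge0 ?(ltW r0)//.
  rewrite mulrC ler_wpM2r ?normc_ge0//.
  have : 0 <= n%:R :> R by []. nra.
by rewrite ler_wpM2r ?sqr_ge0.
Qed.

(** Adding the expansion at [z] evaluated at [w] to the expansion at [w] evaluated at [z] cancels
    [F] and leaves [(pderiv w - pderiv z) * (w - z)]. *)
Lemma pderiv_lipschitz (rho : R) : 0 < rho -> rho < 1 ->
  exists2 K : R, 0 <= K & forall z w, normc z <= rho -> normc w <= rho ->
  normc (pderiv w - pderiv z) <= K * normc (w - z).
Proof.
move=> r0 r1; have [K K0 hK] := pseries_taylor2 r0 r1.
exists (2 * K); first by rewrite mulr_ge0.
move=> z w zr wr.
have [->|wz] := eqVneq w z; first by rewrite !subrr Normc.normc0 mulr0.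
have d0 : 0 < normc (w - z) by rewrite normc_gt0 subr_eq0.
rewrite -(ler_pM2r d0) -Normc.normcM.
have -> : (pderiv w - pderiv z) * (w - z) =
  (F w - F z - pderiv z * (w - z)) + (F z - F w - pderiv w * (z - w)) by ring.
rewrite (le_trans (le_normcD _ _))//.
have h1 := hK _ _ zr wr; have h2 := hK _ _ wr zr.
by rewrite (normcB_sym z w) in h2; move: h1 h2; rewrite expr2; lra.
Qed.

Lemma pseries_lipschitz (rho : R) : 0 < rho -> rho < 1 ->
  exists2 K : R, 0 <= K & forall z w, normc z <= rho -> normc w <= rho ->
  normc (F w - F z) <= K * normc (w - z).
Proof.
move=> r0 r1; have [K K0 hK] := pseries_taylor2 r0 r1.
have [B [s [B0 s0 s1 hB]]] := pderiv_term_bound r0 r1.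
have s10 : 0 <= (1 - s)^-1 by rewrite invr_ge0 subr_ge0 ltW.
exists (B * (1 - s)^-1 + K * (2 * rho)); first by rewrite addr_ge0 ?mulr_ge0// ltW.
move=> z w zr wr.
have Dz : normc (pderiv z) <= B * (1 - s)^-1.
  apply: (ccvg_norm_le _ (ccvg_pderiv (le_lt_trans zr r1))); apply: nearW => N.
  by apply: (@normc_geometric_sum (fun n => n%:R * a n * z ^+ n.-1) _ s N (ltW s0) s1) => n;
    exact: hB.
have -> : F w - F z = (F w - F z - pderiv z * (w - z)) + pderiv z * (w - z) by ring.
rewrite (le_trans (le_normcD _ _))// Normc.normcM.
have h1 := hK _ _ zr wr.
have d0 : 0 <= normc (w - z) by exact: normc_ge0.
have d2 : normc (w - z) <= 2 * rho by have := le_normcB w z; lra.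
have h2 := ler_wpM2r d0 Dz.
have h3 : K * normc (w - z) ^+ 2 <= K * (2 * rho) * normc (w - z).
  by rewrite expr2 [leLHS]mulrA ler_wpM2r// ler_wpM2l.
lra.
Qed.

End power_series.

(** * Real powers, and convexity and monotonicity of the gradient of [|w|^p] *)

Section powR_extra.
Context {R : realType}.
Implicit Types s t : R.

Lemma cvg_powR {T : Type} {F : set_system T} {FF : Filter F} (f : T -> R) (a s : R) :
  0 < s -> (forall x, 0 <= f x) -> 0 <= a -> f @ F --> a ->
  (fun x => f x `^ s) @ F --> a `^ s.
Proof.
move=> s0 f0; rewrite le_eqVlt => /predU1P[<- fa|a0 fa].
  rewrite powR0 ?gt_eqF//; apply/cvgr0Pnorm_lt => e e0.
  have e1 : 0 < e `^ s^-1 by rewrite powR_gt0.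
  move/cvgr0Pnorm_lt : fa => /(_ _ e1); apply: filterS => x.
  rewrite !ger0_norm ?powR_ge0// => h.
  have := gt0_ltr_powR s0 (f0 x) (powR_ge0 _ _) h.
  by rewrite -powRrM mulVf ?gt_eqF// powRr1 ?ltW.
have : {for a, continuous (@powR R ^~ s)}.
  by apply: differentiable_continuous; apply/derivable1_diffP; case: (is_derive1_powR s a0).
by move=> h; exact: (continuous_cvg _ h fa).
Qed.

Lemma pow1R s : 1 `^ s = 1 :> R.
Proof. by rewrite powR1. Qed.

(** Young's inequality for the exponents [1 / s] and [1 / (1 - s)]: the concave power lies below its
    tangent at 1. *)
Lemma powR_le_linear (s t : R) : 0 < s -> s <= 1 -> 0 <= t -> t `^ s <= s * t + (1 - s).
Proof.
move=> s0; rewrite le_eqVlt => /predU1P[->|s1] t0.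
  by rewrite powRr1// mul1r subrr addr0.
have h : s^-1^-1 + (1 - s)^-1^-1 = 1 by rewrite !invrK; ring.
have := @conjugate_powR _ (t `^ s) 1 s^-1 (1 - s)^-1 (powR_ge0 _ _) ler01.
rewrite !invr_gt0 subr_gt0 => /(_ s0 s1 h).
by rewrite mulr1 -powRrM mulfV ?gt_eqF// powRr1// powR1 !invrK mul1r mulrC.
Qed.

(** For [s <= 1] the tangent bound gives the constant [1 / s], for [s > 1] the inequality [t^s <= t]
    gives the constant 1; their sum serves both. It is used with [s = p - 1], which treats [p < 2]
    and [p >= 2] alike. *)
Lemma one_sub_le_powR (s t : R) : 0 < s -> 0 <= t <= 1 ->
  1 - t <= (1 + s^-1) * (1 - t `^ s).
Proof.
move=> s0 /andP[t0 t1].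
have si : 0 <= s^-1 by rewrite invr_ge0 ltW.
have [s1|s1] := leP s 1.
  have h := powR_le_linear s0 s1 t0.
  have : s * (1 - t) <= 1 - t `^ s by lra.
  have ts1 : 0 <= 1 - t `^ s.
    by rewrite subr_ge0 -[leRHS](pow1R s) ge0_ler_powR// ?nnegrE//; exact: ltW.
  move=> /(ler_wpM2l si); rewrite mulrA mulVf ?gt_eqF// mul1r mulrDl mul1r => h2.
  by rewrite (le_trans h2)// lerDr.
have h : t `^ s <= t.
  have [->|tn0] := eqVneq t 0; first by rewrite powR0// gt_eqF.
  have tp : 0 < t <= 1 by rewrite lt_def tn0 t0.
  by have := ger_powR tp (ltW s1); rewrite powRr1.
have h2 : 0 <= 1 - t `^ s by lra.
have : 1 - t <= 1 - t `^ s by lra.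
move=> h1; rewrite mulrDl mul1r (le_trans h1)// lerDl mulr_ge0//.
Qed.

End powR_extra.

Section power_gradient.
Context {R : realType}.
Local Notation C := R[i].
Local Notation normc := (@Normc.normc R).
Variable p : R.
Hypothesis p1 : 1 < p.
Implicit Types a b w : C.

Let p0 : 0 < p. Proof. exact: lt_trans p1. Qed.
Let pm0 : 0 < p - 1. Proof. by rewrite subr_gt0. Qed.

Definition Np w : R := normc w `^ p.
(* [p / 2 * Gp w] is the Wirtinger derivative of [|w| ^ p] with respect to [w]. *)
Definition Gp w : C := (normc w `^ (p - 2))%:C * conjc w.

Lemma Np_ge0 w : 0 <= Np w. Proof. exact: powR_ge0. Qed.

Lemma normc_Gp w : normc (Gp w) = normc w `^ (p - 1).
Proof.
rewrite /Gp Normc.normcM normc_real ger0_norm ?powR_ge0// normc_conjc mulrC.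
have [->|w0] := eqVneq (normc w) 0; first by rewrite mul0r powR0 ?gt_eqF.
have -> : p - 1 = 1 + (p - 2) by ring.
by rewrite (@powRD _ _ 1) ?w0 ?implybT// powRr1// normc_ge0.
Qed.

Lemma mul_normc_powR w : normc w * normc w `^ (p - 1) = Np w.
Proof. by rewrite mulr_powRB1 ?normc_ge0. Qed.

Lemma mul_Gp w : w * Gp w = (Np w)%:C.
Proof.
rewrite /Gp mulrCA mul_conjc -rmorphM; congr (_ %:C).
have [w0|w0] := eqVneq (normc w) 0.
  by rewrite /Np w0 expr0n/= mulr0 powR0 ?gt_eqF.
rewrite -(powR_mulrn 2)%R ?normc_ge0// -powRD ?w0 ?implybT//.
by congr (_ `^ _); ring.
Qed.

Lemma Re_mul_Gp_le a b : complex.Re (b * Gp a) <= Np b / p + (1 - p^-1) * Np a.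
Proof.
apply: (le_trans (Re_le_normc _)); rewrite Normc.normcM normc_Gp.
have h : p^-1 + (p / (p - 1))^-1 = 1.
  by rewrite invf_div; field; rewrite !gt_eqF.
have q0 : 0 < p / (p - 1) by rewrite divr_gt0.
apply: (le_trans (conjugate_powR (normc_ge0 b) (powR_ge0 _ _) p0 q0 h)).
rewrite -powRrM mulrCA mulfV ?gt_eqF// mulr1 -/(Np a) -/(Np b) lerD2l mulrC.
by rewrite invf_div mulrBl div1r mulfV ?gt_eqF.
Qed.

(** Young's inequality for [b * Gp a], combined with [a * Gp a = |a|^p]. No derivative is taken, so
    [a = 0] is no exception. *)
Lemma Np_convex a b : Np a + p * complex.Re ((b - a) * Gp a) <= Np b.
Proof.
rewrite mulrBl ReD ReN mul_Gp /= mulrBr.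
have := ler_wpM2l (ltW p0) (Re_mul_Gp_le a b).
have -> : p * (Np b / p + (1 - p^-1) * Np a) = Np b + (p - 1) * Np a.
  by field; rewrite gt_eqF.
lra.
Qed.

Lemma Np_convex_upper a b : Np b <= Np a + p * complex.Re ((b - a) * Gp b).
Proof.
have := Np_convex b a.
have -> : (a - b) * Gp b = - ((b - a) * Gp b) by rewrite -mulNr opprB.
by rewrite ReN; lra.
Qed.

Lemma Gp_mono a b : 0 <= complex.Re ((a - b) * (Gp a - Gp b)).
Proof.
have h := Np_convex a b; have h1 := Np_convex b a.
have -> : (a - b) * (Gp a - Gp b) = - ((b - a) * Gp a + (a - b) * Gp b) by ring.
rewrite ReN ReD; rewrite -(pmulr_rge0 _ p0); lra.
Qed.

Lemma cvg_Np {T : Type} {F : set_system T} {FF : Filter F} (f : T -> C) a :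
  ccvg F f a -> (fun x => Np (f x)) @ F --> Np a.
Proof.
by move=> fa; apply: cvg_powR => // [x||]; rewrite ?normc_ge0//; exact: ccvg_normc.
Qed.

Lemma ccvg_Gp {T : Type} {F : set_system T} {FF : Filter F} (f : T -> C) a :
  ccvg F f a -> ccvg F (fun x => Gp (f x)) (Gp a).
Proof.
move=> fa; have [a0|a0] := eqVneq a 0.
  apply/ccvgP; rewrite a0 /Gp conjc0 mulr0.
  under eq_fun do rewrite subr0 normc_Gp.
  rewrite -(@powR0 R (p - 1)) ?gt_eqF//.
  apply: cvg_powR => // [x|]; first exact: normc_ge0.
  by rewrite -Normc.normc0 -a0; exact: ccvg_normc.
apply: ccvgM; last exact: ccvg_conjc.
apply: ccvg_real.
have na0 : 0 < normc a by rewrite normc_gt0.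
have : {for normc a, continuous (@powR R ^~ (p - 2))}.
  by apply: differentiable_continuous; apply/derivable1_diffP; case: (is_derive1_powR (p - 2) na0).
by move=> h; exact: (continuous_cvg _ h (ccvg_normc fa)).
Qed.

(* With [x = |a|], [y = |b|], [u = x ^ (p - 2)], [v = y ^ (p - 2)] and
   [k = x y - Re (a conj b)], the right-hand factor is
   [(x - y) (u x - v y) + (u + v) k] while [|a - b| ^ 2 = (x - y) ^ 2 + 2 k]. *)
Lemma Gp_mono_lower a b :
  normc (a - b) ^+ 2 * (normc a `^ (p - 1)) ^+ 2 <=
  (2 + (p - 1)^-1) * complex.Re ((a - b) * (Gp a - Gp b)) * (Np a + Np b).
Proof.
have K0 : 0 <= 2 + (p - 1)^-1 by rewrite addr_ge0// invr_ge0 ltW.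
have [a0|a0] := eqVneq a 0.
  rewrite {2}a0 Normc.normc0 powR0 ?gt_eqF// expr0n/= mulr0.
  by rewrite mulr_ge0 ?(addr_ge0 (Np_ge0 _) (Np_ge0 _))// mulr_ge0 ?Gp_mono.
have [b0|b0] := eqVneq b 0.
  rewrite b0 /(Gp 0) conjc0 mulr0 !subr0 mul_Gp /= /(Np 0) Normc.normc0 powR0 ?gt_eqF// addr0.
  rewrite -exprMn mul_normc_powR expr2 -mulrA ler_peMl ?mulr_ge0 ?Np_ge0//.
  have : 0 <= (p - 1)^-1 by rewrite invr_ge0 ltW.
  lra.
set x := normc a; set y := normc b.
have x0 : 0 < x by rewrite normc_gt0.
have y0 : 0 < y by rewrite normc_gt0.
set u := x `^ (p - 2); set v := y `^ (p - 2).
have u0 : 0 < u by rewrite powR_gt0.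
have v0 : 0 < v by rewrite powR_gt0.
have pw z : 0 < z -> z `^ (p - 1) = z `^ (p - 2) * z.
  move=> z0; have -> : p - 1 = 1 + (p - 2) by ring.
  have zn : z != 0 by rewrite gt_eqF.
  by rewrite (@powRD _ _ 1) ?zn ?implybT// powRr1 ?ltW// mulrC.
have pw2 z : 0 < z -> z `^ p = z `^ (p - 2) * z ^+ 2.
  move=> z0; rewrite -(mulr_powRB1 (ltW z0) p0) pw// expr2; ring.
have NaE : Np a = u * x ^+ 2 by rewrite /Np pw2.
have NbE : Np b = v * y ^+ 2 by rewrite /Np pw2.
set c := complex.Re (a * conjc b).
pose k := x * y - c.
have k0 : 0 <= k.
  rewrite subr_ge0 (le_trans (Re_le_normc _))// Normc.normcM normc_conjc//.
have dE : normc (a - b) ^+ 2 = (x - y) ^+ 2 + 2 * k.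
  rewrite /k /c sqrrB /x /y !normc_sqr; case: (a) (b) => [a1 a2] [b1 b2] /=.
  rewrite [in RHS]mulrBr -mulr_natr; ring.
have MonE : complex.Re ((a - b) * (Gp a - Gp b)) = (x - y) * (u * x - v * y) + (u + v) * k.
  rewrite mulrBl !mulrBr !ReD !ReN !ReD !ReN !mul_Gp /= NaE NbE.
  have -> : complex.Re (a * Gp b) = v * c.
    by rewrite /Gp mulrCA ReMl.
  have -> : complex.Re (b * Gp a) = u * c.
    rewrite /Gp mulrCA ReMl /c; congr (_ * _); case: (a) (b) => [a1 a2] [b1 b2] /=; ring.
  rewrite /k; ring.
rewrite dE MonE NaE NbE pw//.
rewrite -/u.
have P1 : 2 * k * (u * x) ^+ 2 <= (2 + (p - 1)^-1) * ((u + v) * k) * (u * x ^+ 2 + v * y ^+ 2).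
  have h1 : 2 <= 2 + (p - 1)^-1 by rewrite lerDl invr_ge0 ltW.
  have e1 : 2 * k * (u * x) ^+ 2 = 2 * (u * k) * (u * x ^+ 2) by ring.
  have v2 : 0 <= v * y ^+ 2 by rewrite mulr_ge0 ?sqr_ge0 ?ltW.
  have u2 : 0 <= u * x ^+ 2 by rewrite mulr_ge0 ?sqr_ge0 ?ltW.
  have uk : 0 <= u * k by exact: mulr_ge0 (ltW u0) k0.
  have vk : 0 <= v * k by exact: mulr_ge0 (ltW v0) k0.
  rewrite e1; apply: ler_pM; [by rewrite mulr_ge0|by []| |by rewrite lerDl].
  apply: ler_pM => //; by rewrite mulrDl lerDl.
have P2 : (x - y) ^+ 2 * (u * x) ^+ 2 <=
    (2 + (p - 1)^-1) * ((x - y) * (u * x - v * y)) * (u * x ^+ 2 + v * y ^+ 2).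
  (* With [t] the ratio of the smaller modulus to the larger, the radial part [(x - y) (u x - v y)]
     becomes [(1 - t) (1 - t^(p-1))] times a power of the larger modulus, so that this comparison is
     all that is needed. *)
  have key t : 0 <= t <= 1 -> 1 - t <= (2 + (p - 1)^-1) * (1 - t `^ (p - 1)).
    move=> t01; apply: (le_trans (one_sub_le_powR pm0 t01)).
    have : 0 <= 1 - t `^ (p - 1).
      move: t01 => /andP[t0 t1]; rewrite subr_ge0 -[leRHS](pow1R (p - 1)) ge0_ler_powR// ?nnegrE//; exact: ltW.
    by move=> h; rewrite ler_wpM2r//; lra.
  have v2 : 0 <= v * y ^+ 2 by rewrite mulr_ge0 ?sqr_ge0 ?ltW.
  have u2 : 0 <= u * x ^+ 2 by rewrite mulr_ge0 ?sqr_ge0 ?ltW.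
  have uxE : u * x = x `^ (p - 1) by rewrite pw.
  have vyE : v * y = y `^ (p - 1) by rewrite pw.
  have [yx|xy] := leP y x.
    pose t := y / x.
    have t01 : 0 <= t <= 1.
      by apply/andP; split; [exact: divr_ge0 (ltW y0) (ltW x0)|rewrite ler_pdivrMr// mul1r].
    have yE : y = t * x by rewrite /t divfK// gt_eqF.
    have vE : v * y = t `^ (p - 1) * (u * x).
      by rewrite vyE uxE {1}yE powRM ?(ltW x0)//; case/andP : t01.
    have kt := key t t01; move: (t `^ (p - 1)) kt vE => q kt vE.
    have -> : (x - y) ^+ 2 * (u * x) ^+ 2 = (1 - t) * ((1 - t) * u * x ^+ 2) * (u * x ^+ 2).
      by rewrite yE; ring.
    have -> : (x - y) * (u * x - v * y) = (1 - q) * ((1 - t) * u * x ^+ 2).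
      by rewrite vE {1}yE; ring.
    have w0 : 0 <= (1 - t) * u * x ^+ 2.
      by rewrite mulr_ge0 ?sqr_ge0// mulr_ge0 ?(ltW u0)// subr_ge0; case/andP : t01.
    have t0 : 0 <= 1 - t by rewrite subr_ge0; case/andP : t01.
    apply: ler_pM => //; [by rewrite mulr_ge0| |by rewrite lerDl].
    by rewrite [leRHS]mulrA ler_wpM2r.
  pose t := x / y.
  have t01 : 0 <= t <= 1.
    by apply/andP; split; [exact: divr_ge0 (ltW x0) (ltW y0)|rewrite ler_pdivrMr// mul1r ltW].
  have xE : x = t * y by rewrite /t divfK// gt_eqF.
  have uE : u * x = t `^ (p - 1) * (v * y).
    by rewrite uxE vyE {1}xE powRM ?(ltW y0)//; case/andP : t01.
  have q1 : t `^ (p - 1) <= 1.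
    move: t01 => /andP[t0 t1]; rewrite -[leRHS](pow1R (p - 1)) ge0_ler_powR// ?nnegrE//; exact: ltW.
  have q0 : 0 <= t `^ (p - 1) by rewrite powR_ge0.
  have kt := key t t01; move: (t `^ (p - 1)) kt uE q1 q0 => q kt uE q1 q0.
  have t0 : 0 <= 1 - t by rewrite subr_ge0; case/andP : t01.
  have -> : (x - y) * (u * x - v * y) = (1 - q) * ((1 - t) * v * y ^+ 2).
    by rewrite uE {1}xE; ring.
  have w0 : 0 <= (1 - t) * v * y ^+ 2 by rewrite mulr_ge0 ?sqr_ge0// mulr_ge0 ?(ltW v0).
  have -> : (x - y) ^+ 2 * (u * x) ^+ 2 =
      ((1 - t) * ((1 - t) * v * y ^+ 2) * (v * y ^+ 2)) * q ^+ 2.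
    by rewrite uE {1}xE; ring.
  have l0 : 0 <= (1 - t) * ((1 - t) * v * y ^+ 2) by rewrite mulr_ge0.
  have q2 : q ^+ 2 <= 1 by rewrite expr_le1.
  apply: (@le_trans _ _ ((1 - t) * ((1 - t) * v * y ^+ 2) * (v * y ^+ 2))).
    by rewrite ler_piMr// mulr_ge0.
  apply: ler_pM => //; [|by rewrite lerDr].
  by rewrite [leRHS]mulrA ler_wpM2r.
rewrite mulrDl; apply: (le_trans (lerD P2 P1)).
by rewrite -mulrDl -mulrDr.
Qed.

(** The square root of [Gp_mono_lower], by [4 U V <= (l U + V / l)^2]. The weight is kept free: it
    will absorb the size of the rotation and afterwards be made arbitrarily small in the passage to
    the limit. *)
Lemma Gp_mono_amgm a b (l : R) : 0 < l ->
  2 * (normc (a - b) * normc a `^ (p - 1)) <=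
  l * ((2 + (p - 1)^-1) * complex.Re ((a - b) * (Gp a - Gp b))) + l^-1 * (Np a + Np b).
Proof.
move=> l0; have := Gp_mono_lower a b; rewrite -exprMn.
set X := _ * _ `^ _; set U := _ * complex.Re _; set V := _ + _ => h.
have U0 : 0 <= U.
  by rewrite mulr_ge0 ?Gp_mono// addr_ge0// invr_ge0 ltW.
have V0 : 0 <= V by rewrite addr_ge0 ?Np_ge0.
have X0 : 0 <= X by rewrite mulr_ge0 ?normc_ge0 ?powR_ge0.
have hsq : (2 * X) ^+ 2 <= (l * U + l^-1 * V) ^+ 2.
  have e : (l * U + l^-1 * V) ^+ 2 = (l * U - l^-1 * V) ^+ 2 + 4 * (U * V).
    by field; rewrite gt_eqF.
  rewrite e exprMn; have := sqr_ge0 (l * U - l^-1 * V).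
  have -> : 2 ^+ 2 = 4 :> R by rewrite expr2; ring.
  lra.
have r0 : 0 <= l * U + l^-1 * V.
  by rewrite addr_ge0// mulr_ge0 ?invr_ge0// ltW.
by rewrite -(@ler_pXn2r _ 2)// ?nnegrE// mulr_ge0.
Qed.

End power_gradient.

(** * Integration of complex-valued functions *)

Section complex_integral.
Context {d : measure_display} {T : measurableType d} {R : realType}.
Local Notation C := R[i].
Local Notation normc := (@Normc.normc R).
Variables (mu : {measure set T -> \bar R}) (D : set T).
Hypothesis mD : measurable D.
Implicit Types (f g : T -> C).

Definition cmeas f := measurable_fun D (fun x => complex.Re (f x)) /\
  measurable_fun D (fun x => complex.Im (f x)).

Definition cintg f := mu.-integrable D (fun x => (complex.Re (f x))%:E) /\
  mu.-integrable D (fun x => (complex.Im (f x))%:E).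

Lemma eq_cmeas f g : (forall x, D x -> f x = g x) -> cmeas f -> cmeas g.
Proof.
move=> fg [m1 m2]; split.
  apply: eq_measurable_fun m1 => x; rewrite inE => Dx; by rewrite fg.
apply: eq_measurable_fun m2 => x; rewrite inE => Dx; by rewrite fg.
Qed.

Lemma cmeas_cst c : cmeas (fun=> c).
Proof. by split; exact: measurable_cst. Qed.

Lemma cmeas_real (u : T -> R) : measurable_fun D u -> cmeas (fun x => (u x)%:C).
Proof. by move=> mu'; split => //=. Qed.

Lemma cmeasD f g : cmeas f -> cmeas g -> cmeas (fun x => f x + g x).
Proof.
move=> [f1 f2] [g1 g2]; split.
  by under eq_fun do rewrite ReD; exact: measurable_funD.
by under eq_fun do rewrite ImD; exact: measurable_funD.
Qed.

Lemma cmeasM f g : cmeas f -> cmeas g -> cmeas (fun x => f x * g x).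
Proof.
move=> [f1 f2] [g1 g2]; split.
  by under eq_fun do rewrite ReM; apply: measurable_funB; exact: measurable_funM.
by under eq_fun do rewrite ImM; apply: measurable_funD; exact: measurable_funM.
Qed.

Lemma cmeasN f : cmeas f -> cmeas (fun x => - f x).
Proof.
move=> mf; rewrite (_ : (fun x => - f x) = fun x => (-1) * f x).
  by apply: cmeasM => //; exact: cmeas_cst.
by apply/funext => x; rewrite mulN1r.
Qed.

Lemma cmeasX f n : cmeas f -> cmeas (fun x => f x ^+ n).
Proof.
move=> mf; elim: n => [|n ih].
  by under eq_fun do rewrite expr0; exact: cmeas_cst.
by under eq_fun do rewrite exprS; exact: cmeasM.
Qed.

Lemma cmeas_conjc f : cmeas f -> cmeas (fun x => conjc (f x)).
Proof.
move=> [f1 f2]; split.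
  by rewrite (_ : (fun x => _) = fun x => complex.Re (f x))//; apply/funext => x; case: (f x).
rewrite (_ : (fun x => _) = fun x => - complex.Im (f x)).
  exact: measurableT_comp.
by apply/funext => x; case: (f x).
Qed.

Lemma cmeas_sum (I : Type) (s : seq I) (h : I -> T -> C) :
  (forall i, cmeas (h i)) -> cmeas (fun x => \sum_(i <- s) h i x).
Proof.
move=> mh; elim: s => [|i s ih].
  by under eq_fun do rewrite big_nil; exact: cmeas_cst.
by under eq_fun do rewrite big_cons; exact: cmeasD.
Qed.

Lemma measurable_normc f : cmeas f -> measurable_fun D (fun x => normc (f x)).
Proof.
move=> [f1 f2]; under eq_fun do rewrite normcE.
apply: (@measurableT_comp _ _ _ _ _ _ (@Num.sqrt R)).
  by apply: continuous_measurable_fun; exact: sqrt_continuous.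
by apply: measurable_funD; apply: measurable_funX.
Qed.

Lemma measurable_Np (p : R) f : cmeas f -> measurable_fun D (fun x => Np p (f x)).
Proof.
move=> mf; rewrite /Np.
apply: (@measurableT_comp _ _ _ _ _ _ (@powR R ^~ p)).
  exact: measurable_powR.
exact: measurable_normc.
Qed.

Lemma cmeas_Gp (p : R) f : cmeas f -> cmeas (fun x => Gp p (f x)).
Proof.
move=> mf; apply: cmeasM; last exact: cmeas_conjc.
apply: cmeas_real; apply: (@measurableT_comp _ _ _ _ _ _ (@powR R ^~ (p - 2))).
  exact: measurable_powR.
exact: measurable_normc.
Qed.

Lemma cmeas_cvg (h : nat -> T -> C) f : (forall n, cmeas (h n)) ->
  (forall x, D x -> ccvg \oo (fun n => h n x) (f x)) -> cmeas f.
Proof.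
move=> mh hf; split.
  apply: (@measurable_fun_cvg _ _ _ D (fun n x => complex.Re (h n x))).
    by move=> n; case: (mh n).
  by move=> x Dx; case: (hf x Dx).
apply: (@measurable_fun_cvg _ _ _ D (fun n x => complex.Im (h n x))).
  by move=> n; case: (mh n).
by move=> x Dx; case: (hf x Dx).
Qed.

Lemma cintg_cmeas f : cintg f -> cmeas f.
Proof. by move=> [/measurable_int f1 /measurable_int f2]; split; exact/measurable_EFinP. Qed.

Lemma cintg_bound f (g : T -> R) : cmeas f ->
  mu.-integrable D (fun x => (g x)%:E) ->
  (forall x, D x -> normc (f x) <= g x) -> cintg f.
Proof.
move=> [f1 f2] ig fg; split.
  apply: le_integrable ig => //; first exact/measurable_EFinP.
  move=> x Dx; rewrite /= lee_fin.
  by rewrite (le_trans (normc_Re _))// (le_trans (fg x Dx))// ler_norm.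
apply: le_integrable ig => //; first exact/measurable_EFinP.
move=> x Dx; rewrite /= lee_fin.
by rewrite (le_trans (normc_Im _))// (le_trans (fg x Dx))// ler_norm.
Qed.

Lemma cintg_normc f : cintg f -> mu.-integrable D (fun x => (normc (f x))%:E).
Proof.
move=> cf; have [f1 f2] := cf.
have mn : measurable_fun D (fun x => (normc (f x))%:E).
  by apply/measurable_EFinP/measurable_normc/cintg_cmeas.
have i12 := integrableD mD (integrable_norm f1) (integrable_norm f2).
apply: le_integrable i12 => // x Dx.
rewrite /= lee_fin ger0_norm ?normc_ge0// ger0_norm ?addr_ge0//.
exact: normc_le_ReIm.
Qed.

Lemma eq_cintg f g : (forall x, D x -> f x = g x) -> cintg f -> cintg g.
Proof.
move=> fg [m1 m2]; split.
  apply: eq_integrable m1 => // x; rewrite inE => Dx; by rewrite fg.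
apply: eq_integrable m2 => // x; rewrite inE => Dx; by rewrite fg.
Qed.

Lemma cintgD f g : cintg f -> cintg g -> cintg (fun x => f x + g x).
Proof.
move=> [f1 f2] [g1 g2]; split.
  by under eq_fun do rewrite ReD EFinD; exact: integrableD.
by under eq_fun do rewrite ImD EFinD; exact: integrableD.
Qed.

Lemma cintgZ c f : cintg f -> cintg (fun x => c * f x).
Proof.
move=> [f1 f2]; split.
  under eq_fun do rewrite ReM EFinB !EFinM.
  by apply: integrableB => //; exact: integrableZl.
under eq_fun do rewrite ImM EFinD !EFinM.
by apply: integrableD => //; exact: integrableZl.
Qed.

Lemma cintgN f : cintg f -> cintg (fun x => - f x).
Proof.
by move=> cf; apply: eq_cintg (cintgZ (-1) cf) => x _; rewrite mulN1r.
Qed.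

Lemma cintgB f g : cintg f -> cintg g -> cintg (fun x => f x - g x).
Proof. by move=> cf cg; apply: cintgD => //; exact: cintgN. Qed.

Lemma cintg0 : cintg (fun=> 0).
Proof. by split; exact: integrable0. Qed.

Lemma cintg_sum (I : Type) (s : seq I) (h : I -> T -> C) :
  (forall i, cintg (h i)) -> cintg (fun x => \sum_(i <- s) h i x).
Proof.
move=> ch; elim: s => [|i s ih].
  by under eq_fun do rewrite big_nil; exact: cintg0.
by under eq_fun do rewrite big_cons; exact: cintgD.
Qed.

Lemma eq_cintegral f g : (forall x, D x -> f x = g x) ->
  cintegral mu D f = cintegral mu D g.
Proof.
move=> fg; rewrite /cintegral; congr (_ +i* _); apply: eq_Rintegral => x;
  by rewrite inE => Dx; rewrite fg.
Qed.

Lemma cintegralD f g : cintg f -> cintg g ->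
  cintegral mu D (fun x => f x + g x) = cintegral mu D f + cintegral mu D g.
Proof.
move=> [f1 f2] [g1 g2]; apply: complexP; rewrite ?ReD ?ImD /=.
  by rewrite -RintegralD//; apply: eq_Rintegral => x _; rewrite ReD.
by rewrite -RintegralD//; apply: eq_Rintegral => x _; rewrite ImD.
Qed.

Lemma integrable_EFinZl (r : R) (u : T -> R) : mu.-integrable D (fun x => (u x)%:E) ->
  mu.-integrable D (fun x => (r * u x)%:E).
Proof. by move=> iu; under eq_fun do rewrite EFinM; exact: integrableZl. Qed.

Lemma cintegralZ c f : cintg f ->
  cintegral mu D (fun x => c * f x) = c * cintegral mu D f.
Proof.
move=> [f1 f2]; apply: complexP; rewrite ?ReM ?ImM /=.
  rewrite -!RintegralZl// -RintegralB//; try exact: integrable_EFinZl.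
  by apply: eq_Rintegral => x _; rewrite ReM.
rewrite -!RintegralZl// -RintegralD//; try exact: integrable_EFinZl.
by apply: eq_Rintegral => x _; rewrite ImM.
Qed.

Lemma cintegralN f : cintg f -> cintegral mu D (fun x => - f x) = - cintegral mu D f.
Proof.
move=> cf; rewrite -mulN1r -cintegralZ//.
by apply: eq_cintegral => x _; rewrite mulN1r.
Qed.

Lemma cintegralB f g : cintg f -> cintg g ->
  cintegral mu D (fun x => f x - g x) = cintegral mu D f - cintegral mu D g.
Proof. by move=> cf cg; rewrite cintegralD ?cintegralN//; exact: cintgN. Qed.

Lemma cintegral0 : cintegral mu D (fun=> 0) = 0.
Proof. by apply: complexP => /=; rewrite /Rintegral integral0. Qed.

Lemma cintegral_sum (I : Type) (s : seq I) (h : I -> T -> C) :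
  (forall i, cintg (h i)) ->
  cintegral mu D (fun x => \sum_(i <- s) h i x) = \sum_(i <- s) cintegral mu D (h i).
Proof.
move=> ch; elim: s => [|i s ih].
  by under eq_fun do rewrite big_nil; rewrite big_nil cintegral0.
rewrite big_cons -ih -cintegralD//; last exact: cintg_sum.
by apply: eq_cintegral => x _; rewrite big_cons.
Qed.

Lemma Re_cintegral_real (u : T -> R) :
  cintegral mu D (fun x => (u x)%:C) = (\int[mu]_(x in D) u x)%:C.
Proof. by apply: complexP => //=; rewrite /Rintegral integral0. Qed.

Lemma Rintegral_dominated (h : nat -> T -> R) (f g : T -> R) :
  (forall n, measurable_fun D (h n)) -> measurable_fun D f ->
  (forall x, D x -> h n x @[n --> \oo] --> f x) ->
  mu.-integrable D (fun x => (g x)%:E) ->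
  (forall n x, D x -> `|h n x| <= g x) ->
  \int[mu]_(x in D) h n x @[n --> \oo] --> \int[mu]_(x in D) f x.
Proof.
move=> mh mf hf ig hg.
have [|||||fi _ fc] := @dominated_convergence _ T R mu D mD (fun n x => (h n x)%:E)
    (fun x => (f x)%:E) (fun x => (g x)%:E).
- by move=> n; exact/measurable_EFinP.
- exact/measurable_EFinP.
- by apply: aeW => x Dx; apply: cvg_EFin; [exact: nearW|exact: hf].
- exact: ig.
- by apply: aeW => x n Dx; rewrite /= lee_fin hg.
apply: fine_cvg; rewrite fineK//; exact: integrable_fin_num.
Qed.

Lemma cintegral_dominated (h : nat -> T -> C) f (g : T -> R) :
  (forall n, cmeas (h n)) -> cmeas f ->
  (forall x, D x -> ccvg \oo (fun n => h n x) (f x)) ->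
  mu.-integrable D (fun x => (g x)%:E) ->
  (forall n x, D x -> normc (h n x) <= g x) ->
  ccvg \oo (fun n => cintegral mu D (h n)) (cintegral mu D f).
Proof.
move=> mh [mf1 mf2] hf ig hg; split => /=.
  apply: (@Rintegral_dominated (fun n x => complex.Re (h n x)) _ g) => //.
  - by move=> n; case: (mh n).
  - by move=> x Dx; case: (hf x Dx).
  - by move=> n x Dx; exact: le_trans (normc_Re _) (hg _ _ Dx).
apply: (@Rintegral_dominated (fun n x => complex.Im (h n x)) _ g) => //.
- by move=> n; case: (mh n).
- by move=> x Dx; case: (hf x Dx).
- by move=> n x Dx; exact: le_trans (normc_Im _) (hg _ _ Dx).
Qed.

Lemma Rintegral_le_bound (f g : T -> R) : measurable_fun D f ->
  mu.-integrable D (fun x => (g x)%:E) -> (forall x, D x -> `|f x| <= g x) ->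
  `|\int[mu]_(x in D) f x| <= \int[mu]_(x in D) g x.
Proof.
move=> mf ig fg.
have jf : mu.-integrable D (EFin \o f).
  apply: le_integrable ig => //; first exact/measurable_EFinP.
  by move=> x Dx; rewrite /= lee_fin (le_trans (fg x Dx))// ler_norm.
rewrite (le_trans (le_normr_Rintegral mD jf))//.
by apply: le_Rintegral => //; exact: integrable_norm.
Qed.

Lemma normc_cintegral_le f (g : T -> R) : cmeas f ->
  mu.-integrable D (fun x => (g x)%:E) -> (forall x, D x -> normc (f x) <= g x) ->
  normc (cintegral mu D f) <= 2 * \int[mu]_(x in D) g x.
Proof.
move=> [m1 m2] ig fg; rewrite (le_trans (normc_le_ReIm _))//= mulr_natl mulr2n.
apply: lerD; apply: Rintegral_le_bound => // x Dx.
- exact: le_trans (normc_Re _) (fg x Dx).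
- exact: le_trans (normc_Im _) (fg x Dx).
Qed.

End complex_integral.

(** * Tonelli and Fubini on rectangles, by extension by zero *)

Section rectangles.
Context {R : realType}.
Local Notation mu := (@lebesgue_measure R).
Variables (A B : set R).
Hypotheses (mA : measurable A) (mB : measurable B).

Lemma patch_rect (T : Type) (c : T) (f : R * R -> T) x y :
  patch (fun=> c) (A `*` B) f (x, y) =
  if x \in A then patch (fun=> c) B (fun y => f (x, y)) y else c.
Proof.
rewrite /patch; have [xA|xA] := boolP (x \in A); have [yB|yB] := boolP (y \in B).
- by rewrite ifT// inE; split; rewrite -inE.
- by rewrite ifF//; apply/negP; rewrite inE => -[_] /=; rewrite -inE (negbTE yB).
- by rewrite ifF//; apply/negP; rewrite inE => -[] /=; rewrite -inE (negbTE xA).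
- by rewrite ifF//; apply/negP; rewrite inE => -[] /=; rewrite -inE (negbTE xA).
Qed.

Lemma patch_rect2 (T : Type) (c : T) (f : R * R -> T) x y :
  patch (fun=> c) (A `*` B) f (x, y) =
  if y \in B then patch (fun=> c) A (fun x => f (x, y)) x else c.
Proof.
rewrite patch_rect /patch.
by case: (x \in A) (y \in B) => [] [].
Qed.

Local Open Scope ereal_scope.

Lemma int_patch_rect1 (f : R * R -> \bar R) x :
  \int[mu]_y (f \_ (A `*` B)) (x, y) =
  ((fun x => \int[mu]_(y in B) f (x, y)) \_ A) x.
Proof.
rewrite [RHS]patchE; under eq_integral do rewrite patch_rect.
by case: ifPn => xA; [rewrite [RHS]integral_mkcond|rewrite integral0].
Qed.

Lemma int_patch_rect2 (f : R * R -> \bar R) y :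
  \int[mu]_x (f \_ (A `*` B)) (x, y) =
  ((fun y => \int[mu]_(x in A) f (x, y)) \_ B) y.
Proof.
rewrite [RHS]patchE; under eq_integral do rewrite patch_rect2.
by case: ifPn => xA; [rewrite [RHS]integral_mkcond|rewrite integral0].
Qed.

Let mAB : measurable (A `*` B). Proof. exact: measurableX. Qed.

Section tonelli.
Variable f : R * R -> \bar R.
Hypothesis mf : measurable_fun (A `*` B) f.
Hypothesis f0 : forall z, (A `*` B) z -> 0 <= f z.

Let mfp : measurable_fun setT (f \_ (A `*` B)).
Proof. exact/(measurable_restrictT f). Qed.
Let f0p z : 0 <= (f \_ (A `*` B)) z.
Proof. by apply: erestrict_ge0. Qed.

Lemma tonelli_rect1 :
  \int[(mu \x mu)]_(z in A `*` B) f z = \int[mu]_(x in A) \int[mu]_(y in B) f (x, y).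
Proof.
rewrite integral_mkcond fubini_tonelli1// [RHS]integral_mkcond.
by apply: eq_integral => x _; rewrite -int_patch_rect1.
Qed.

Lemma tonelli_rect2 :
  \int[(mu \x mu)]_(z in A `*` B) f z = \int[mu]_(y in B) \int[mu]_(x in A) f (x, y).
Proof.
rewrite integral_mkcond fubini_tonelli2// [RHS]integral_mkcond.
by apply: eq_integral => x _; rewrite -int_patch_rect2.
Qed.

Lemma measurable_tonelli_rect2 :
  measurable_fun B (fun y => \int[mu]_(x in A) f (x, y)).
Proof.
apply/(measurable_restrictT _ mB).
rewrite (_ : _ \_ B = fubini_G mu (f \_ (A `*` B))).
  exact: measurable_fun_fubini_tonelli_G.
by apply/funext => y; rewrite /fubini_G int_patch_rect2.
Qed.

End tonelli.

Section fubini.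
Variable f : R * R -> R.
Hypothesis jf : (mu \x mu).-integrable (A `*` B) (EFin \o f).

Let jfp : (mu \x mu).-integrable setT ((EFin \o f) \_ (A `*` B)).
Proof. exact: ((@integrable_mkcond _ _ _ (mu \x mu) _ (EFin \o f) mAB).1 jf). Qed.

Lemma integrable_rect1 :
  mu.-integrable A (fun x => \int[mu]_(y in B) (f (x, y))%:E).
Proof.
apply/integrable_mkcond => //.
rewrite (_ : _ \_ A = fubini_F mu ((EFin \o f) \_ (A `*` B))).
  exact: integrable_fubini_F.
by apply/funext => y; rewrite /fubini_F int_patch_rect1.
Qed.

Lemma fubini_rect1 : \int[(mu \x mu)]_(z in A `*` B) (f z)%:E =
  \int[mu]_(x in A) \int[mu]_(y in B) (f (x, y))%:E.
Proof.
rewrite integral_mkcond -integral12_prod_meas1// [RHS]integral_mkcond.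
by apply: eq_integral => x _; exact: (int_patch_rect1 (EFin \o f)).
Qed.

Lemma fubini_rect2 : \int[(mu \x mu)]_(z in A `*` B) (f z)%:E =
  \int[mu]_(y in B) \int[mu]_(x in A) (f (x, y))%:E.
Proof.
rewrite integral_mkcond -integral21_prod_meas1// [RHS]integral_mkcond.
by apply: eq_integral => x _; exact: (int_patch_rect2 (EFin \o f)).
Qed.

End fubini.

End rectangles.

(** * Integration over the disc: polar coordinates and rotation invariance *)

Section disc_functions.
Context {R : realType}.
Local Notation C := R[i].
Local Notation normc := (@Normc.normc R).
Local Notation mu := (@lebesgue_measure R).
Local Notation D := (@Disc R).
Local Notation circ := (@circ_dom R).

Definition pol (z : R * R) : C := (z.1)%:C * expi z.2.

Definition polar_rect : set (R * R) := `]0, 1[%classic `*` circ.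

Lemma normc_pol r t : normc (r%:C * expi t) = `|r|.
Proof. by rewrite Normc.normcM normc_real normc_expi mulr1. Qed.

Lemma cplx_pol (r t : R) : cplx (r * cos t, r * sin t) = r%:C * expi t.
Proof. by apply: complexP; rewrite ?ReM ?ImM /=; ring. Qed.

Lemma DiscE (z : R * R) : D z <-> normc (cplx z) < 1.
Proof.
rewrite normcE /Disc /=; split => h.
  by rewrite -sqrtr1 ltr_sqrt.
by rewrite -ltr_sqrt// sqrtr1.
Qed.

Lemma measurable_circ : measurable circ.
Proof.
rewrite (_ : circ = `[0, pi *+ 2]%classic); first exact: measurable_itv.
by apply/seteqP; split => t /=; rewrite in_itv.
Qed.

Lemma circ_lty : (mu circ < +oo)%E.
Proof.
rewrite (_ : circ = `[0, pi *+ 2]%classic); last first.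
  by apply/seteqP; split => t /=; rewrite in_itv.
rewrite lebesgue_measure_itv /= lte_fin.
by case: ifP => _; [rewrite -EFinB ltry|].
Qed.

Lemma measurable_fun_poly2 : measurable_fun [set: R * R]
  (fun z : R * R => z.1 ^+ 2 + z.2 ^+ 2).
Proof. by apply: measurable_funD; apply: measurable_funX. Qed.

Lemma measurable_Disc : measurable D.
Proof.
have := measurable_fun_poly2 measurableT (measurable_itv `]-oo, 1[).
rewrite setTI.
by rewrite (_ : _ @^-1` _ = D).
Qed.

Lemma measurable_cos : measurable_fun [set: R] (@cos R).
Proof. by apply: continuous_measurable_fun; exact: continuous_cos. Qed.

Lemma measurable_sin : measurable_fun [set: R] (@sin R).
Proof. by apply: continuous_measurable_fun; exact: continuous_sin. Qed.

Lemma cmeas_id : cmeas setT (@cplx R).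
Proof. by split; [exact: measurable_fst|exact: measurable_snd]. Qed.

Lemma measurable_comp_Disc d (T : measurableType d) (A : set T) (h : T -> C)
    (g : C -> R) : cmeas setT h -> (forall x, A x -> normc (h x) < 1) ->
  measurable_fun D (fun z => g (cplx z)) -> measurable_fun A (fun x => g (h x)).
Proof.
move=> [m1 m2] hA mg.
rewrite (_ : (fun x => _) = (fun z => g (cplx z)) \o
   (fun x => (complex.Re (h x), complex.Im (h x)))); last first.
  by apply/funext => x /=; congr g; case: (h x).
apply: (measurable_comp measurable_Disc _ mg).
  move=> _ [x Ax <-]; apply/DiscE; rewrite /cplx/=.
  by have := hA x Ax; case: (h x).
by apply: measurable_funTS; exact: measurable_fun_pair.
Qed.

Lemma cmeas_pol : cmeas setT pol.
Proof.
apply: cmeasM; first by apply: cmeas_real; exact: measurable_funTS.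
split => /=.
  by apply: (measurableT_comp measurable_cos); exact: measurable_snd.
by apply: (measurableT_comp measurable_sin); exact: measurable_snd.
Qed.

Lemma normc_pol_lt1 z : polar_rect z -> normc (pol z) < 1.
Proof.
move=> [+ _]; rewrite /pol normc_pol /= in_itv/= => /andP[z0 z1].
by rewrite gtr0_norm.
Qed.

(** Nothing is asked outside the disc, where an analytic function of the statement takes arbitrary
    values. Measurability on the disc with continuity on each circle is what [polar_ge0] and the
    shift of the angle need, and it survives [Np], [Gp], conjugation and truncation, which
    analyticity does not. *)
Definition dreg (g : C -> R) := measurable_fun D (fun z => g (cplx z)) /\
  forall r, 0 < r < 1 -> continuous (fun t => g (r%:C * expi t)).

Definition cdreg (f : C -> C) := cmeas D (fun z => f (cplx z)) /\
  forall r, 0 < r < 1 -> forall t,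
    ccvg (nbhs t) (fun s => f (r%:C * expi s)) (f (r%:C * expi t)).

Lemma ccvg_expi t : ccvg (nbhs t) (fun s : R => expi s) (expi t).
Proof. by split => /=; [exact: continuous_cos|exact: continuous_sin]. Qed.

Lemma dreg_polar_meas g : dreg g -> measurable_fun polar_rect (fun z => g (pol z)).
Proof.
move=> [mg _]; apply: measurable_comp_Disc mg; first exact: cmeas_pol.
exact: normc_pol_lt1.
Qed.

Lemma polar_Disc_ge0 (g : C -> R) : dreg g -> (forall z, normc z < 1 -> 0 <= g z) ->
  (\int[(mu \x mu)]_(z in D) (g (cplx z))%:E =
   \int[(mu \x mu)]_(z in polar_rect) (z.1 * g (pol z))%:E)%E.
Proof.
move=> dg g0; have [mg cg] := dg.
pose f (z : R * R) : R := if z.1 ^+ 2 + z.2 ^+ 2 < 1 then g (cplx z) else 0.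
have fE : f = (fun z => g (cplx z)) \_ D.
  apply/funext => z; rewrite patchE /f; congr (if _ then _ else _).
  by apply/idP/idP; rewrite inE.
have mf : measurable_fun [set: R * R] f.
  by rewrite fE; apply/(measurable_restrictT _ measurable_Disc).
have f0 z : 0 <= f z.
  by rewrite /f; case: ifPn => // h; apply: g0; apply/DiscE.
have fpol r t : f (r * cos t, r * sin t) = if r ^+ 2 < 1 then g (r%:C * expi t) else 0.
  rewrite /f cplx_pol /= !exprMn -mulrDr.
  by rewrite cos2Dsin2 mulr1.
rewrite integral_mkcond.
rewrite (_ : _ \_ D = fun z => (f z)%:E); last first.
  by rewrite fE restrict_EFin.
rewrite polar_ge0//; last first.
  move=> r r0; rewrite (_ : (fun t => _) = fun t => if r ^+ 2 < 1 then g (r%:C * expi t) else 0);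
    last by apply/funext => t; rewrite fpol.
  have [r1|r1] := boolP (r ^+ 2 < 1); last by move=> t; exact: cvg_cst.
  by apply: cg; rewrite r0 -(@expr_lt1 _ 2)//= ltW.
rewrite tonelli_rect1; last 4 first.
- by [].
- exact: measurable_circ.
- apply/measurable_EFinP; apply: measurable_funM; first exact: measurable_funTS.
  exact: dreg_polar_meas.
- move=> z Qz; rewrite lee_fin; have h := g0 _ (normc_pol_lt1 Qz).
  by case: Qz; rewrite /= in_itv/= => /andP[/ltW z0 _] _; rewrite mulr_ge0.
rewrite [RHS]integral_mkcond; apply: eq_integral => r _; rewrite patchE.
have [|h] := boolP (r \in `]0, 1[%classic).
  rewrite inE /= in_itv/= => /andP[r0 r1].
  apply: eq_integral => t _; rewrite r0 fpol.
  by rewrite expr_lt1 ?r1// ltW.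
have {}h : ~~ ((0 < r) && (r < 1)).
  by apply: contra h; rewrite inE /= in_itv.
rewrite integral0_eq// => t _.
have [r0|//] := boolP (0 < r).
rewrite fpol ifF ?mulr0//; apply/negP => r1; move: h; rewrite r0 /=.
by rewrite -(@expr_lt1 _ 2) ?r1// ltW.
Qed.

Lemma dreg_max0 g : dreg g -> dreg (fun z => Num.max (g z) 0).
Proof.
move=> [mg cg]; split; first by apply: measurable_maxr => //; exact: measurable_cst.
move=> r r01 t; apply: continuous_max => //; first exact: cg.
exact: cvg_cst.
Qed.

Lemma dregN g : dreg g -> dreg (fun z => - g z).
Proof.
move=> [mg cg]; split; first exact: measurableT_comp.
by move=> r r01 t; apply: cvgN; exact: cg.
Qed.

Lemma dreg_norm g : dreg g -> dreg (fun z => `|g z|).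
Proof.
move=> [mg cg]; split; first exact: measurableT_comp.
by move=> r r01 t; apply: cvg_norm; exact: cg.
Qed.

Lemma polar_Disc (g : C -> R) : dreg g ->
  (\int[(mu \x mu)]_(z in D) (g (cplx z))%:E =
   \int[(mu \x mu)]_(z in polar_rect) (z.1 * g (pol z))%:E)%E.
Proof.
move=> dg; rewrite integralE [RHS]integralE; congr (_ - _)%E.
  transitivity (\int[(mu \x mu)]_(z in D) (Num.max (g (cplx z)) 0)%:E)%E.
    by apply: eq_integral => z _; rewrite funeposE -EFin_max.
  rewrite (polar_Disc_ge0 (dreg_max0 dg)); last by move=> z _; rewrite le_max lexx orbT.
  apply: eq_integral => z; rewrite inE => -[]; rewrite /= in_itv/= => /andP[z0 _] _.
  by rewrite funeposE -EFin_max maxr_pMr ?mulr0// ltW.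
transitivity (\int[(mu \x mu)]_(z in D) (Num.max (- g (cplx z)) 0)%:E)%E.
  by apply: eq_integral => z _; rewrite funenegE -EFinN -EFin_max.
rewrite (polar_Disc_ge0 (dreg_max0 (dregN dg))); last by move=> z _; rewrite le_max lexx orbT.
apply: eq_integral => z; rewrite inE => -[]; rewrite /= in_itv/= => /andP[z0 _] _.
by rewrite funenegE -EFinN -EFin_max maxr_pMr ?mulr0 ?mulrN// ltW.
Qed.

Lemma polar_integrable (g : C -> R) : dreg g ->
  (mu \x mu)%E.-integrable D (fun z => (g (cplx z))%:E) ->
  (mu \x mu)%E.-integrable polar_rect (fun z => (z.1 * g (pol z))%:E).
Proof.
move=> dg /integrableP[mg ig]; apply/integrableP; split.
  apply/measurable_EFinP; apply: measurable_funM; first exact: measurable_funTS.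
  exact: dreg_polar_meas.
apply: le_lt_trans ig.
rewrite [leRHS](polar_Disc_ge0 (dreg_norm dg))// le_eqVlt; apply/orP; left; apply/eqP.
apply: eq_integral => z; rewrite inE => -[]; rewrite /= in_itv/= => /andP[z0 _] _.
by rewrite normrM gtr0_norm.
Qed.

Definition rot (t : R) (z : C) : C := expi t * z.

Lemma normc_rot t z : normc (rot t z) = normc z.
Proof. by rewrite /rot Normc.normcM normc_expi mul1r. Qed.

Lemma rot_pol t r s : rot t (r%:C * expi s) = r%:C * expi (s + t).
Proof. by rewrite /rot expiD; ring. Qed.

Lemma rotK t z : rot (- t) (rot t z) = z.
Proof. by rewrite /rot mulrA expiNl mul1r. Qed.

Lemma dreg_rot t g : dreg g -> dreg (fun z => g (rot t z)).
Proof.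
move=> [mg cg]; split.
  apply: measurable_comp_Disc mg.
    apply: cmeasM; first exact: cmeas_cst.
    exact: cmeas_id.
  by move=> z /DiscE; rewrite normc_rot.
move=> r r01 s.
have -> : (fun s => g (rot t (r%:C * expi s))) = (fun s => g (r%:C * expi (s + t))).
  by apply/funext => ?; rewrite rot_pol.
apply: (@continuous_comp _ _ _ (fun s => s + t) (fun s => g (r%:C * expi s))).
  by apply: cvgD => //; exact: cvg_cst.
exact: cg.
Qed.

Lemma cdreg_rot t f : cdreg f -> cdreg (fun z => f (rot t z)).
Proof.
move=> [[m1 m2] cf].
have d1 : dreg (fun z => complex.Re (f z)).
  by split => // r r01 s; have [] := cf r r01 s.
have d2 : dreg (fun z => complex.Im (f z)).
  by split => // r r01 s; have [] := cf r r01 s.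
have [a1 b1] := dreg_rot t d1; have [a2 b2] := dreg_rot t d2.
split; first by split.
by move=> r r01 s; split; [exact: b1|exact: b2].
Qed.

(** In polar coordinates a rotation is a shift of the angle, absorbed on each circle by periodicity;
    the range of [t] is that of [ge0_integral_circ_shift]. *)
Let rot_ge0_pos t g : 0 <= t <= pi *+ 2 -> dreg g -> (forall z, normc z < 1 -> 0 <= g z) ->
  (\int[(mu \x mu)]_(z in D) (g (rot t (cplx z)))%:E =
   \int[(mu \x mu)]_(z in D) (g (cplx z))%:E)%E.
Proof.
move=> t0 dg g0.
have Q0 h : (forall z, normc z < 1 -> 0 <= h z) ->
    forall z, polar_rect z -> (0 <= (z.1 * h (pol z))%:E)%E.
  move=> h0 z Qz; rewrite lee_fin; have h1 := h0 _ (normc_pol_lt1 Qz).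
  by case: Qz; rewrite /= in_itv/= => /andP[/ltW z0 _] _; rewrite mulr_ge0.
have mQ h : dreg h -> measurable_fun polar_rect (fun z => (z.1 * h (pol z))%:E).
  move=> dh; apply/measurable_EFinP; apply: measurable_funM; first exact: measurable_funTS.
  exact: dreg_polar_meas.
have g1 z : normc z < 1 -> 0 <= g (rot t z) by move=> z1; apply: g0; rewrite normc_rot.
rewrite (polar_Disc_ge0 (dreg_rot t dg))// (polar_Disc_ge0 dg)//.
rewrite tonelli_rect1//; [|exact: measurable_circ|exact: mQ (dreg_rot t dg)|exact: (Q0 (fun z => g (rot t z)) g1)].
rewrite tonelli_rect1//; [|exact: measurable_circ|exact: (mQ g dg)|exact: (Q0 g g0)].
apply: eq_integral => r; rewrite inE /= in_itv/= => r01.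
have cg := dg.2 r r01.
rewrite -(@ge0_integral_circ_shift _ (fun s => (r * g (pol (r, s)))%:E) t)//.
- by apply: eq_integral => s _; rewrite /pol /= rot_pol.
- apply/measurable_EFinP; apply: measurable_funM => //.
  exact: continuous_measurable_fun.
- move=> s; have /andP[r0 r1] := r01; rewrite lee_fin mulr_ge0 ?(ltW r0)//.
  by apply: g0; rewrite /pol normc_pol gtr0_norm.
- by move=> s; rewrite /pol /= expiD2pi.
Qed.

Let rot_ge0 t g : `|t| <= pi *+ 2 -> dreg g -> (forall z, normc z < 1 -> 0 <= g z) ->
  (\int[(mu \x mu)]_(z in D) (g (rot t (cplx z)))%:E =
   \int[(mu \x mu)]_(z in D) (g (cplx z))%:E)%E.
Proof.
move=> tpi dg g0; have [t0|t0] := leP 0 t.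
  have t01 : 0 <= t <= pi *+ 2 by rewrite t0 (le_trans (ler_norm t)).
  exact: rot_ge0_pos t01 dg g0.
have tN : 0 <= - t <= pi *+ 2.
  by rewrite oppr_ge0 (ltW t0) (le_trans (ler_norm (- t)))// normrN.
have g1 z : normc z < 1 -> 0 <= g (rot t z) by move=> z1; apply: g0; rewrite normc_rot.
rewrite -(rot_ge0_pos tN (dreg_rot t dg) g1).
by apply: eq_integral => z _; rewrite -{1}(opprK t) rotK.
Qed.

Lemma rot_Disc t g : `|t| <= pi *+ 2 -> dreg g ->
  (\int[(mu \x mu)]_(z in D) (g (rot t (cplx z)))%:E =
   \int[(mu \x mu)]_(z in D) (g (cplx z))%:E)%E.
Proof.
move=> tpi dg; rewrite integralE [RHS]integralE; congr (_ - _)%E.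
  transitivity (\int[(mu \x mu)]_(z in D) (Num.max (g (rot t (cplx z))) 0)%:E)%E.
    by apply: eq_integral => z _; rewrite funeposE -EFin_max.
  rewrite (rot_ge0 tpi (dreg_max0 dg)); last by move=> z _; rewrite le_max lexx orbT.
  by apply: eq_integral => z _; rewrite funeposE -EFin_max.
transitivity (\int[(mu \x mu)]_(z in D) (Num.max (- g (rot t (cplx z))) 0)%:E)%E.
  by apply: eq_integral => z _; rewrite funenegE -EFinN -EFin_max.
rewrite (rot_ge0 tpi (dreg_max0 (dregN dg))); last by move=> z _; rewrite le_max lexx orbT.
by apply: eq_integral => z _; rewrite funenegE -EFinN -EFin_max.
Qed.

Lemma rot_integrable t g : `|t| <= pi *+ 2 -> dreg g ->
  (mu \x mu)%E.-integrable D (fun z => (g (cplx z))%:E) ->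
  (mu \x mu)%E.-integrable D (fun z => (g (rot t (cplx z)))%:E).
Proof.
move=> tpi dg /integrableP[mg ig]; apply/integrableP; split.
  by apply/measurable_EFinP; have [] := dreg_rot t dg.
rewrite [ltLHS](_ : _ = \int[(mu \x mu)]_(z in D) (`|g (rot t (cplx z))|)%:E)%E//.
by rewrite (rot_Disc tpi (dreg_norm dg)).
Qed.

End disc_functions.

Section disc_algebra.
Context {R : realType}.
Local Notation C := R[i].
Local Notation normc := (@Normc.normc R).
Local Notation mu := (@lebesgue_measure R).
Local Notation mu2 := (mu \x mu)%E.
Local Notation D := (@Disc R).
Local Notation circ := (@circ_dom R).
Implicit Types f g : C -> C.

Lemma cdreg_Re f : cdreg f -> dreg (fun z => complex.Re (f z)).
Proof. by move=> [[m1 m2] cf]; split => // r r01 t; have [] := cf r r01 t. Qed.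

Lemma cdreg_Im f : cdreg f -> dreg (fun z => complex.Im (f z)).
Proof. by move=> [[m1 m2] cf]; split => // r r01 t; have [] := cf r r01 t. Qed.

Lemma cdreg_normc f : cdreg f -> dreg (fun z => normc (f z)).
Proof.
move=> [m cf]; split; first exact: measurable_normc.
by move=> r r01 t; apply: ccvg_normc; exact: cf.
Qed.

Lemma cdreg_Np (p : R) f : 1 < p -> cdreg f -> dreg (fun z => Np p (f z)).
Proof.
move=> p1 [m cf]; split; first exact: measurable_Np.
by move=> r r01 t; apply: cvg_Np => //; exact: cf.
Qed.

Lemma cdreg_Gp (p : R) f : 1 < p -> cdreg f -> cdreg (fun z => Gp p (f z)).
Proof.
move=> p1 [m cf]; split; first exact: cmeas_Gp.
by move=> r r01 t; apply: ccvg_Gp => //; exact: cf.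
Qed.

Lemma cdreg_cst (c : C) : cdreg (fun=> c).
Proof. by split; [exact: cmeas_cst|move=> *; exact: ccvg_cst]. Qed.

Lemma cdreg_id : cdreg (fun z : C => z).
Proof.
split; first by have [? ?] := @cmeas_id R; split; exact: measurable_funTS.
move=> r r01 t; apply: ccvgM; first exact: ccvg_cst.
exact: ccvg_expi.
Qed.

Lemma cdregD f g : cdreg f -> cdreg g -> cdreg (fun z => f z + g z).
Proof.
move=> [mf cf] [mg cg]; split; first exact: cmeasD.
by move=> r r01 t; apply: ccvgD; [exact: cf|exact: cg].
Qed.

Lemma cdregM f g : cdreg f -> cdreg g -> cdreg (fun z => f z * g z).
Proof.
move=> [mf cf] [mg cg]; split; first exact: cmeasM.
by move=> r r01 t; apply: ccvgM; [exact: cf|exact: cg].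
Qed.

Lemma cdregN f : cdreg f -> cdreg (fun z => - f z).
Proof.
move=> [mf cf]; split; first exact: cmeasN.
by move=> r r01 t; apply: ccvgN; exact: cf.
Qed.

Lemma cdregB f g : cdreg f -> cdreg g -> cdreg (fun z => f z - g z).
Proof. by move=> cf cg; apply: cdregD => //; exact: cdregN. Qed.

Lemma cdreg_conjc f : cdreg f -> cdreg (fun z => conjc (f z)).
Proof.
move=> [mf cf]; split; first exact: cmeas_conjc.
by move=> r r01 t; apply: ccvg_conjc; exact: cf.
Qed.

Lemma cdregX f n : cdreg f -> cdreg (fun z => f z ^+ n).
Proof.
move=> [mf cf]; split; first exact: cmeasX.
by move=> r r01 t; apply: ccvgX; exact: cf.
Qed.

Lemma eq_cdreg f g : (forall z, normc z < 1 -> f z = g z) -> cdreg f -> cdreg g.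
Proof.
move=> fg [mf cf]; split.
  by apply: eq_cmeas mf => z /DiscE z1; exact: fg.
move=> r r01 t; have /andP[r0 r1] := r01.
have e s : f (r%:C * expi s) = g (r%:C * expi s).
  by apply: fg; rewrite normc_pol gtr0_norm.
rewrite -e; have h := cf r r01 t.
by rewrite -(_ : (fun s => f (r%:C * expi s)) = (fun s => g (r%:C * expi s)))//; apply/funext.
Qed.

Definition disc_integral f : C := cintegral mu2 D (fun z => f (cplx z)).
Definition disc_intg f : Prop := cdreg f /\ cintg mu2 D (fun z => f (cplx z)).

Definition circ_integral (r : R) f : C :=
  cintegral mu circ (fun t => f (r%:C * expi t)).

Lemma disc_intg_rot t f : `|t| <= pi *+ 2 -> disc_intg f ->
  disc_intg (fun z => f (rot t z)).
Proof.
move=> tp [df [i1 i2]]; split; first exact: cdreg_rot.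
split.
  exact: (rot_integrable tp (cdreg_Re df)).
exact: (rot_integrable tp (cdreg_Im df)).
Qed.

Lemma disc_integral_rot t f : `|t| <= pi *+ 2 -> cdreg f ->
  disc_integral (fun z => f (rot t z)) = disc_integral f.
Proof.
move=> tp df; apply: complexP => /=; rewrite /Rintegral.
  by rewrite (rot_Disc tp (cdreg_Re df)).
by rewrite (rot_Disc tp (cdreg_Im df)).
Qed.

Lemma real_polar_iterated (g : C -> R) : dreg g ->
  mu2.-integrable D (fun z => (g (cplx z))%:E) ->
  mu.-integrable `]0, 1[%classic
     (fun r => (r * \int[mu]_(t in circ) g (r%:C * expi t))%:E) /\
  \int[mu2]_(z in D) g (cplx z) =
  \int[mu]_(r in `]0, 1[%classic) (r * \int[mu]_(t in circ) g (r%:C * expi t)).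
Proof.
move=> dg ig; have jg := polar_integrable dg ig.
have mI : measurable (`]0, 1[%classic : set R) by [].
have inner r : r \in (`]0, 1[%classic : set R) ->
    (\int[mu]_(t in circ) (r * g (pol (r, t)))%:E =
     (r * \int[mu]_(t in circ) g (r%:C * expi t))%:E)%E.
  rewrite inE /= in_itv/= => r01.
  have cg := dg.2 r r01.
  have ic : mu.-integrable circ (EFin \o (fun t => g (r%:C * expi t))).
    rewrite (_ : circ = `[0, pi *+ 2]%classic); last first.
      by apply/seteqP; split => t /=; rewrite in_itv.
    apply: continuous_compact_integrable; first exact: segment_compact.
    exact: continuous_subspaceT.
  rewrite (_ : (fun t => _) = fun t => (r%:E * (g (r%:C * expi t))%:E)%E) //.
  rewrite integralZl//; last exact: measurable_circ.
  rewrite EFinM; congr (_ * _)%E; rewrite /Rintegral fineK//.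
  by apply: integrable_fin_num => //; exact: measurable_circ.
split.
  apply: (@eq_integrable _ _ _ mu _ mI
      (fun r => (\int[mu]_(t in circ) (r * g (pol (r, t)))%:E)%E)) => //.
  exact: (@integrable_rect1 _ _ _ mI measurable_circ (fun z => z.1 * g (pol z))).
rewrite /Rintegral polar_Disc//; congr fine.
rewrite (@fubini_rect1 _ _ _ mI measurable_circ (fun z => z.1 * g (pol z)))//.
by apply: eq_integral => r r01 /=; exact: inner.
Qed.

Lemma disc_polar f : disc_intg f ->
  cintg mu `]0, 1[%classic (fun r => r%:C * circ_integral r f) /\
  disc_integral f =
    cintegral mu `]0, 1[%classic (fun r => r%:C * circ_integral r f).
Proof.
move=> [df [i1 i2]].
have [j1 e1] := real_polar_iterated (cdreg_Re df) i1.
have [j2 e2] := real_polar_iterated (cdreg_Im df) i2.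
split.
  split.
    by apply: eq_integrable j1 => // r _; rewrite ReMl.
  by apply: eq_integrable j2 => // r _; rewrite ImMl.
rewrite /disc_integral /cintegral e1 e2; congr (_ +i* _); apply: eq_Rintegral => r _.
  by rewrite ReMl.
by rewrite ImMl.
Qed.

Lemma circ_continuous_integrable (g : R -> R) : continuous g ->
  mu.-integrable circ (fun t => (g t)%:E).
Proof.
move=> cg; rewrite (_ : circ = `[0, pi *+ 2]%classic); last first.
  by apply/seteqP; split => t /=; rewrite in_itv.
apply: continuous_compact_integrable; first exact: segment_compact.
exact: continuous_subspaceT.
Qed.

Lemma circ_cintg r f : 0 < r < 1 -> cdreg f -> cintg mu circ (fun t => f (r%:C * expi t)).
Proof.
move=> r01 df; split; apply: circ_continuous_integrable.
- exact: (cdreg_Re df).2.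
- exact: (cdreg_Im df).2.
Qed.

Lemma disc_intg_bound f (g : C -> R) : cdreg f ->
  mu2.-integrable D (fun z => (g (cplx z))%:E) ->
  (forall z, normc z < 1 -> normc (f z) <= g z) -> disc_intg f.
Proof.
move=> df ig fg; split => //.
apply: (@cintg_bound _ _ _ mu2 D measurable_Disc _ (fun z => g (cplx z))) => //.
  exact: df.1.
by move=> z /DiscE; exact: fg.
Qed.

Lemma disc_intg_normc f : disc_intg f ->
  mu2.-integrable D (fun z => (normc (f (cplx z)))%:E).
Proof. by move=> [_ jf]; exact: (@cintg_normc _ _ _ mu2 D measurable_Disc _ jf). Qed.

Lemma disc_intgD f g : disc_intg f -> disc_intg g -> disc_intg (fun z => f z + g z).
Proof.
move=> [df jf] [dg jg]; split; first exact: cdregD.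
by apply: cintgD => //; exact: measurable_Disc.
Qed.

Lemma disc_intgZ c f : disc_intg f -> disc_intg (fun z => c * f z).
Proof.
move=> [df jf]; split; first by apply: cdregM => //; exact: cdreg_cst.
by apply: cintgZ => //; exact: measurable_Disc.
Qed.

Lemma disc_intgB f g : disc_intg f -> disc_intg g -> disc_intg (fun z => f z - g z).
Proof.
move=> [df jf] [dg jg]; split; first exact: cdregB.
by apply: cintgB => //; exact: measurable_Disc.
Qed.

Lemma disc_intg_conjX f n : disc_intg f -> disc_intg (fun z => f z * conjc z ^+ n).
Proof.
move=> hf; have [df jf] := hf.
apply: (@disc_intg_bound _ (fun z => normc (f z))).
- by apply: cdregM => //; apply: cdregX; apply: cdreg_conjc; exact: cdreg_id.
- exact: disc_intg_normc.
- move=> z z1; rewrite Normc.normcM normcX normc_conjc ler_piMr ?normc_ge0//.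
  by rewrite exprn_ile1 ?normc_ge0// ltW.
Qed.

Lemma disc_integral_sum (I : Type) (s : seq I) (h : I -> C -> C) :
  (forall i, disc_intg (h i)) ->
  disc_integral (fun z => \sum_(i <- s) h i z) = \sum_(i <- s) disc_integral (h i).
Proof.
by move=> hh; rewrite /disc_integral cintegral_sum//; [exact: measurable_Disc|move=> i; have [] := hh i].
Qed.

End disc_algebra.

(** * Derivatives along curves, circle integrals and Taylor coefficients *)

Section analytic_functions.
Context {R : realType}.
Local Notation C := R[i].
Local Notation mu := (@lebesgue_measure R).
Local Notation circ := (@circ_dom R).

Lemma circE : circ = `[0, pi *+ 2]%classic.
Proof. by apply/seteqP; split => t /=; rewrite in_itv. Qed.

Lemma rderivM (f g : R -> R) (x df dg : R) : is_derive x 1 f df -> is_derive x 1 g dg ->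
  is_derive x 1 (fun t => f t * g t) (df * g x + f x * dg).
Proof.
move=> hf hg; apply: (@is_derive_eq _ _ _ (f * g) x 1 _ (f x *: dg + g x *: df)).
by rewrite /GRing.scale /= addrC mulrC.
Qed.

Lemma rderiv_cst (c x : R) : is_derive x 1 (fun=> c) (0 : R).
Proof. exact: is_derive_cst. Qed.

Lemma rderivZ (c : R) (f : R -> R) (x df : R) : is_derive x 1 f df ->
  is_derive x 1 (fun t => c * f t) (c * df).
Proof.
move=> hf; have := rderivM (rderiv_cst c x) hf.
by rewrite mul0r add0r.
Qed.

Lemma rderiv_id (x : R) : is_derive x 1 (fun t : R => t) (1 : R).
Proof. exact: is_derive_id. Qed.

Lemma rderiv_comp (f g : R -> R) (x df dg : R) : is_derive (g x) 1 f df ->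
  is_derive x 1 g dg -> is_derive x 1 (fun t => f (g t)) (df * dg).
Proof. by move=> hf hg; exact: is_derive1_comp. Qed.

Lemma rderivX (n : nat) (x : R) : is_derive x 1 (fun t : R => t ^+ n.+1) (n.+1%:R * x ^+ n).
Proof.
elim: n => [|n ih].
  by rewrite expr0 mulr1; under eq_fun do rewrite expr1; exact: rderiv_id.
have -> : (fun t : R => t ^+ n.+2) = (fun t => t * t ^+ n.+1).
  by apply/funext => t; rewrite exprS.
have := rderivM (rderiv_id x) ih; rewrite mul1r.
suff -> : x ^+ n.+1 + x * (n.+1%:R * x ^+ n) = n.+2%:R * x ^+ n.+1 by [].
by rewrite -[in RHS]natr1 !exprS; ring.
Qed.

Lemma rderivP (f : R -> R) (x d : R) : is_derive x 1 f d <->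
  h^-1 * (f (x + h) - f x) @[h --> 0^'] --> d.
Proof.
have E : (fun h => h^-1 *: ((f \o shift x) (h *: 1) - f x)) =
    (fun h : R => h^-1 * (f (x + h) - f x)).
  by apply/funext => h; rewrite /= /GRing.scale /= mulr1 [h + x]addrC.
split.
  move=> [df <-]; move: df; rewrite /derivable /derive E => /cvg_ex[l hl].
  by move/(cvg_lim (@Rhausdorff R)) : (hl) => ->.
move=> h; apply: DeriveDef; rewrite /derivable /derive E.
  by apply/cvg_ex; exists d.
by apply/(cvg_lim (@Rhausdorff R)).
Qed.

Lemma FTC_closed (f F : R -> R) (a b : R) : a < b ->
  (forall x : R, a <= x <= b -> is_derive x 1 F (f x)) ->
  (forall x : R, a <= x <= b -> {for x, continuous f}) ->
  mu.-integrable `[a, b]%classic (fun x => (f x)%:E) /\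
  (\int[mu]_(x in `[a, b]%classic) (f x)%:E)%E = (F b - F a)%:E.
Proof.
move=> ab dF cf.
have wf : {within `[a, b], continuous f}.
  by apply: continuous_in_subspaceT => x; rewrite inE /= in_itv/= => h; exact: cf.
split; first by apply: continuous_compact_integrable => //; exact: segment_compact.
have cF (x : R) : a <= x <= b -> {for x, continuous F}.
  move=> h; apply: differentiable_continuous; apply/derivable1_diffP.
  by case: (dF x h).
rewrite (@continuous_FTC2 _ f F)//.
- split.
  + by move=> x; rewrite in_itv/= => /andP[h1 h2]; case: (dF x _); rewrite ?ltW.
  + by apply: cvg_at_right_filter; apply: cF; rewrite lexx ltW.
  + by apply: cvg_at_left_filter; apply: cF; rewrite lexx ltW.
- move=> x; rewrite in_itv/= => /andP[h1 h2]; rewrite derive1E.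
  by case: (dF x _) => //; rewrite ?ltW.
Qed.

Lemma pi2_gt0 : 0 < pi *+ 2 :> R.
Proof. by rewrite mulrn_wgt0// pi_gt0. Qed.

Lemma mu_circ : mu circ = (pi *+ 2)%:E.
Proof. by rewrite circE lebesgue_measure_itv/= lte_fin pi2_gt0 -EFinB subr0. Qed.

Lemma expi_pow_mul n m t : expi t ^+ n * conjc (expi t) ^+ m =
  expi ((n%:R - m%:R) * t) :> C.
Proof.
by rewrite -expiN !expiX -expiD; congr expi; rewrite -[t *+ n]mulr_natl -[_ *+ m]mulr_natl; ring.
Qed.

Lemma circ_expi (n m : nat) :
  cintegral mu circ (fun t : R => expi t ^+ n * conjc (expi t) ^+ m) =
  if n == m then (pi *+ 2)%:C else 0.
Proof.
case: eqP => [<-|/eqP nm].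
  rewrite (@eq_cintegral _ _ _ mu circ _ (fun=> 1%:C)); last first.
    by move=> t _; rewrite expi_pow_mul subrr mul0r expi0.
  rewrite (Re_cintegral_real mu circ (cst 1)); congr (_ %:C).
  rewrite Rintegral_cst; last exact: measurable_circ.
  by rewrite mul1r [X in fine X]mu_circ.
pose k : R := n%:R - m%:R.
have k0 : k != 0 by rewrite subr_eq0 eqr_nat.
(* The frequency [k] is a real number here; that it is an integer is used through the powers of
   [expi (2 pi) = 1]. *)
have eC : expi (k * (pi *+ 2)) = 1.
  by rewrite -expi_pow_mul -[pi *+ 2]add0r expiD2pi expi0 conjc1 !expr1n mulr1.
have c1 : cos (k * (pi *+ 2)) = 1 by case: eC.
have s1 : sin (k * (pi *+ 2)) = 0 by case: eC.
rewrite (@eq_cintegral _ _ _ mu circ _ (fun t => expi (k * t))); last first.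
  by move=> t _; rewrite expi_pow_mul.
have dk (x : R) : is_derive x 1 (fun t : R => k * t) k.
  by have := rderivZ k (rderiv_id x); rewrite mulr1.
have ck (x : R) : {for x, continuous (fun t : R => k * t)}.
  by apply: cvgM => //; exact: cvg_cst.
apply: complexP => /=; rewrite /Rintegral circE.
  have [||_ ->] := @FTC_closed (fun t => cos (k * t)) (fun t => k^-1 * sin (k * t)) 0 (pi *+ 2) pi2_gt0.
  - move=> x _; have := rderivZ k^-1 (rderiv_comp (is_derive_sin _) (dk x)).
    by rewrite mulrC mulfK.
  - by move=> x _; apply: (continuous_comp (ck x)); exact: continuous_cos.
  - by rewrite s1 !mulr0 sin0 !mulr0 subr0.
have [||_ ->] := @FTC_closed (fun t => sin (k * t)) (fun t => - k^-1 * cos (k * t)) 0 (pi *+ 2) pi2_gt0.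
- move=> x _; have := rderivZ (- k^-1) (rderiv_comp (is_derive_cos _) (dk x)).
  by rewrite (_ : - k^-1 * (- sin (k * x) * k) = sin (k * x))//; field.
- by move=> x _; apply: (continuous_comp (ck x)); exact: continuous_sin.
- by rewrite c1 mulr0 cos0 subrr.
Qed.

End analytic_functions.

Section curves.
Context {R : realType}.
Local Notation C := R[i].
Local Notation normc := (@Normc.normc R).

Definition cderiv (f : R -> C) (x : R) (d : C) :=
  is_derive x 1 (fun t => complex.Re (f t)) (complex.Re d) /\
  is_derive x 1 (fun t => complex.Im (f t)) (complex.Im d).

Lemma cderivP (f : R -> C) (x : R) (d : C) : cderiv f x d <->
  ccvg ((0 : R)^') (fun h : R => (h^-1)%:C * (f (x + h) - f x)) d.
Proof.
have eRe : (fun h : R => complex.Re ((h^-1)%:C * (f (x + h) - f x))) =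
   (fun h => h^-1 * (complex.Re (f (x + h)) - complex.Re (f x))).
  by apply/funext => h; rewrite ReMl ReD ReN.
have eIm : (fun h : R => complex.Im ((h^-1)%:C * (f (x + h) - f x))) =
   (fun h => h^-1 * (complex.Im (f (x + h)) - complex.Im (f x))).
  by apply/funext => h; rewrite ImMl ImD ImN.
split=> [[/rderivP h1 /rderivP h2]|[h1 h2]].
  by split; rewrite ?eRe ?eIm.
by split; apply/rderivP; rewrite -?eRe -?eIm.
Qed.

Lemma dnbhs_neq0 : \forall h \near (0 : R)^', h != 0.
Proof. exact: nbhs_dnbhs_neq. Qed.

Lemma cderiv_ccvg (f : R -> C) (x : R) (d : C) : cderiv f x d ->
  ccvg ((0 : R)^') (fun h => f (x + h)) (f x).
Proof.
move=> /cderivP hf.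
have h0 : (fun h : R => h) @ (0 : R)^' --> (0 : R) by exact: cvg_within.
have H : ccvg ((0 : R)^') (fun h => h%:C * ((h^-1)%:C * (f (x + h) - f x)) + f x) (0%:C * d + f x).
  apply: ccvgD; last exact: ccvg_cst.
  by apply: ccvgM => //; exact: ccvg_real.
rewrite mul0r add0r in H.
move/ccvgP : H => H'; apply/ccvgP; apply: cvg_trans H'.
apply: near_eq_cvg; near=> h.
have hn : h != 0 by near: h; exact: dnbhs_neq0.
congr (normc (_ - _)).
by rewrite mulrA -rmorphM mulfV// rmorph1 mul1r subrK.
Unshelve. all: by end_near. Qed.

(** Stated on closed discs of radius below 1 because values outside the open disc are arbitrary; it
    yields limits along any filter whose limit point lies inside. *)
Definition locally_lipschitz (f : C -> C) := forall rho : R, 0 < rho -> rho < 1 ->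
  exists2 K : R, 0 <= K & forall z w, normc z <= rho -> normc w <= rho ->
  normc (f w - f z) <= K * normc (w - z).

Lemma near_disc {T : Type} {F : set_system T} {FF : Filter F} (g : T -> C) z :
  ccvg F g z -> normc z < 1 -> \forall x \near F, normc (g x) <= (normc z + 1) / 2.
Proof.
move=> /ccvg_normc gz z1.
have e0 : 0 < (1 - normc z) / 2 by lra.
move/cvgrPdist_le : gz => /(_ _ e0); apply: filterS => x.
by rewrite ler_norml => /andP[h1 h2]; lra.
Qed.

Lemma ccvg_squeeze {T : Type} {F : set_system T} {FF : Filter F} (f : T -> C) z (g : T -> R) :
  (\forall x \near F, normc (f x - z) <= g x) -> g @ F --> (0 : R) -> ccvg F f z.
Proof.
move=> fg g0; apply/ccvgP.
apply: (@squeeze_cvgr _ _ _ _ (cst 0) g) => //; last exact: cvg_cst.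
by apply: filterS fg => x h; rewrite normc_ge0.
Qed.

Lemma locally_lipschitz_ccvg (f : C -> C) : locally_lipschitz f ->
  forall {T : Type} {F : set_system T} {FF : Filter F} (g : T -> C) z,
  ccvg F g z -> normc z < 1 -> ccvg F (fun x => f (g x)) (f z).
Proof.
move=> lf T F FF g z gz z1; have n0 := normc_ge0 z.
have [||K K0 hK] := lf ((normc z + 1) / 2); [lra|lra|].
apply: (ccvg_squeeze (g := fun x => K * normc (g x - z))).
  apply: filterS (near_disc gz z1) => x gx; apply: hK => //; lra.
rewrite -[X in _ --> X](mulr0 K); apply: cvgM; first exact: cvg_cst.
exact/ccvgP.
Qed.

(** The tangent inequalities at [f x] and at [f (x + h)] enclose the increment of [|f|^p] between
    two linear expressions, whose difference is controlled by the continuity of [Gp]. No chain rule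
    is involved, so the zeros of [f] need no separate treatment. *)
Lemma cderiv_Np (p : R) (f : R -> C) (x : R) (d : C) : 1 < p -> cderiv f x d ->
  is_derive x 1 (fun t => Np p (f t)) (p * complex.Re (d * Gp p (f x))).
Proof.
move=> p1 df; have fc := cderiv_ccvg df; move/cderivP : df => df.
have p0 : 0 < p by exact: lt_trans p1.
apply/rderivP.
pose q (h : R) := (h^-1)%:C * (f (x + h) - f x).
have qd : ccvg ((0 : R)^') (fun h => q h * Gp p (f x)) (d * Gp p (f x)).
  by apply: ccvgM => //; exact: ccvg_cst.
have gap : normc (q h) * normc (Gp p (f (x + h)) - Gp p (f x)) @[h --> (0 : R)^'] --> (0 : R).
  rewrite -[X in _ --> X](mulr0 (normc d)); apply: cvgM; first exact: ccvg_normc.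
  apply/ccvgP; exact: ccvg_Gp.
have main : p * complex.Re (q h * Gp p (f x)) @[h --> (0 : R)^'] --> p * complex.Re (d * Gp p (f x)).
  by apply: cvgM; [exact: cvg_cst|case: qd].
have err : h^-1 * (Np p (f (x + h)) - Np p (f x)) - p * complex.Re (q h * Gp p (f x))
    @[h --> (0 : R)^'] --> (0 : R).
  apply: norm_cvg0.
  apply: (@squeeze_cvgr _ _ _ _ (cst 0)
   (fun h => p * (normc (q h) * normc (Gp p (f (x + h)) - Gp p (f x))))).
- near=> h; rewrite normr_ge0/=.
  have hn : h != 0 by near: h; exact: dnbhs_neq0.
  have l := Np_convex p1 (f x) (f (x + h)).
  have u := Np_convex_upper p1 (f x) (f (x + h)).
  rewrite /q -mulrA ReMl.
  set X := (f (x + h) - f x) in l u *.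
  have -> : h^-1 * (Np p (f (x + h)) - Np p (f x)) - p * (h^-1 * complex.Re (X * Gp p (f x))) =
    h^-1 * (Np p (f (x + h)) - Np p (f x) - p * complex.Re (X * Gp p (f x))) by ring.
  rewrite normrM Normc.normcM normc_real.
  rewrite [leRHS](_ : _ = `|h^-1| * (p * (normc X * normc (Gp p (f (x + h)) - Gp p (f x)))));
    last by ring.
  rewrite ler_wpM2l//.
  rewrite ger0_norm; last lra.
  apply: (@le_trans _ _ (p * complex.Re (X * (Gp p (f (x + h)) - Gp p (f x))))).
    by rewrite mulrBr ReD ReN; lra.
  rewrite -Normc.normcM ler_wpM2l ?(ltW p0)//; exact: Re_le_normc.
- exact: cvg_cst.
- by rewrite -[X in _ --> X](mulr0 p); apply: cvgM => //; exact: cvg_cst.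
have H := cvgD main err; rewrite addr0 in H.
rewrite (_ : (fun h : R => h^-1 * (Np p (f (x + h)) - Np p (f x))) =
  (fun h => p * complex.Re (q h * Gp p (f x))) \+
  (fun h => h^-1 * (Np p (f (x + h)) - Np p (f x)) - p * complex.Re (q h * Gp p (f x)))); first exact: H.
by apply/funext => h /=; rewrite subrKC.
Unshelve. all: by end_near. Qed.

End curves.

Section analytic_disc_theory.
Context {R : realType}.
Local Notation C := R[i].
Local Notation normc := (@Normc.normc R).
Local Notation mu := (@lebesgue_measure R).
Local Notation D := (@Disc R).
Local Notation circ := (@circ_dom R).

Lemma ccvg_unique {T : Type} {F : set_system T} {FF : ProperFilter F} (f : T -> C) (l1 l2 : C) :
  ccvg F f l1 -> ccvg F f l2 -> l1 = l2.
Proof.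
move=> [h1 h2] [h3 h4]; apply: complexP.
  exact: (cvg_unique (@Rhausdorff R) h1 h3).
exact: (cvg_unique (@Rhausdorff R) h2 h4).
Qed.

Lemma cderiv_expi (t : R) : cderiv (@expi R) t (Complex 0 1 * expi t).
Proof.
split => /=.
  by rewrite mul0r mul1r sub0r; exact: is_derive_cos.
by rewrite mul0r mul1r add0r; exact: is_derive_sin.
Qed.

Lemma cderivMl (f : R -> C) (x : R) (c d : C) : cderiv f x d ->
  cderiv (fun t => c * f t) x (c * d).
Proof.
move=> /cderivP df; apply/cderivP.
have -> : (fun h : R => (h^-1)%:C * (c * f (x + h) - c * f x)) =
    (fun h : R => c * ((h^-1)%:C * (f (x + h) - f x))).
  by apply/funext => h; ring.
by apply: ccvgM => //; exact: ccvg_cst.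
Qed.

Lemma cderiv_realM (c : C) (x : R) : cderiv (fun t : R => t%:C * c) x c.
Proof.
case: c => c1 c2; split.
  have -> : (fun t : R => complex.Re (t%:C * (c1 +i* c2))) = (fun t => c1 * t).
    by apply/funext => t; rewrite ReMl /= mulrC.
  by have := rderivZ c1 (rderiv_id x); rewrite mulr1.
have -> : (fun t : R => complex.Im (t%:C * (c1 +i* c2))) = (fun t => c2 * t).
  by apply/funext => t; rewrite ImMl /= mulrC.
by have := rderivZ c2 (rderiv_id x); rewrite mulr1.
Qed.

Lemma locally_lipschitz_cdreg (f : C -> C) (h : nat -> C -> C) : locally_lipschitz f ->
  (forall n, cmeas D (fun z => h n (cplx z))) ->
  (forall z, normc z < 1 -> ccvg \oo (fun n => h n z) (f z)) -> cdreg f.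
Proof.
move=> lf mh hf; split.
  by apply: (cmeas_cvg mh) => z /DiscE z1; exact: hf.
move=> r /andP[r0 r1] t; apply: (locally_lipschitz_ccvg lf).
  by apply: ccvgM; [exact: ccvg_cst|exact: ccvg_expi].
by rewrite normc_pol gtr0_norm.
Qed.

Lemma cmeas_cplx : cmeas D (@cplx R).
Proof. by have [? ?] := @cmeas_id R; split; exact: measurable_funTS. Qed.

Section power_series_function.
Variables (a : nat -> C) (F : C -> C).
Hypothesis aF : forall z : C, normc z < 1 ->
  ccvg \oo (fun N : nat => \sum_(n < N) a n * z ^+ n) (F z).

Lemma pseries_cdreg : cdreg F.
Proof.
apply: (@locally_lipschitz_cdreg _ (fun N z => \sum_(n < N) a n * z ^+ n)) => //.
  exact: pseries_lipschitz aF.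
move=> n; apply: cmeas_sum => i; apply: cmeasM; first exact: cmeas_cst.
by apply: cmeasX; exact: cmeas_cplx.
Qed.

Lemma pderiv_cdreg : cdreg (pderiv a).
Proof.
apply: (@locally_lipschitz_cdreg _ (fun N z => \sum_(n < N) n%:R * a n * z ^+ n.-1)).
- exact: pderiv_lipschitz aF.
- move=> n; apply: cmeas_sum => i; apply: cmeasM; first exact: cmeas_cst.
  by apply: cmeasX; exact: cmeas_cplx.
- by move=> z z1; exact: (ccvg_pderiv aF).
Qed.

Lemma pseries_cderiv (g : R -> C) (x : R) (d : C) : cderiv g x d -> normc (g x) < 1 ->
  cderiv (fun t => F (g t)) x (pderiv a (g x) * d).
Proof.
move=> dg g1; have gc := cderiv_ccvg dg; move/cderivP : dg => dg; apply/cderivP.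
have n0 := normc_ge0 (g x).
have [||K K0 hK] := pseries_taylor2 aF (rho := (normc (g x) + 1) / 2); [lra|lra|].
pose q (h : R) := (h^-1)%:C * (g (x + h) - g x).
have err : ccvg ((0 : R)^') (fun h : R => (h^-1)%:C *
    (F (g (x + h)) - F (g x) - pderiv a (g x) * (g (x + h) - g x))) 0.
  apply: (ccvg_squeeze (g := fun h => K * (normc (q h) * normc (g (x + h) - g x)))).
    apply: filterS (near_disc gc g1) => h gh.
    rewrite subr0 Normc.normcM /q Normc.normcM.
    rewrite [leRHS](_ : _ = normc (h^-1)%:C * (K * normc (g (x + h) - g x) ^+ 2)); last by ring.
    by rewrite ler_wpM2l ?normc_ge0//; apply: hK => //; lra.
  rewrite -[X in _ --> X](mulr0 K); apply: cvgM; first exact: cvg_cst.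
  rewrite -[X in _ --> X](mulr0 (normc d)); apply: cvgM; first exact: ccvg_normc.
  exact/ccvgP.
have -> : (fun h : R => (h^-1)%:C * (F (g (x + h)) - F (g x))) =
  (fun h : R => pderiv a (g x) * q h + (h^-1)%:C *
    (F (g (x + h)) - F (g x) - pderiv a (g x) * (g (x + h) - g x))).
  by apply/funext => h; rewrite /q; ring.
rewrite -[X in ccvg _ _ X]addr0; apply: ccvgD => //.
by apply: ccvgM => //; exact: ccvg_cst.
Qed.

Lemma rot_diff_quotient z : normc z < 1 ->
  ccvg ((0 : R)^') (fun h : R => (h^-1)%:C * (F (rot h z) - F z))
    (Complex 0 1 * (z * pderiv a z)).
Proof.
move=> z1.
have d0 : cderiv (fun t : R => z * expi t) 0 (z * Complex 0 1).
  by have := cderivMl z (cderiv_expi 0); rewrite expi0 mulr1.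
have := pseries_cderiv d0; rewrite expi0 mulr1 => /(_ z1) /cderivP.
have -> : (fun h : R => (h^-1)%:C * (F (z * expi (0 + h)) - F (z * expi 0))) =
   (fun h : R => (h^-1)%:C * (F (rot h z) - F z)).
  by apply/funext => h; rewrite /rot add0r expi0 mulr1 [z * expi h]mulrC.
by have -> : pderiv a z * (z * Complex 0 1) = Complex 0 1 * (z * pderiv a z) by ring.
Qed.

Lemma radial_cderiv (t s : R) : `|s| < 1 ->
  cderiv (fun s => F (s%:C * expi t)) s (pderiv a (s%:C * expi t) * expi t).
Proof.
move=> s1; apply: (@pseries_cderiv (fun s => s%:C * expi t)); first exact: cderiv_realM.
by rewrite normc_pol.
Qed.

Lemma angular_cderiv (s t : R) : `|s| < 1 ->
  cderiv (fun t => F (s%:C * expi t)) t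
    (Complex 0 1 * (s%:C * expi t * pderiv a (s%:C * expi t))).
Proof.
move=> s1.
have := @pseries_cderiv (fun t => s%:C * expi t) t _ (cderivMl _ (cderiv_expi t)).
rewrite normc_pol => /(_ s1).
by have -> : pderiv a (s%:C * expi t) * (s%:C * (Complex 0 1 * expi t)) =
  Complex 0 1 * (s%:C * expi t * pderiv a (s%:C * expi t)) by ring.
Qed.

(** The partial sums are uniformly bounded on the circle, so integration goes term by term and
    orthogonality keeps the index [m] alone. The power [r^(2m)] collects the moduli of [z^m] and of
    its conjugate. *)
Lemma circ_coef (r : R) (m : nat) : 0 < r < 1 ->
  circ_integral r (fun z => F z * conjc z ^+ m) = (pi *+ 2 * r ^+ m.*2)%:C * a m.
Proof.
move=> /andP[r0 r1].
pose S N (z : C) := (\sum_(n < N) a n * z ^+ n) * conjc z ^+ m.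
have rs t : normc (r%:C * expi t) = r by rewrite normc_pol gtr0_norm.
have [B [s [B0 s0 s1 hB]]] := coef_geometric aF (ltW r0) r1.
have bound z N : normc z = r -> normc (\sum_(n < N) a n * z ^+ n) <= B * (1 - s)^-1.
  move=> zr; apply: (@normc_geometric_sum _ (fun n => a n * z ^+ n) B s N (ltW s0) s1) => n.
  apply: le_trans (hB n); rewrite Normc.normcM normcX zr -[leRHS]mulrA ler_peMl//.
    by rewrite mulr_ge0 ?normc_ge0// exprn_ge0// ltW.
  have : 0 <= n%:R :> R by []. nra.
have mcirc (f : C -> C) : cdreg f -> cmeas circ (fun t => f (r%:C * expi t)).
  move=> [_ cf]; split; apply: measurable_funTS; apply: continuous_measurable_fun => t.
    by have [] := cf r _ t; rewrite ?r0.
  by have [] := cf r _ t; rewrite ?r0.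
have regS N : cdreg (S N).
  apply: cdregM; last by apply: cdregX; apply: cdreg_conjc; exact: cdreg_id.
  elim: N => [|N ih].
    apply: (@eq_cdreg _ (fun=> 0)); first by move=> z _; rewrite big_ord0.
    exact: cdreg_cst.
  apply: (@eq_cdreg _ (fun z => (\sum_(n < N) a n * z ^+ n) + a N * z ^+ N)).
    by move=> z _; rewrite big_ord_recr.
  apply: cdregD => //; apply: cdregM; first exact: cdreg_cst.
  by apply: cdregX; exact: cdreg_id.
have lim1 : ccvg \oo (fun N => circ_integral r (S N)) (circ_integral r (fun z => F z * conjc z ^+ m)).
  apply: (@cintegral_dominated _ _ _ mu circ measurable_circ
     (fun N t => S N (r%:C * expi t)) _ (fun=> B * (1 - s)^-1)).
  - by move=> N; apply: mcirc.
  - apply: (mcirc (fun z => F z * conjc z ^+ m)).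
    apply: cdregM; first exact: pseries_cdreg.
    by apply: cdregX; apply: cdreg_conjc; exact: cdreg_id.
  - move=> t _; apply: ccvgM; last exact: ccvg_cst.
    by apply: aF; rewrite rs.
  - by apply: circ_continuous_integrable => t; exact: cvg_cst.
  - move=> N t _; rewrite /S Normc.normcM normcX normc_conjc rs.
    rewrite (@le_trans _ _ (B * (1 - s)^-1 * 1))//; last by rewrite mulr1.
    apply: ler_pM; rewrite ?normc_ge0 ?exprn_ge0 ?(ltW r0)//.
      by apply: bound; rewrite rs.
    by rewrite exprn_ile1// ltW.
have val N : (m < N)%N -> circ_integral r (S N) = (pi *+ 2 * r ^+ m.*2)%:C * a m.
  move=> mN; rewrite /circ_integral.
  rewrite (@eq_cintegral _ _ _ mu circ _ (fun t => \sum_(n < N)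
    (a n * r%:C ^+ (n + m)) * (expi t ^+ n * conjc (expi t) ^+ m))); last first.
    move=> t _; rewrite /S mulr_suml; apply: eq_bigr => n _.
    have -> : conjc (r%:C * expi t) = r%:C * conjc (expi t) by rewrite rmorphM /= oppr0.
    by rewrite !exprMn exprD; ring.
  have ie n : cintg mu circ (fun t : R => expi t ^+ n * conjc (expi t) ^+ m).
    under eq_fun do rewrite expi_pow_mul.
    split; apply: circ_continuous_integrable => t /=.
      apply: continuous_comp; last exact: continuous_cos.
      by apply: cvgM => //; exact: cvg_cst.
    apply: continuous_comp; last exact: continuous_sin.
    by apply: cvgM => //; exact: cvg_cst.
  rewrite cintegral_sum//; [|exact: measurable_circ|]; last first.
    by move=> n; apply: cintgZ => //; exact: measurable_circ.
  rewrite (bigD1 (Ordinal mN))//= big1 ?addr0; last first.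
    move=> n nm; rewrite cintegralZ//; last exact: measurable_circ.
    rewrite circ_expi ifF ?mulr0//; apply/negbTE; apply: contra nm => /eqP h.
    by apply/eqP/val_inj.
  rewrite cintegralZ//; last exact: measurable_circ.
  by rewrite circ_expi eqxx addnn rmorphM /= rmorphXn /=; ring.
have lim2 : ccvg \oo (fun N => circ_integral r (S N)) ((pi *+ 2 * r ^+ m.*2)%:C * a m).
  by split; apply: cvg_near_cst; exists m.+1 => // N mN; rewrite (val N mN).
exact: ccvg_unique lim1 lim2.
Qed.

End power_series_function.

End analytic_disc_theory.

(** * The Bergman class and the moments of its functions *)

Section bergman_class.
Context {R : realType}.
Local Notation C := R[i].
Local Notation normc := (@Normc.normc R).
Local Notation mu := (@lebesgue_measure R).
Local Notation mu2 := (mu \x mu)%E.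
Local Notation D := (@Disc R).
Local Notation circ := (@circ_dom R).
Implicit Types f g : C -> C.

Lemma analytic_cdreg f : analytic_disc f -> cdreg f.
Proof. by move=> [a aF]; exact: (pseries_cdreg aF). Qed.

Lemma analyticD f g : analytic_disc f -> analytic_disc g ->
  analytic_disc (fun z => f z + g z).
Proof.
move=> [a aF] [b bF]; exists (fun n => a n + b n) => z z1.
rewrite (_ : (fun N => _) = (fun N => (\sum_(n < N) a n * z ^+ n) + \sum_(n < N) b n * z ^+ n)).
  by apply: ccvgD; [exact: aF|exact: bF].
by apply/funext => N; rewrite -big_split; apply: eq_bigr => n _; rewrite mulrDl.
Qed.

Lemma analyticZ c f : analytic_disc f -> analytic_disc (fun z => c * f z).
Proof.
move=> [a aF]; exists (fun n => c * a n) => z z1.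
rewrite (_ : (fun N => _) = (fun N => c * \sum_(n < N) a n * z ^+ n)); last first.
  by apply/funext => N; rewrite mulr_sumr; apply: eq_bigr => n _; rewrite mulrA.
by apply: ccvgM; [exact: ccvg_cst|exact: aF].
Qed.

Lemma analyticMX j f : analytic_disc f -> analytic_disc (fun z => z ^+ j * f z).
Proof.
move=> [a aF]; exists (fun n => if (n < j)%N then 0 else a (n - j)%N) => z z1.
have E N : \sum_(n < N + j) (if (n < j)%N then 0 else a (n - j)%N) * z ^+ n =
    z ^+ j * \sum_(n < N) a n * z ^+ n.
  rewrite addnC big_split_ord /= big1 ?add0r; last first.
    by move=> i _; rewrite ltn_ord mul0r.
  rewrite mulr_sumr; apply: eq_bigr => i _.
  rewrite ltnNge leq_addr /= addKn exprD; ring.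
have h : ccvg \oo (fun N => z ^+ j * \sum_(n < N) a n * z ^+ n) (z ^+ j * f z).
  by apply: ccvgM; [exact: ccvg_cst|exact: aF].
move: h => [h1 h2]; split.
  rewrite -(cvg_shiftn j); apply: cvg_trans h1; apply: near_eq_cvg; apply: nearW => N.
  by rewrite /= E.
rewrite -(cvg_shiftn j); apply: cvg_trans h2; apply: near_eq_cvg; apply: nearW => N.
by rewrite /= E.
Qed.

Lemma analytic_rot t f : analytic_disc f -> analytic_disc (fun z => f (rot t z)).
Proof.
move=> [a aF]; exists (fun n => a n * expi t ^+ n) => z z1.
rewrite (_ : (fun N => _) = (fun N => \sum_(n < N) a n * (rot t z) ^+ n)); last first.
  by apply/funext => N; apply: eq_bigr => n _; rewrite /rot exprMn mulrA.
by apply: aF; rewrite normc_rot.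
Qed.

Lemma analytic1 : analytic_disc (fun _ : C => 1).
Proof.
exists (fun n => if n == 0%N then 1 else 0) => z z1.
have E N : \sum_(n < N.+1) (if (n : nat) == 0%N then 1 else 0) * z ^+ n = 1.
  by rewrite big_ord_recl /= big1 ?addr0 ?mul1r// => i _; rewrite mul0r.
by split; apply: cvg_near_cst; exists 1%N => // -[|N] // _; rewrite E.
Qed.

Definition mom (i : nat) f : C := disc_integral (fun z => f z * conjc z ^+ i).

Lemma integral_pow (n : nat) :
  (\int[mu]_(r in `]0%R, 1%R[%classic) (r ^+ n)%:E)%E = (n.+1%:R^-1)%:E.
Proof.
rewrite -(@integral_itv_bndoo _ _ _ _ true false); last first.
  apply/measurable_EFinP; apply: measurable_funX; exact: measurable_funTS.
have [||_ ->] := @FTC_closed R (fun r => r ^+ n) (fun r => n.+1%:R^-1 * r ^+ n.+1) 0 1 ltr01.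
- move=> x _; have := rderivZ n.+1%:R^-1 (rderivX n x).
  by rewrite mulrA mulVf ?mul1r ?pnatr_eq0.
- by move=> x _; exact: exprn_continuous.
- by rewrite expr1n expr0n /= mulr0 subr0 mulr1.
Qed.

(** Each circle contributes [2 pi r^(2i) a_i]; with the area factor [r], integration of [r^(2i+1)]
    gives [1 / (2i + 2)]. *)
Lemma mom_coef (a : nat -> C) f i :
  (forall z : C, normc z < 1 -> ccvg \oo (fun N : nat => \sum_(n < N) a n * z ^+ n) (f z)) ->
  disc_intg f -> mom i f = (pi / i.+1%:R)%:C * a i.
Proof.
move=> aF jf; have [_ e] := disc_polar (disc_intg_conjX i jf).
rewrite /mom e (@eq_cintegral _ _ _ mu _ _
   (fun r : R => (pi *+ 2)%:C * a i * (r ^+ i.*2.+1)%:C)); last first.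
  move=> r; rewrite /= in_itv/= => r01; rewrite (circ_coef aF)//.
  by rewrite exprS !rmorphM /=; ring.
have ip : mu.-integrable `]0%R, 1%R[%classic (fun r : R => (r ^+ i.*2.+1)%:E).
  apply/integrableP; split.
    apply/measurable_EFinP; apply: measurable_funX; exact: measurable_funTS.
  rewrite [ltLHS](_ : _ = (i.*2.+2%:R^-1)%:E) ?ltry// -integral_pow.
  apply: eq_integral => r; rewrite inE /= in_itv/= => /andP[r0 _].
  by rewrite ger0_norm// exprn_ge0// ltW.
rewrite cintegralZ//; last by split => //=; exact: integrable0.
rewrite Re_cintegral_real /Rintegral integral_pow /=.
rewrite mulrAC -rmorphM /=; congr (_%:C * _).
rewrite -[i.*2.+2]/((i.+1).*2) -muln2 natrM -mulr_natr.
have : i.+1%:R != 0 :> R by rewrite pnatr_eq0.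
by move: (i.+1%:R) => c c0; field.
Qed.

Variable p : R.
Hypothesis p1 : 1 < p.
Let p0 : 0 < p. Proof. exact: lt_trans p1. Qed.

Definition inA f := analytic_disc f /\
  mu2.-integrable D (fun z => (Np p (f (cplx z)))%:E).

(** Area is not normalized here, so functions of norm 1 have [apI] equal to [pi]. *)
Definition apI f : R := \int[mu2]_(z in D) Np p (f (cplx z)).

Lemma apI_ge0 f : 0 <= apI f.
Proof. by apply: Rintegral_ge0 => z _; exact: Np_ge0. Qed.

Lemma Ap_intE f : inA f -> Ap_int p f = (pi^-1 * apI f)%:E.
Proof.
move=> [_ jf]; rewrite /Ap_int EFinM; congr (_ * _)%E.
rewrite /apI /Rintegral fineK//.
apply: integrable_fin_num => //; exact: measurable_Disc.
Qed.

Lemma in_ApP f : in_Ap p f <-> inA f.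
Proof.
split=> [[af h]|h]; last by split; [case: h|rewrite Ap_intE// ltry].
split=> //; apply/integrableP; split.
  by apply/measurable_EFinP; have [] := cdreg_Np p1 (analytic_cdreg af).
rewrite [ltLHS](_ : _ = \int[mu2]_(z in D) (Np p (f (cplx z)))%:E)%E; last first.
  by apply: eq_integral => z _; rewrite gee0_abs// lee_fin Np_ge0.
have i0 : (0 <= \int[mu2]_(z in D) (Np p (f (cplx z)))%:E)%E.
  by apply: integral_ge0 => z _; rewrite lee_fin Np_ge0.
rewrite ltey; apply/eqP => e.
move: h; rewrite /Ap_int; set I := (integral _ _ _).
have -> : I = +oo%E by exact: e.
by rewrite gt0_muley ?ltxx// lte_fin invr_gt0 pi_gt0.
Qed.

Lemma Ap_normE f : inA f -> Ap_norm p f = (pi^-1 * apI f) `^ p^-1.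
Proof. by move=> jf; rewrite /Ap_norm Ap_intE. Qed.

Lemma le_1powR (x : R) : 0 <= x -> x <= 1 + x `^ p.
Proof.
move=> x0; have [x1|x1] := leP x 1.
  by rewrite (le_trans x1)// lerDl powR_ge0.
rewrite (@le_trans _ _ (x `^ p))// ?lerDr//.
by rewrite -{1}(powRr1 x0) ler_powR// ltW.
Qed.

Lemma powR_mul_le (x y : R) : 0 <= x -> 0 <= y -> x * y `^ (p - 1) <= x `^ p + y `^ p.
Proof.
move=> x0 y0; have pm0 : 0 <= p - 1 by rewrite subr_ge0 ltW.
have [xy|xy] := leP x y.
  rewrite (@le_trans _ _ (y * y `^ (p - 1)))//; first by rewrite ler_wpM2r ?powR_ge0.
  by rewrite mulr_powRB1// lerDr powR_ge0.
rewrite (@le_trans _ _ (x * x `^ (p - 1)))//.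
  by rewrite ler_wpM2l// ge0_ler_powR// ?nnegrE// ltW.
by rewrite mulr_powRB1// lerDl powR_ge0.
Qed.

Lemma Np_add_le (a b : C) : Np p (a + b) <= 2 `^ p * (Np p a + Np p b).
Proof.
have mono (x y : R) : 0 <= x -> x <= y -> x `^ p <= y `^ p.
  move=> x0 xy; apply: (ge0_ler_powR (ltW p0)) => //; rewrite nnegrE//.
  exact: le_trans xy.
have key (u v : C) : normc u <= normc v -> Np p (u + v) <= 2 `^ p * Np p v.
  move=> uv; rewrite /Np -powRM ?normc_ge0//; apply: mono; first exact: normc_ge0.
  by rewrite (le_trans (le_normcD _ _))//; lra.
have [ab|ab] := leP (normc a) (normc b).
  rewrite (le_trans (key _ _ ab))// ler_wpM2l ?powR_ge0//.
  by rewrite lerDr Np_ge0.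
rewrite addrC (le_trans (key _ _ (ltW ab)))// ler_wpM2l ?powR_ge0//.
by rewrite lerDl Np_ge0.
Qed.

Lemma NpM (c w : C) : Np p (c * w) = Np p c * Np p w.
Proof. by rewrite /Np Normc.normcM powRM ?normc_ge0. Qed.

Lemma Disc_integrable_cst (c : R) : mu2.-integrable D (fun _ => c%:E).
Proof.
suff h : mu2.-integrable D (fun _ => 1%E).
  apply: (@eq_integrable _ _ _ mu2 D measurable_Disc (fun _ => (c * 1)%:E)).
    by move=> z _; rewrite mulr1.
  exact: (@integrable_EFinZl _ _ _ mu2 D measurable_Disc c (cst 1) h).
apply/integrableP; split; first exact: measurable_cst.
rewrite [ltLHS](_ : _ = \int[mu2]_(z in D) (1%:E))%E; last first.
  by apply: eq_integral => z _; rewrite /= normr1.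
have d1 : dreg (fun _ : C => 1 : R) by split => [|r _ t]; [exact: measurable_cst|exact: cvg_cst].
rewrite (polar_Disc_ge0 d1)// tonelli_rect1 //; first last.
- by move=> z [/= + _]; rewrite in_itv/= mulr1 lee_fin => /andP[/ltW].
- apply/measurable_EFinP; apply: measurable_funM; last exact: measurable_cst.
  exact: measurable_funTS.
- exact: measurable_circ.
rewrite [ltLHS](_ : _ =
    \int[mu]_(r in `]0%R, 1%R[%classic) ((pi *+ 2)%:E * (r ^+ 1)%:E))%E; last first.
  apply: eq_integral => r _.
  transitivity (\int[mu]_(t in circ) cst r%:E t)%E.
    by apply: eq_integral => t _; rewrite /= mulr1.
  rewrite integral_cst; last exact: measurable_circ.
  by rewrite [X in (_ * X)%E]mu_circ muleC expr1.
rewrite ge0_integralZl//.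
- by rewrite integral_pow -EFinM ltry.
- by apply/measurable_EFinP; apply: measurable_funX; exact: measurable_funTS.
- by move=> r; rewrite /= in_itv/= => /andP[/ltW r0 _]; rewrite lee_fin exprn_ge0.
- by rewrite lee_fin ltW// pi2_gt0.
Qed.

Lemma disc_integrableD (u v : C -> R) : mu2.-integrable D (fun z => (u (cplx z))%:E) ->
  mu2.-integrable D (fun z => (v (cplx z))%:E) ->
  mu2.-integrable D (fun z => (u (cplx z) + v (cplx z))%:E).
Proof. by move=> iu iv; under eq_fun do rewrite EFinD; exact: (@integrableD _ _ _ mu2 D measurable_Disc _ _ iu iv). Qed.

Lemma disc_integrableZ (c : R) (u : C -> R) : mu2.-integrable D (fun z => (u (cplx z))%:E) ->
  mu2.-integrable D (fun z => (c * u (cplx z))%:E).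
Proof. exact: (@integrable_EFinZl _ _ _ mu2 D measurable_Disc c (fun z => u (cplx z))). Qed.

Lemma disc_le_integrable (u v : C -> R) :
  measurable_fun D (fun z => u (cplx z)) ->
  mu2.-integrable D (fun z => (v (cplx z))%:E) ->
  (forall z, normc z < 1 -> `|u z| <= v z) -> mu2.-integrable D (fun z => (u (cplx z))%:E).
Proof.
move=> mu' iv uv; apply: (@le_integrable _ _ _ mu2 D measurable_Disc _ _ _ _ iv).
  exact/measurable_EFinP.
move=> z /DiscE z1; rewrite /= lee_fin.
by rewrite (le_trans (uv _ z1))// ler_norm.
Qed.

Lemma inA_disc_intg f : inA f -> disc_intg f.
Proof.
move=> [af jf]; apply: (@disc_intg_bound _ _ (fun z => 1 + Np p (f z))).
- exact: analytic_cdreg.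
- exact: (@disc_integrableD (fun=> 1) (fun z => Np p (f z)) (Disc_integrable_cst 1) jf).
- by move=> z _; rewrite le_1powR// normc_ge0.
Qed.

Lemma inA_mul_Gp f g : inA f -> inA g -> disc_intg (fun z => f z * Gp p (g z)).
Proof.
move=> [af jf] [ag jg]; apply: (@disc_intg_bound _ _ (fun z => Np p (f z) + Np p (g z))).
- apply: cdregM; first exact: analytic_cdreg.
  by apply: cdreg_Gp => //; exact: analytic_cdreg.
- exact: (@disc_integrableD (fun z => Np p (f z)) (fun z => Np p (g z)) jf jg).
- by move=> z _; rewrite Normc.normcM normc_Gp// powR_mul_le// normc_ge0.
Qed.

Lemma inAD f g : inA f -> inA g -> inA (fun z => f z + g z).
Proof.
move=> [af jf] [ag jg]; have afg := analyticD af ag; split => //.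
have [m _] := cdreg_Np p1 (analytic_cdreg afg).
apply: (disc_le_integrable (u := fun z => Np p (f z + g z)) m
   (v := fun z => 2 `^ p * (Np p (f z) + Np p (g z)))).
  apply: (@disc_integrableZ _ (fun z => Np p (f z) + Np p (g z))).
  exact: (@disc_integrableD (fun z => Np p (f z)) (fun z => Np p (g z)) jf jg).
by move=> z _; rewrite ger0_norm ?Np_ge0// Np_add_le.
Qed.

Lemma inAZ c f : inA f -> inA (fun z => c * f z).
Proof.
move=> [af jf]; split; first exact: analyticZ.
by under eq_fun do rewrite NpM; exact: (@disc_integrableZ _ (fun z => Np p (f z))).
Qed.

Lemma apIZ c f : inA f -> apI (fun z => c * f z) = Np p c * apI f.
Proof.
move=> [af jf]; rewrite /apI -(@RintegralZl _ _ _ mu2 D _ (Np p c) measurable_Disc jf).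
by apply: eq_Rintegral => z _; rewrite NpM.
Qed.

Lemma inA_rot t f : `|t| <= pi *+ 2 -> inA f -> inA (fun z => f (rot t z)).
Proof.
move=> tp [af jf]; split; first exact: analytic_rot.
exact: (rot_integrable tp (cdreg_Np p1 (analytic_cdreg af)) jf).
Qed.

Lemma inAMX j f : inA f -> inA (fun z => z ^+ j * f z).
Proof.
move=> [af jf]; have afj := analyticMX j af; split => //.
have [m _] := cdreg_Np p1 (analytic_cdreg afj).
apply: (@disc_le_integrable (fun z => Np p (z ^+ j * f z)) (fun z => Np p (f z)) m jf) => z z1.
rewrite ger0_norm ?Np_ge0// /Np (ge0_ler_powR (ltW p0)) ?nnegrE ?normc_ge0//.
rewrite Normc.normcM normcX ler_piMl ?normc_ge0// exprn_ile1 ?normc_ge0//; exact: ltW.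
Qed.

Lemma inA1 : inA (fun=> 1).
Proof. by split; [exact: analytic1|exact: Disc_integrable_cst]. Qed.

End bergman_class.

(** * The functional [phi] and the extremal problem *)

Section extremal_problem.
Context {R : realType}.
Local Notation C := R[i].
Local Notation normc := (@Normc.normc R).
Local Notation mu := (@lebesgue_measure R).
Local Notation mu2 := (mu \x mu)%E.
Local Notation D := (@Disc R).
Implicit Types f g : C -> C.

Lemma conjc_horner (k : {poly C}) (z : C) :
  conjc k.[z] = \sum_(i < size k) conjc k`_i * conjc z ^+ i.
Proof.
by rewrite horner_coef rmorph_sum; apply: eq_bigr => i _; rewrite rmorphM rmorphXn.
Qed.

Lemma phi_mom (k : {poly C}) f : disc_intg f ->
  phi k f = (pi^-1)%:C * \sum_(i < size k) conjc k`_i * mom i f.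
Proof.
move=> jf; congr (_ * _).
transitivity (disc_integral (fun z => \sum_(i < size k) conjc k`_i * (f z * conjc z ^+ i))).
  apply: eq_cintegral => z _; rewrite conjc_horner mulr_sumr.
  by apply: eq_bigr => i _; rewrite mulrCA.
rewrite disc_integral_sum; last by move=> i; apply: disc_intgZ; exact: disc_intg_conjX.
apply: eq_bigr => i _; have [_ ci] := disc_intg_conjX i jf.
exact: (@cintegralZ _ _ _ mu2 D measurable_Disc _ _ ci).
Qed.

Lemma momD i f g : disc_intg f -> disc_intg g ->
  mom i (fun z => f z + g z) = mom i f + mom i g.
Proof.
move=> jf jg; have [_ cf] := disc_intg_conjX i jf; have [_ cg] := disc_intg_conjX i jg.
rewrite /mom /disc_integral -(@cintegralD _ _ _ mu2 D measurable_Disc _ _ cf cg).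
by apply: eq_cintegral => z _; rewrite mulrDl.
Qed.

Lemma momZ i c f : disc_intg f -> mom i (fun z => c * f z) = c * mom i f.
Proof.
move=> jf; have [_ cf] := disc_intg_conjX i jf.
rewrite /mom /disc_integral -(@cintegralZ _ _ _ mu2 D measurable_Disc c _ cf).
by apply: eq_cintegral => z _; rewrite mulrA.
Qed.

Lemma phiD (k : {poly C}) f g : disc_intg f -> disc_intg g ->
  phi k (fun z => f z + g z) = phi k f + phi k g.
Proof.
move=> jf jg; rewrite !phi_mom//; last exact: disc_intgD.
rewrite -mulrDr -big_split; congr (_ * _); apply: eq_bigr => i _ /=.
by rewrite momD// mulrDr.
Qed.

Lemma phiZ (k : {poly C}) c f : disc_intg f -> phi k (fun z => c * f z) = c * phi k f.
Proof.
move=> jf; rewrite !phi_mom//; last exact: disc_intgZ.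
rewrite [RHS]mulrCA; congr (_ * _); rewrite mulr_sumr; apply: eq_bigr => i _.
by rewrite momZ// mulrCA.
Qed.

Variable p : R.
Hypothesis p1 : 1 < p.
Let p0 : 0 < p. Proof. exact: lt_trans p1. Qed.

(** A supremum of an unbounded set would be a default value; this crude bound shows that [phi] is
    bounded on the unit sphere, so that [sup] is a true upper bound. It also handles the functions
    with [apI] equal to 0, which cannot be normalized. *)
Lemma phi_bounded (k : {poly C}) : exists2 K : R, 0 <= K &
  forall f, inA p f -> normc (phi k f) <= K * (1 + apI p f).
Proof.
pose V : R := \int[mu2]_(z in D) 1.
have V0 : 0 <= V by apply: Rintegral_ge0.
pose S := \sum_(i < size k) normc k`_i.
have S0 : 0 <= S by apply: sumr_ge0 => i _; exact: normc_ge0.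
exists (pi^-1 * S * (2 * (V + 1))).
  by rewrite !mulr_ge0 ?invr_ge0 ?pi_ge0// addr_ge0.
move=> f Af; have jf := inA_disc_intg p1 Af.
have A0 := apI_ge0 p f.
rewrite phi_mom// Normc.normcM normc_real ger0_norm ?invr_ge0 ?pi_ge0// -!mulrA.
rewrite ler_wpM2l ?invr_ge0 ?pi_ge0//.
rewrite (le_trans (normc_sum _ _ _))// mulr_suml; apply: ler_sum => i _.
rewrite Normc.normcM normc_conjc ler_wpM2l ?normc_ge0//.
have [di _] := disc_intg_conjX i jf.
have i1 := @disc_integrableD _ (fun=> 1) (fun z => Np p (f z)) (Disc_integrable_cst 1) Af.2.
apply: (@le_trans _ _ (2 * \int[mu2]_(z in D) (1 + Np p (f (cplx z))))).
  apply: (@normc_cintegral_le _ _ _ mu2 D measurable_Disc _ (fun z => 1 + Np p (f (cplx z)))) => //.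
    exact: di.1.
  move=> z /DiscE z1; rewrite Normc.normcM normcX normc_conjc.
  apply: (@le_trans _ _ (normc (f (cplx z)))).
    by rewrite ler_piMr ?normc_ge0// exprn_ile1 ?normc_ge0// ltW.
  by rewrite le_1powR// normc_ge0.
rewrite (@RintegralD _ _ _ mu2 D _ _ measurable_Disc (Disc_integrable_cst 1) Af.2).
rewrite -/V -/(apI p f) ler_wpM2l//; nra.
Qed.

Variables (k : {poly C}) (F : C -> C).
Hypothesis k0 : k != 0.
Hypothesis exF : extremal p k F.

Local Notation Phi := (phi_norm p k).

Lemma extremal_inA : inA p F.
Proof. by apply/(in_ApP p1); case: exF => -[]. Qed.

Let AF := extremal_inA.

Lemma extremal_apI : apI p F = pi.
Proof.
have [[_ n1] _] := exF; move: n1; rewrite Ap_normE// => n1.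
have h0 : 0 <= pi^-1 * apI p F by rewrite mulr_ge0 ?invr_ge0 ?pi_ge0 ?apI_ge0.
have : pi^-1 * apI p F = 1.
  have := congr1 (fun x => x `^ p) n1.
  by rewrite -powRrM mulVf ?gt_eqF// powRr1// pow1R.
move=> h; have pin : pi != 0 :> R by rewrite gt_eqF// pi_gt0.
by rewrite -[LHS]mul1r -(mulfV pin) -mulrA h mulr1.
Qed.

Lemma extremal_Re_phi : complex.Re (phi k F) = Phi.
Proof. by case: exF => _ []. Qed.

Let Re_phi_sphere g : Ap_sphere p g -> complex.Re (phi k g) <= Phi.
Proof.
move=> Sg; have [SF [e1 _]] := exF; rewrite -extremal_Re_phi e1.
have [K K0 hK] := phi_bounded k.
apply: ub_le_sup; last by exists g.
exists (K * (1 + pi)) => _ [f [/(in_ApP p1) Af n1] <-].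
rewrite (le_trans (Re_le_normc _))// (le_trans (hK f Af))// ler_wpM2l// lerD2l.
move: n1; rewrite Ap_normE// => n1.
have h0 : 0 <= pi^-1 * apI p f by rewrite mulr_ge0 ?invr_ge0 ?pi_ge0 ?apI_ge0.
have : pi^-1 * apI p f = 1.
  have := congr1 (fun x => x `^ p) n1.
  by rewrite -powRrM mulVf ?gt_eqF// powRr1// pow1R.
move=> h; have pin : pi != 0 :> R by rewrite gt_eqF// pi_gt0.
by rewrite -[leLHS]mul1r -(mulfV pin) -mulrA h mulr1.
Qed.

Lemma Re_phi_le g : inA p g -> complex.Re (phi k g) <= Phi * (pi^-1 * apI p g) `^ p^-1.
Proof.
move=> Ag; have jg := inA_disc_intg p1 Ag.
have pip : 0 < pi^-1 :> R by rewrite invr_gt0 pi_gt0.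
have := apI_ge0 p g; rewrite le_eqVlt => /predU1P[e|ag].
  rewrite -e mulr0 powR0 ?gt_eqF ?invr_gt0// mulr0.
  have [K K0 hK] := phi_bounded k.
  rewrite leNgt; apply/negP => ph.
  (* With [apI p g = 0] every multiple of [g] obeys the same bound [K]; this factor would make the
     real part of [phi] equal to [K + 1]. *)
  pose t := (K + 1) / complex.Re (phi k g).
  have t0 : 0 < t by rewrite divr_gt0//; lra.
  have := hK _ (inAZ t%:C Ag).
  rewrite apIZ// -e mulr0 addr0 mulr1 phiZ// => h.
  have := le_trans (Re_le_normc _) h.
  rewrite ReMl /t divfK ?gt_eqF//; lra.
set n := (pi^-1 * apI p g) `^ p^-1.
have n0 : 0 < n by rewrite powR_gt0// mulr_gt0.
have S : Ap_sphere p (fun z => (n^-1)%:C * g z).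
  split; first by apply/(in_ApP p1); exact: inAZ.
  rewrite Ap_normE; last exact: inAZ.
  rewrite apIZ// mulrCA /Np normc_real ger0_norm ?invr_ge0 ?(ltW n0)//.
  rewrite powRM ?powR_ge0//; last by rewrite mulr_ge0 ?(ltW pip) ?apI_ge0.
  rewrite -powRrM mulfV ?gt_eqF// powRr1 ?invr_ge0 ?(ltW n0)//.
  by rewrite -/n mulVf// gt_eqF.
have := Re_phi_sphere S; rewrite phiZ// ReMl.
by rewrite mulrC ler_pdivrMr.
Qed.

Lemma pow_coef (m : nat) (z : C) : normc z < 1 ->
  ccvg \oo (fun N : nat => \sum_(n < N) ((n : nat) == m)%:R * z ^+ n) (z ^+ m).
Proof.
move=> z1.
have E N : (m < N)%N -> \sum_(n < N) ((n : nat) == m)%:R * z ^+ n = z ^+ m.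
  move=> mN; rewrite (bigD1 (Ordinal mN))//= eqxx mul1r big1 ?addr0// => i im.
  rewrite (_ : (i : nat) == m = false) ?mul0r//; apply/negbTE; apply: contra im => /eqP h.
  by apply/eqP/val_inj.
by split; apply: cvg_near_cst; exists m.+1 => // N mN; rewrite (E N mN).
Qed.

(** The test function is [k_m z^m], with [m] the degree of [k]. By orthogonality only the
    coefficient of index [m] contributes, and [phi] takes the value [|k_m|^2 / (m + 1)]. *)
Lemma Phi_gt0 : 0 < Phi.
Proof.
pose m := (size k).-1.
have km : k`_m != 0 by rewrite -lead_coefE lead_coef_eq0.
have mk : (m < size k)%N by rewrite prednK// size_poly_gt0.
have Am : inA p (fun z => z ^+ m * 1) by apply: inAMX => //; exact: inA1.
have jm := inA_disc_intg p1 Am.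
have Ag := inAZ k`_m Am.
have := Re_phi_le Ag; rewrite phiZ// phi_mom//.
have am z : normc z < 1 ->
    ccvg \oo (fun N : nat => \sum_(n < N) ((n : nat) == m)%:R * z ^+ n) (z ^+ m * 1).
  by move=> z1; rewrite mulr1; exact: pow_coef.
rewrite (bigD1 (Ordinal mk))//= big1 ?addr0; last first.
  move=> i im; rewrite (mom_coef (a := fun n => (n == m)%:R) i am jm).
  rewrite (_ : (i : nat) == m = false) ?mulr0//; apply/negbTE; apply: contra im => /eqP h.
  by apply/eqP/val_inj.
rewrite (mom_coef (a := fun n => (n == m)%:R) m am jm) eqxx mulr1.
have -> : k`_m * ((pi^-1)%:C * (conjc k`_m * (pi / m.+1%:R)%:C)) =
    (normc k`_m ^+ 2 / m.+1%:R)%:C.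
  have -> : (normc k`_m ^+ 2 / m.+1%:R)%:C = (pi^-1)%:C * (pi / m.+1%:R)%:C * (normc k`_m ^+ 2)%:C.
    rewrite -!rmorphM /=; congr (_%:C).
    have : m.+1%:R != 0 :> R by rewrite pnatr_eq0.
    have : pi != 0 :> R by rewrite gt_eqF// pi_gt0.
    by move: (m.+1%:R) pi => c d d0 c0; field; rewrite c0 d0.
  by rewrite -mul_conjc; ring.
move=> h; rewrite ltNge; apply/negP => Phi0.
have : 0 < normc k`_m ^+ 2 / m.+1%:R by rewrite divr_gt0// exprn_gt0// normc_gt0.
rewrite ltNge => /negP; apply; apply: (le_trans h).
by rewrite mulr_le0_ge0// powR_ge0.
Qed.

End extremal_problem.

(** * The variational identity satisfied by the extremal function *)

Section variational_identity.
Context {R : realType}.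
Local Notation C := R[i].
Local Notation normc := (@Normc.normc R).
Local Notation mu := (@lebesgue_measure R).
Local Notation mu2 := (mu \x mu)%E.
Local Notation D := (@Disc R).
Implicit Types f g : C -> C.
Variable p : R.
Hypothesis p1 : 1 < p.
Let p0 : 0 < p. Proof. exact: lt_trans p1. Qed.
Variables (k : {poly C}) (F : C -> C).
Hypothesis k0 : k != 0.
Hypothesis exF : extremal p k F.
Local Notation Phi := (phi_norm p k).
Let AF : inA p F := extremal_inA p1 exF.

Lemma disc_integralZ c f : disc_intg f ->
  disc_integral (fun z => c * f z) = c * disc_integral f.
Proof. by move=> [_ cf]; exact: (@cintegralZ _ _ _ mu2 D measurable_Disc c _ cf). Qed.

Lemma disc_integralD f g : disc_intg f -> disc_intg g ->
  disc_integral (fun z => f z + g z) = disc_integral f + disc_integral g.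
Proof. by move=> [_ cf] [_ cg]; exact: (@cintegralD _ _ _ mu2 D measurable_Disc _ _ cf cg). Qed.

Lemma disc_integralB f g : disc_intg f -> disc_intg g ->
  disc_integral (fun z => f z - g z) = disc_integral f - disc_integral g.
Proof. by move=> [_ cf] [_ cg]; exact: (@cintegralB _ _ _ mu2 D measurable_Disc _ _ cf cg). Qed.

Lemma eq_disc_integral f g : (forall z, normc z < 1 -> f z = g z) ->
  disc_integral f = disc_integral g.
Proof. by move=> fg; apply: eq_cintegral => z /DiscE; exact: fg. Qed.

Let Np_small (e : R) (w : C) : 0 < e <= 1 -> Np p (e%:C * w) <= Np p w.
Proof.
move=> /andP[e0 e1]; rewrite NpM ler_piMl ?Np_ge0// /Np normc_real gtr0_norm//.
by rewrite -[leRHS](pow1R p) ge0_ler_powR// ?nnegrE ?(ltW p0) ?(ltW e0).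
Qed.

(** Compare [phi] at [F + e g] with [Phi] times the norm of [F + e g]. The tangent to [|w|^p] is
    taken at the perturbed point, which bounds the norm from above without differentiating it, and
    concavity of [x^(1/p)] linearizes the root. Division by [e] leaves the gradient at [F + e g]. *)
Let variation_le g (e : R) : inA p g -> 0 < e -> complex.Re (phi k g) <=
  Phi * (pi^-1 * complex.Re (disc_integral (fun z => g z * Gp p (F z + e%:C * g z)))).
Proof.
move=> Ag e0; have Aeg := inAZ e%:C Ag; have Ab := inAD p1 AF Aeg.
have Ph := Phi_gt0 p1 k0 exF.
have := Re_phi_le p1 exF Ab; rewrite phiD ?phiZ; try exact: (inA_disc_intg p1).
rewrite ReD (extremal_Re_phi exF) ReMl.
set b := fun z => F z + e%:C * g z.
set I := complex.Re _; set J := complex.Re (disc_integral _) => h.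
have pip : 0 < pi^-1 :> R by rewrite invr_gt0 pi_gt0.
have [_ [iG _]] := inA_mul_Gp p1 Ag Ab.
have AI : apI p b <= pi + p * e * J.
  rewrite -(extremal_apI p1 exF) /J /disc_integral /= /apI.
  have iG2 := @integrable_EFinZl _ _ _ mu2 D measurable_Disc (p * e) _ iG.
  rewrite -(@RintegralZl _ _ _ mu2 D _ (p * e) measurable_Disc iG).
  rewrite -(@RintegralD _ _ _ mu2 D _ _ measurable_Disc AF.2 iG2).
  apply: le_Rintegral; first exact: measurable_Disc.
  - exact: Ab.2.
  - exact: (@disc_integrableD _ (fun z => Np p (F z))
      (fun z => p * e * complex.Re (g z * Gp p (b z))) AF.2 iG2).
  move=> z _; apply: (le_trans (Np_convex_upper p1 (F (cplx z)) (b (cplx z)))).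
  rewrite lerD2l -mulrA ler_wpM2l ?(ltW p0)// /b addrC addKr -mulrA.
  by rewrite -ReMl.
have J0 : 0 <= pi^-1 * apI p b by rewrite mulr_ge0 ?(ltW pip) ?apI_ge0.
have pi1 : p^-1 <= 1 by rewrite invf_le1// ltW.
have := powR_le_linear (_ : 0 < p^-1) pi1 J0; rewrite invr_gt0 => /(_ p0) h2.
have h3 : pi^-1 * apI p b <= 1 + pi^-1 * (p * e * J).
  have := ler_wpM2l (ltW pip) AI; rewrite mulrDr mulVf// gt_eqF//; exact: pi_gt0.
have h4 : (pi^-1 * apI p b) `^ p^-1 <= 1 + e * (pi^-1 * J).
  apply: (le_trans h2).
  have pv : 0 <= p^-1 by rewrite invr_ge0 ltW.
  have := ler_wpM2l pv h3.
  have -> : p^-1 * (1 + pi^-1 * (p * e * J)) = p^-1 + e * (pi^-1 * J).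
    have pin : pi != 0 :> R by rewrite gt_eqF// pi_gt0.
    have pn : p != 0 by rewrite gt_eqF.
    by move: (pi : R) pin => q qn; field; rewrite pn qn.
  lra.
have h5 : Phi + e * I <= Phi + Phi * (e * (pi^-1 * J)).
  rewrite -{2}[Phi]mulr1 -mulrDr; exact: le_trans h (ler_wpM2l (ltW Ph) h4).
by rewrite -(ler_pM2l e0) [leRHS]mulrCA; rewrite lerD2l in h5.
Qed.

(** The perturbation tends to 0: [Gp] is continuous, also at the zeros of [F], and steps of size at
    most 1 have a common majorant. *)
Let Re_variational_le g : inA p g -> complex.Re (phi k g) <=
  Phi * (pi^-1 * complex.Re (disc_integral (fun z => g z * Gp p (F z)))).
Proof.
move=> Ag; pose e (n : nat) : R := n.+1%:R^-1.
have e01 n : 0 < e n <= 1 by rewrite invr_gt0 ltr0n/= invf_le1 ?ler1n ?ltr0n.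
have e0 : e n @[n --> \oo] --> 0 by exact: cvg_harmonic.
have [ag jg] := Ag; have [aF jF] := AF.
have dg := analytic_cdreg ag; have dF := analytic_cdreg aF.
have lim : ccvg \oo (fun n => disc_integral (fun z => g z * Gp p (F z + (e n)%:C * g z)))
    (disc_integral (fun z => g z * Gp p (F z))).
  apply: (@cintegral_dominated _ _ _ mu2 D measurable_Disc
    (fun n z => g (cplx z) * Gp p (F (cplx z) + (e n)%:C * g (cplx z))) _
    (fun z => Np p (g (cplx z)) + 2 `^ p * (Np p (F (cplx z)) + Np p (g (cplx z))))).
  - move=> n.
    by have [] := cdregM dg (cdreg_Gp p1 (cdregD dF (cdregM (cdreg_cst (e n)%:C) dg))).
  - by have [] := cdregM dg (cdreg_Gp p1 dF).
  - move=> z _; apply: ccvgM; first exact: ccvg_cst.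
    apply: ccvg_Gp => //; rewrite -[X in ccvg _ _ X]addr0.
    apply: ccvgD; first exact: ccvg_cst.
    rewrite -[X in ccvg _ _ X](mul0r (g (cplx z))).
    by apply: ccvgM; [exact: ccvg_real|exact: ccvg_cst].
  - apply: (@disc_integrableD _ (fun z => Np p (g z)) (fun z => 2 `^ p * (Np p (F z) + Np p (g z)))) => //.
    apply: (@disc_integrableZ _ _ (fun z => Np p (F z) + Np p (g z))).
    exact: (@disc_integrableD _ (fun z => Np p (F z)) (fun z => Np p (g z))).
  - move=> n z _; rewrite Normc.normcM normc_Gp//.
    apply: (le_trans (powR_mul_le p1 (normc_ge0 _) (normc_ge0 _))).
    rewrite lerD2l (le_trans (Np_add_le p1 _ _))// ler_wpM2l ?powR_ge0// lerD2l.
    exact: Np_small.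
have l2 : Phi * (pi^-1 * complex.Re (disc_integral (fun z => g z * Gp p (F z + (e n)%:C * g z))))
    @[n --> \oo] --> Phi * (pi^-1 * complex.Re (disc_integral (fun z => g z * Gp p (F z)))).
  by apply: cvgM; [exact: cvg_cst|apply: cvgM; [exact: cvg_cst|case: lim]].
rewrite -(cvg_lim (@Rhausdorff R) l2); apply: limr_ge.
  by apply/cvg_ex; eexists; exact: l2.
by apply: nearW => n; apply: variation_le => //; have /andP[] := e01 n.
Qed.

(** Both sides are complex linear in [g]. The inequality for [-g] makes the one for real parts an
    equality, and the equality for [-i g] is the one for imaginary parts. *)
Lemma variational_identity g : inA p g ->
  pi%:C * phi k g = Phi%:C * disc_integral (fun z => g z * Gp p (F z)).
Proof.
move=> Ag; have pin : pi != 0 :> R by rewrite gt_eqF// pi_gt0.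
have Reeq f : inA p f -> complex.Re (phi k f) =
    Phi * (pi^-1 * complex.Re (disc_integral (fun z => f z * Gp p (F z)))).
  move=> Af; apply/eqP; rewrite eq_le Re_variational_le//=.
  have := Re_variational_le (inAZ (-1) Af); rewrite phiZ; last exact: (inA_disc_intg p1).
  have -> : disc_integral (fun z => -1 * f z * Gp p (F z)) =
      -1 * disc_integral (fun z => f z * Gp p (F z)).
    rewrite -disc_integralZ; last exact: inA_mul_Gp.
    by apply: eq_disc_integral => z _; rewrite mulrA.
  by rewrite !mulN1r !ReN !mulrN lerN2.
have h1 := Reeq g Ag; have h2 := Reeq _ (inAZ (Complex 0 (-1)) Ag).
have Im_i (w : C) : complex.Re (Complex 0 (-1) * w) = complex.Im w.
  by rewrite ReM /=; ring.
rewrite phiZ in h2; last exact: (inA_disc_intg p1).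
have e : disc_integral (fun z => Complex 0 (-1) * g z * Gp p (F z)) =
    Complex 0 (-1) * disc_integral (fun z => g z * Gp p (F z)).
  rewrite -disc_integralZ; last exact: inA_mul_Gp.
  by apply: eq_disc_integral => z _; rewrite mulrA.
rewrite e !Im_i in h2.
apply: complexP; [rewrite ReMl [RHS]ReMl h1|rewrite ImMl [RHS]ImMl h2];
  by rewrite mulrCA [pi * _]mulrA mulfV// mul1r.
Qed.

End variational_identity.

(** * Limits of integrals without a dominating function *)

Section fatou_convergence.
Context {d : measure_display} {T : measurableType d} {R : realType}.
Variables (mu : {measure set T -> \bar R}) (D : set T).
Hypothesis mD : measurable D.

(** The integrands are not assumed to converge: [g] is merely an eventual lower bound up to [e].
    This admits a nonnegative summand of which only the integral is controlled. *)
Lemma fatou_le (f : nat -> T -> R) (g : T -> R) (b : nat -> R) (B : R) :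
  (forall n, measurable_fun D (f n)) -> measurable_fun D g ->
  (forall n x, D x -> 0 <= f n x) -> (forall x, D x -> 0 <= g x) ->
  (forall x, D x -> forall e, 0 < e -> \forall n \near \oo, g x - e <= f n x) ->
  (forall n, (\int[mu]_(x in D) (f n x)%:E <= (b n)%:E)%E) ->
  b n @[n --> \oo] --> B ->
  (\int[mu]_(x in D) (g x)%:E <= B%:E)%E.
Proof.
move=> mf mg f0 g0 gf fb bB.
pose h n x := (f n x)%:E.
have mh n : measurable_fun D (h n) by exact/measurable_EFinP.
have h0 n x : D x -> (0 <= h n x)%E by move=> Dx; rewrite lee_fin f0.
have glim x : D x -> ((g x)%:E <= limn_einf (h ^~ x))%E.
  move=> Dx; apply/lee_addgt0Pr => e e0.
  rewrite -leeBlDr// -EFinB limn_einf_lim; apply: lime_ge; first exact: is_cvg_einfs.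
  have [N _ hN] := gf x Dx e e0; exists N => // n /= Nn.
  apply: le_ereal_inf_tmp => _ [m /= nm <-].
  by rewrite /h lee_fin; apply: hN => /=; exact: leq_trans Nn nm.
apply: (@le_trans _ _ (\int[mu]_(x in D) limn_einf (h ^~ x))%E).
  apply: ge0_le_integral => //.
  - exact/measurable_EFinP.
  - apply: (emeasurable_fun_cvg (fun n x => einfs (h ^~ x) n)).
      exact: measurable_fun_einfs.
    by move=> x Dx; rewrite limn_einf_lim; exact: is_cvg_einfs.
apply: (le_trans (fatou mu mD mh h0)).
rewrite limn_einf_lim.
have bc : (b n)%:E @[n --> \oo] --> B%:E by apply: cvg_EFin => //; exact: nearW.
rewrite -(cvg_lim _ bc)//; apply: lee_lim; first exact: is_cvg_einfs.
  by apply/cvg_ex; eexists; exact: bc.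
apply: nearW => n; apply: le_trans (fb n); apply: ereal_inf_lbound.
by exists n => /=.
Qed.

Variables (v X Y : nat -> T -> R) (v' Y' : T -> R) (K y : R).
Hypothesis mv : forall n, measurable_fun D (v n).
Hypothesis mv' : measurable_fun D v'.
Hypothesis iX : forall n, mu.-integrable D (fun x => (X n x)%:E).
Hypothesis iY : forall n, mu.-integrable D (fun x => (Y n x)%:E).
Hypothesis iY' : mu.-integrable D (fun x => (Y' x)%:E).
Hypothesis X0 : forall n x, D x -> 0 <= X n x.
Hypothesis vXY : forall (l : R) n x, 0 < l -> D x -> `|v n x| <= l * X n x + l^-1 * Y n x.
Hypothesis XK : forall n, \int[mu]_(x in D) X n x <= K.
Hypothesis Yy : forall n, \int[mu]_(x in D) Y n x = y.
Hypothesis Yy' : \int[mu]_(x in D) Y' x = y.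
Hypothesis vv' : forall x, D x -> v n x @[n --> \oo] --> v' x.
Hypothesis YY' : forall x, D x -> Y n x @[n --> \oo] --> Y' x.

Let measR (f : T -> R) : mu.-integrable D (fun x => (f x)%:E) -> measurable_fun D f.
Proof. by move=> /measurable_int/measurable_EFinP. Qed.

Let iD (f g : T -> R) : mu.-integrable D (fun x => (f x)%:E) ->
  mu.-integrable D (fun x => (g x)%:E) -> mu.-integrable D (fun x => (f x + g x)%:E).
Proof. by move=> jf jg; under eq_fun do rewrite EFinD; exact: integrableD. Qed.

Let iv n : mu.-integrable D (fun x => (v n x)%:E).
Proof.
have i1 := iD (integrable_EFinZl mD 1 (iX n)) (integrable_EFinZl mD 1 (iY n)).
apply: le_integrable i1 => //; first exact/measurable_EFinP.
move=> x Dx; rewrite /= lee_fin; have := vXY n ltr01 Dx; rewrite invr1 => h.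
by rewrite (le_trans h)// ler_norm.
Qed.

Lemma fatou_integrable : mu.-integrable D (fun x => (v' x)%:E).
Proof.
apply/integrableP; split; first exact/measurable_EFinP.
apply: (@le_lt_trans _ _ (K + y)%:E); last exact: ltry.
apply: (@fatou_le (fun n x => `|v n x|) (fun x => `|v' x|) (fun=> K + y)) => //.
- by move=> n; apply: measurableT_comp.
- exact: measurableT_comp.
- move=> x Dx e e0; have c : `|v n x| @[n --> \oo] --> `|v' x| by apply: cvg_norm; exact: vv'.
  by move/cvgrPdist_le : c => /(_ _ e0); apply: filterS => n; rewrite ler_norml => /andP[_]; lra.
- move=> n.
  have i1 := iD (iX n) (iY n).
  apply: (@le_trans _ _ (\int[mu]_(x in D) (X n x + Y n x)%:E)%E).
    apply: ge0_le_integral => //.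
    + by apply/measurable_EFinP; apply: measurableT_comp.
    + exact: measurable_int i1.
    + by move=> x Dx; rewrite lee_fin; have := vXY n ltr01 Dx; rewrite invr1 !mul1r.
  have := @RintegralD _ _ _ mu D _ _ mD (iX n) (iY n); rewrite /Rintegral => e.
  rewrite -[leLHS]fineK; last exact: integrable_fin_num.
  by rewrite e lee_fin; apply: lerD; [exact: XK|rewrite -(Yy n)].
- exact: cvg_cst.
Qed.

(** Fatou applied to [s X + Y / s + v], which is nonnegative. The integrals of [Y / s] and [Y' / s]
    are equal and cancel, so the integral of [v'] exceeds the limit by at most [s K], and [s] is
    chosen to make this at most [e]; the [K + 1] in its denominator covers [K = 0]. *)
Let upper (l : R) : \int[mu]_(x in D) v n x @[n --> \oo] --> l ->
  \int[mu]_(x in D) v' x <= l.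
Proof.
move=> vl; apply/ler_addgt0Pr => e e0.
have K0 : 0 <= K by apply: le_trans (XK 0); apply: Rintegral_ge0 => x; exact: X0.
pose s := e / (K + 1).
have s0 : 0 < s by rewrite divr_gt0//; lra.
have sK : s * K <= e.
  rewrite /s mulrAC ler_pdivrMr; last lra.
  by rewrite ler_wpM2l//; lra.
pose g x := s^-1 * Y' x + v' x.
have ig : mu.-integrable D (fun x => (g x)%:E).
  by apply: iD; [exact: integrable_EFinZl|exact: fatou_integrable].
have mg := measR ig.
(* [X] has no pointwise limit, so without it [g] may be negative; cutting at 0 restores the sign
   that Fatou requires. *)
have imax : mu.-integrable D (fun x => (Num.max (g x) 0)%:E).
  apply: le_integrable ig => //.
    by apply/measurable_EFinP; apply: measurable_maxr => //; exact: measurable_cst.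
  by move=> x Dx; rewrite /= lee_fin maxEle; case: ifP; rewrite ?normr0.
pose b n := s * K + s^-1 * y + \int[mu]_(x in D) v n x.
have main : (\int[mu]_(x in D) (Num.max (g x) 0)%:E <= (s * K + s^-1 * y + l)%:E)%E.
  apply: (@fatou_le (fun n x => s * X n x + s^-1 * Y n x + v n x) _ b).
  - move=> n; apply: measurable_funD => //.
    by apply: measurable_funD; apply: measurable_funM => //; exact: measR.
  - by apply: measurable_maxr => //; exact: measurable_cst.
  - by move=> n x Dx; have := vXY n s0 Dx; rewrite ler_norml => /andP[]; lra.
  - by move=> x Dx; rewrite le_max lexx orbT.
  - move=> x Dx r r0.
    have gn : s^-1 * Y n x + v n x @[n --> \oo] --> g x.
      by apply: cvgD; [apply: cvgM; [exact: cvg_cst|exact: YY']|exact: vv'].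
    move/cvgrPdist_le : gn => /(_ _ r0); apply: filterS => n; rewrite ler_norml => /andP[_ h].
    have h1 : 0 <= s * X n x by rewrite mulr_ge0 ?X0// ltW.
    have h2 : 0 <= s * X n x + s^-1 * Y n x + v n x.
      by have := vXY n s0 Dx; rewrite ler_norml => /andP[]; lra.
    by rewrite maxEle; case: ifP => _; lra.
  - move=> n.
    have i1 := integrable_EFinZl mD s (iX n); have i2 := integrable_EFinZl mD s^-1 (iY n).
    have e1 := @RintegralD _ _ _ mu D _ _ mD (iD i1 i2) (iv n).
    have e2 := @RintegralD _ _ _ mu D _ _ mD i1 i2.
    rewrite -[leLHS]fineK; last by apply: integrable_fin_num => //; exact: (iD (iD i1 i2) (iv n)).
    rewrite lee_fin [leLHS]e1 [X in X + _]e2 /b lerD2r.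
    rewrite (@RintegralZl _ _ _ mu D _ s mD (iX n)).
    rewrite (@RintegralZl _ _ _ mu D _ s^-1 mD (iY n)).
    by rewrite Yy lerD2r ler_wpM2l// ltW.
  - by apply: cvgD => //; exact: cvg_cst.
have le1 : \int[mu]_(x in D) g x <= \int[mu]_(x in D) Num.max (g x) 0.
  by apply: le_Rintegral => // x _; rewrite le_max lexx.
have le2 : \int[mu]_(x in D) Num.max (g x) 0 <= s * K + s^-1 * y + l.
  by rewrite -lee_fin /Rintegral fineK//; exact: integrable_fin_num.
have := le_trans le1 le2; rewrite /g.
rewrite (@RintegralD _ _ _ mu D _ _ mD (integrable_EFinZl mD s^-1 iY') fatou_integrable).
by rewrite RintegralZl// Yy'; lra.
Qed.

Lemma fatou_limit_le (l : R) : \int[mu]_(x in D) v n x @[n --> \oo] --> l ->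
  \int[mu]_(x in D) v' x <= l.
Proof. exact: upper. Qed.

End fatou_convergence.

Section fatou_eq.
Context {d : measure_display} {T : measurableType d} {R : realType}.
Variables (mu : {measure set T -> \bar R}) (D : set T).
Hypothesis mD : measurable D.

(* A generalized dominated convergence: the dominating functions [l X_n + Y_n / l] do not
   converge in L^1, but the non convergent part carries the arbitrarily small weight [l]. *)
Lemma fatou_limit (v X Y : nat -> T -> R) (v' Y' : T -> R) (K y l : R) :
  (forall n, measurable_fun D (v n)) -> measurable_fun D v' ->
  (forall n, mu.-integrable D (fun x => (X n x)%:E)) ->
  (forall n, mu.-integrable D (fun x => (Y n x)%:E)) ->
  mu.-integrable D (fun x => (Y' x)%:E) ->
  (forall n x, D x -> 0 <= X n x) ->
  (forall (l : R) n x, 0 < l -> D x -> `|v n x| <= l * X n x + l^-1 * Y n x) ->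
  (forall n, \int[mu]_(x in D) X n x <= K) ->
  (forall n, \int[mu]_(x in D) Y n x = y) -> \int[mu]_(x in D) Y' x = y ->
  (forall x, D x -> v n x @[n --> \oo] --> v' x) ->
  (forall x, D x -> Y n x @[n --> \oo] --> Y' x) ->
  \int[mu]_(x in D) v n x @[n --> \oo] --> l ->
  \int[mu]_(x in D) v' x = l.
Proof.
move=> mv mv' iX iY iY' X0 vXY XK Yy Yy' vv' YY' vl.
have iv' := fatou_integrable mD mv mv' iX iY vXY XK Yy vv'.
apply/eqP; rewrite eq_le (@fatou_limit_le _ _ _ mu D mD v X Y v' Y' K y)//=.
have ivn n : mu.-integrable D (fun x => (v n x)%:E).
  have i1 : mu.-integrable D (fun x => (1 * X n x + 1 * Y n x)%:E).
    under eq_fun do rewrite EFinD.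
    by apply: integrableD => //; exact: integrable_EFinZl.
  apply: le_integrable i1 => //; first exact/measurable_EFinP.
  move=> x Dx; rewrite /= lee_fin; have := vXY _ n _ ltr01 Dx; rewrite invr1 => h.
  by rewrite (le_trans h)// ler_norm.
have RN (f : T -> R) : mu.-integrable D (fun x => (f x)%:E) ->
    \int[mu]_(x in D) - f x = - \int[mu]_(x in D) f x.
  move=> jf; rewrite -mulN1r -RintegralZl//.
  by apply: eq_Rintegral => x _; rewrite mulN1r.
have : \int[mu]_(x in D) - v' x <= - l.
  apply: (@fatou_limit_le _ _ _ mu D mD (fun n x => - v n x) X Y _ Y' K y) => //.
  - by move=> n; exact: measurableT_comp.
  - exact: measurableT_comp.
  - by move=> r n x r0 Dx; rewrite normrN; exact: vXY.
  - by move=> x Dx; apply: cvgN; exact: vv'.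
  - under eq_fun do rewrite RN//.
    exact: cvgN.
by rewrite RN// lerN2.
Qed.

End fatou_eq.

(** * Moments of rotated functions and the second difference of the extremal function *)

Section rotation_derivative.
Context {R : realType}.
Local Notation C := R[i].
Implicit Types f g : C -> C.

Lemma cderiv_expiZ (c x : R) :
  cderiv (fun t => expi (c * t)) x (Complex 0 c * expi (c * x)).
Proof.
have [h1 h2] := cderiv_expi (c * x).
have hc : is_derive x 1 (fun t : R => c * t) (c * 1) by apply: rderivZ; exact: rderiv_id.
have := rderiv_comp h1 hc; have := rderiv_comp h2 hc.
rewrite !ReM !ImM /= => k2 k1.
split; [apply: (is_derive_eq k1)|apply: (is_derive_eq k2)]; rewrite ?ReM ?ImM /=; ring.
Qed.

Lemma ccvg_expi_quotient (c : R) :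
  ccvg ((0 : R)^') (fun t => (t^-1)%:C * (expi (c * t) - 1)) (Complex 0 c).
Proof.
have := (cderivP _ _ _).1 (cderiv_expiZ c 0).
rewrite mulr0 expi0 mulr1.
by under eq_fun do rewrite add0r.
Qed.

(** Fatou's lemma and dominated convergence concern sequences, so derivatives at 0 are read along
    the angles [1 / (n + 1)]. *)
Lemma ccvg_harmonic_at0 (f : R -> C) l : ccvg ((0 : R)^') f l ->
  ccvg \oo (fun n => f n.+1%:R^-1) l.
Proof.
have u0 : (forall n, n.+1%:R^-1 != 0 :> R) /\ (n.+1%:R^-1 : R) @[n --> \oo] --> (0 : R).
  by split; [move=> n; rewrite invr_neq0// pnatr_eq0|exact: cvg_harmonic].
by case=> h1 h2; split; [exact: ((cvgr_dnbhsP _ _ _).1 h1 _ u0)|exact: ((cvgr_dnbhsP _ _ _).1 h2 _ u0)].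
Qed.

Lemma mom_rot (m : nat) t f : `|t| <= pi *+ 2 -> disc_intg f ->
  mom m (fun z => f (rot t z)) = expi t ^+ m * mom m f.
Proof.
move=> t2 jf; have jm := disc_intg_conjX m jf.
have [dm _] := disc_intgZ (expi t ^+ m) jm.
rewrite /mom -(disc_integralZ _ jm) -[RHS](disc_integral_rot t2 dm).
apply: eq_disc_integral => z _.
rewrite /rot rmorphM exprMn mulrCA; congr (_ * _).
by rewrite mulrA -exprMn mul_conjc normc_expi expr1n expr1n mul1r.
Qed.

(** Only [F] is rotated. Writing [z^j F(e^(it) z)] as [e^(-ijt)] times the rotation of [z^j F] gives
    the frequency [m - j], the source of the factor [m - j] in the angular derivative. *)
Lemma mom_MX_rot (j m : nat) t f : `|t| <= pi *+ 2 ->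
  disc_intg (fun z => z ^+ j * f z) ->
  mom m (fun z => z ^+ j * f (rot t z)) =
  expi ((m%:R - j%:R) * t) * mom m (fun z => z ^+ j * f z).
Proof.
move=> t2 jf; rewrite -expi_pow_mul mulrAC mulrC.
rewrite -(mom_rot m t2 jf) -momZ; last exact: (disc_intg_rot t2 jf).
apply: eq_disc_integral => z _; congr (_ * _).
rewrite /rot exprMn !mulrA; congr (_ * _).
rewrite -exprMn [X in _ = X ^+ j * _]mulrC mul_conjc normc_expi.
by rewrite expr1n expr1n mul1r.
Qed.

End rotation_derivative.

Section extremal_rotation.
Context {R : realType}.
Local Notation C := R[i].
Variable p : R.
Hypothesis p1 : 1 < p.
Let p0 : 0 < p. Proof. exact: lt_trans p1. Qed.
Variables (k : {poly C}) (F : C -> C).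
Hypothesis k0 : k != 0.
Hypothesis exF : extremal p k F.
Local Notation Phi := (phi_norm p k).
Let AF : inA p F := extremal_inA p1 exF.

Lemma variational_mom g : inA p g -> disc_integral (fun z => g z * Gp p (F z)) =
  (Phi^-1)%:C * \sum_(m < size k) conjc k`_m * mom m g.
Proof.
move=> Ag; have := variational_identity p1 k0 exF Ag.
rewrite phi_mom; last exact: (inA_disc_intg p1).
have pin : pi != 0 :> R by rewrite gt_eqF// pi_gt0.
rewrite mulrA -rmorphM mulfV//= rmorph1 mul1r => ->.
by rewrite mulrA -rmorphM mulVf ?rmorph1 ?mul1r// gt_eqF// (Phi_gt0 p1 k0 exF).
Qed.

Lemma variational_MX_rot (j : nat) t : `|t| <= pi *+ 2 ->
  disc_integral (fun z => z ^+ j * F (rot t z) * Gp p (F z)) =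
  (Phi^-1)%:C * \sum_(m < size k)
    conjc k`_m * (expi ((m%:R - j%:R) * t) * mom m (fun z => z ^+ j * F z)).
Proof.
move=> t2; rewrite variational_mom; last by apply: (inAMX p1); exact: (inA_rot p1).
congr (_ * _); apply: eq_bigr => m _; rewrite mom_MX_rot//.
by apply: (inA_disc_intg p1); exact: (inAMX p1).
Qed.

Let VF t : `|t| <= pi *+ 2 -> disc_integral (fun z => F (rot t z) * Gp p (F z)) =
  (Phi^-1)%:C * \sum_(m < size k) conjc k`_m * (expi (m%:R * t) * mom m F).
Proof.
move=> t2; transitivity (disc_integral (fun z => z ^+ 0 * F (rot t z) * Gp p (F z))).
  by apply: eq_disc_integral => z _; rewrite expr0 mul1r.
rewrite variational_MX_rot//; congr (_ * _); apply: eq_bigr => m _.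
rewrite subr0; congr (_ * (_ * _)).
by apply: eq_disc_integral => z _; rewrite expr0 mul1r.
Qed.

Let rot0 (z : C) : rot 0 z = z. Proof. by rewrite /rot expi0 mul1r. Qed.

Lemma second_difference_intg t : `|t| <= pi *+ 2 ->
  disc_intg (fun z => (F z - F (rot t z)) * (Gp p (F z) - Gp p (F (rot t z)))).
Proof.
move=> t2; have AFt := inA_rot p1 t2 AF.
have i1 := inA_mul_Gp p1 AF AF; have i2 := inA_mul_Gp p1 AF AFt.
have i3 := inA_mul_Gp p1 AFt AF; have i4 := inA_mul_Gp p1 AFt AFt.
have := disc_intgB (disc_intgB i1 i2) (disc_intgB i3 i4).
by congr disc_intg; apply/funext => z; ring.
Qed.

(** Expand into four pairings. Rotation invariance replaces [F_t] against [G(F_t)] by [F] against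
    [G(F)], and [F] against [G(F_t)] by [F_(-t)] against [G(F)]; the variational identity then
    evaluates all four. The factor [2 - e^(imt) - e^(-imt)] is kept as a product so that each factor
    can be divided by [t]. *)
Lemma second_difference t : `|t| <= pi *+ 2 ->
  disc_integral (fun z => (F z - F (rot t z)) * (Gp p (F z) - Gp p (F (rot t z)))) =
  (Phi^-1)%:C * \sum_(m < size k) conjc k`_m *
    ((expi (m%:R * t) - 1) * (expi (- m%:R * t) - 1) * mom m F).
Proof.
move=> t2; have AFt := inA_rot p1 t2 AF.
have tN : `|- t| <= pi *+ 2 by rewrite normrN.
have i1 := inA_mul_Gp p1 AF AF; have i2 := inA_mul_Gp p1 AF AFt.
have i3 := inA_mul_Gp p1 AFt AF; have i4 := inA_mul_Gp p1 AFt AFt.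
transitivity (disc_integral (fun z => F z * Gp p (F z)) -
    disc_integral (fun z => F z * Gp p (F (rot t z))) -
    (disc_integral (fun z => F (rot t z) * Gp p (F z)) -
     disc_integral (fun z => F (rot t z) * Gp p (F (rot t z))))).
  rewrite -!disc_integralB//; try exact: disc_intgB.
  by apply: eq_disc_integral => z _; ring.
have -> : disc_integral (fun z => F (rot t z) * Gp p (F (rot t z))) =
    disc_integral (fun z => F z * Gp p (F z)).
  exact: (disc_integral_rot t2 i1.1).
have -> : disc_integral (fun z => F z * Gp p (F (rot t z))) =
    disc_integral (fun z => F (rot (- t) z) * Gp p (F z)).
  have [d2 _] := i2; rewrite -(disc_integral_rot tN d2).
  apply: eq_disc_integral => z _.
  by have := rotK (- t) z; rewrite opprK => ->.
have -> : disc_integral (fun z => F z * Gp p (F z)) =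
    disc_integral (fun z => F (rot 0 z) * Gp p (F z)).
  by apply: eq_disc_integral => z _; rewrite rot0.
have z2 : `|0 : R| <= pi *+ 2 by rewrite normr0 ltW// pi2_gt0.
rewrite !VF// -!mulrBr -!sumrB; congr (_ * _); apply: eq_bigr => m _.
rewrite mulr0 expi0 mul1r mulrN mulNr.
have e : expi (m%:R * t) * expi (- (m%:R * t)) = 1 :> C by rewrite -expiD addrN expi0.
rewrite -!mulrBr; congr (_ * _).
have -> : (expi (m%:R * t) - 1) * (expi (- (m%:R * t)) - 1) =
   (expi (m%:R * t) * expi (- (m%:R * t))) - expi (m%:R * t) - expi (- (m%:R * t)) + 1 :> C by ring.
rewrite e; ring.
Qed.

End extremal_rotation.

(** * Integrability and integral of the angular derivative *)

Section angular_derivative.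
Context {R : realType}.
Local Notation C := R[i].
Local Notation normc := (@Normc.normc R).
Local Notation mu := (@lebesgue_measure R).
Local Notation mu2 := (mu \x mu)%E.
Local Notation D := (@Disc R).
Variable p : R.
Hypothesis p1 : 1 < p.
Let p0 : 0 < p. Proof. exact: lt_trans p1. Qed.
Variables (k : {poly C}) (F : C -> C).
Hypothesis k0 : k != 0.
Hypothesis exF : extremal p k F.
Local Notation Phi := (phi_norm p k).
Let AF : inA p F := extremal_inA p1 exF.
Variable a : nat -> C.
Hypothesis aF : forall z : C, normc z < 1 ->
  ccvg \oo (fun N : nat => \sum_(n < N) a n * z ^+ n) (F z).

Let t (n : nat) : R := n.+1%:R^-1.

Let t0 n : 0 < t n. Proof. by rewrite invr_gt0. Qed.

Let t2 n : `|t n| <= pi *+ 2.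
Proof.
rewrite gtr0_norm// (@le_trans _ _ 1)//; first by rewrite invf_le1// ler1n.
by have := pi_ge2 R; rewrite mulr2n; lra.
Qed.

Let cp : R := 2 + (p - 1)^-1.
Let cp0 : 0 < cp. Proof. by rewrite addr_gt0// invr_gt0 subr_gt0. Qed.

Let Ft n z := F (rot (t n) z).
Let AFt n : inA p (Ft n). Proof. exact: (inA_rot p1). Qed.

(** Dividing [Gp_mono_amgm], taken with weight [l / t], by [2 t] bounds [|F_t - F| |F|^(p-1) / t] by
    [l X + Y / l]. The integral of [Y] does not depend on [t], by rotation invariance; that of [X]
    is the second difference over [t^2]. *)
Let Q n z := (F z - Ft n z) * (Gp p (F z) - Gp p (Ft n z)).
Let X n z := 2^-1 * (t n ^- 2 * (cp * complex.Re (Q n z))).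
Let Y n z := 2^-1 * (Np p (F z) + Np p (Ft n z)).

Let iQ n : disc_intg (Q n). Proof. exact: (second_difference_intg p1 exF). Qed.

Let iX n : mu2.-integrable D (fun z => (X n (cplx z))%:E).
Proof.
have [_ [iR _]] := iQ n.
have i1 := @integrable_EFinZl _ _ _ mu2 D measurable_Disc cp _ iR.
have i2 := @integrable_EFinZl _ _ _ mu2 D measurable_Disc (t n ^- 2) _ i1.
exact: (@integrable_EFinZl _ _ _ mu2 D measurable_Disc 2^-1 _ i2).
Qed.

Let iY n : mu2.-integrable D (fun z => (Y n (cplx z))%:E).
Proof.
apply: (@disc_integrableZ R _ (fun z => Np p (F z) + Np p (Ft n z))).
exact: (@disc_integrableD R (fun z => Np p (F z)) (fun z => Np p (Ft n z)) AF.2 (AFt n).2).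
Qed.

Let X0 n z : 0 <= X n z.
Proof.
by rewrite !mulr_ge0 ?invr_ge0 ?exprn_ge0 ?(ltW (t0 n)) ?(ltW cp0)//; exact: (Gp_mono p1).
Qed.

Let Yy n : \int[mu2]_(z in D) Y n (cplx z) = pi.
Proof.
have i2 := @disc_integrableD R (fun z => Np p (F z)) (fun z => Np p (Ft n z)) AF.2 (AFt n).2.
rewrite (@RintegralZl _ _ _ mu2 D _ 2^-1 measurable_Disc i2).
rewrite (@RintegralD _ _ _ mu2 D _ _ measurable_Disc AF.2 (AFt n).2).
have e : \int[mu2]_(z in D) Np p (Ft n (cplx z)) = \int[mu2]_(z in D) Np p (F (cplx z)).
  congr fine; exact: (rot_Disc (t2 n) (cdreg_Np p1 (analytic_cdreg AF.1))).
rewrite e -/(apI p F) (extremal_apI p1 exF).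
by move: (pi : R) => q; field.
Qed.

(** After division by [t^2] the formula of [second_difference] is a finite sum of convergent
    sequences, hence bounded. *)
Let XK : exists K, forall n, \int[mu2]_(z in D) X n (cplx z) <= K.
Proof.
have h m : ccvg \oo (fun n => ((t n)^-1)%:C * (expi (m * t n) - 1)) (Complex 0 m).
  exact: ccvg_harmonic_at0 (ccvg_expi_quotient m).
have c : ccvg \oo (fun n => ((t n)^-1)%:C * ((t n)^-1)%:C * disc_integral (Q n))
  ((Phi^-1)%:C * \sum_(m < size k) conjc k`_m *
    (Complex 0 m%:R * Complex 0 (- m%:R) * mom m F)).
  have e n : ((t n)^-1)%:C * ((t n)^-1)%:C * disc_integral (Q n) =
    (Phi^-1)%:C * \sum_(m < size k) conjc k`_m *
    ((((t n)^-1)%:C * (expi (m%:R * t n) - 1)) *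
     (((t n)^-1)%:C * (expi (- m%:R * t n) - 1)) * mom m F).
    rewrite [disc_integral _](second_difference p1 k0 exF (t2 n)) [LHS]mulrCA.
    congr (_ * _); rewrite mulr_sumr; apply: eq_bigr => m _; ring.
  rewrite (funext e); apply: ccvgM; first exact: ccvg_cst.
  apply: ccvg_sum => m; apply: ccvgM; first exact: ccvg_cst.
  by apply: ccvgM; [apply: ccvgM; exact: h|exact: ccvg_cst].
case: c => c _; have := @cvg_seq_bounded _ _ _ (cvgP _ c).
case=> M [_ /(_ (M + 1))]; rewrite ltrDl ltr01 => /(_ isT) hM.
exists (2^-1 * (cp * (M + 1))) => n.
have [_ [iR _]] := iQ n.
have i1 := @integrable_EFinZl _ _ _ mu2 D measurable_Disc cp _ iR.
have i2 := @integrable_EFinZl _ _ _ mu2 D measurable_Disc (t n ^- 2) _ i1.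
rewrite (@RintegralZl _ _ _ mu2 D _ 2^-1 measurable_Disc i2).
rewrite (@RintegralZl _ _ _ mu2 D _ (t n ^- 2) measurable_Disc i1).
rewrite (@RintegralZl _ _ _ mu2 D _ cp measurable_Disc iR).
rewrite ler_pM2l ?invr_gt0// mulrCA ler_pM2l//.
have hQ : `|complex.Re (((t n)^-1)%:C * ((t n)^-1)%:C * disc_integral (Q n))| <= M + 1 := hM n I.
move: hQ; rewrite -rmorphM ReMl => hQ.
apply: le_trans hQ; apply: le_trans (ler_norm _).
by rewrite -invfM -expr2.
Qed.

Section monomial.
Variable j : nat.

Let W z := z ^+ j * (z * pderiv a z) * Gp p (F z).
Let V n z := z ^+ j * (((t n)^-1)%:C * (Ft n z - F z)) * Gp p (F z).

Let iV n : disc_intg (V n).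
Proof.
have A1 : inA p (fun z => z ^+ j * (((t n)^-1)%:C * (Ft n z + -1 * F z))).
  exact: (inAMX p1 j (inAZ ((t n)^-1)%:C (inAD p1 (AFt n) (inAZ (-1) AF)))).
have := inA_mul_Gp p1 A1 AF; congr disc_intg; apply/funext => z.
by rewrite /V mulN1r.
Qed.

Let cW : cdreg W.
Proof.
apply: cdregM; last exact: (cdreg_Gp p1 (analytic_cdreg AF.1)).
apply: cdregM; first by apply: cdregX; exact: cdreg_id.
by apply: cdregM; [exact: cdreg_id|exact: (pderiv_cdreg aF)].
Qed.

Let VW z : normc z < 1 -> ccvg \oo (fun n => V n z) (Complex 0 1 * W z).
Proof.
move=> z1.
have -> : Complex 0 1 * W z = z ^+ j * (Complex 0 1 * (z * pderiv a z)) * Gp p (F z).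
  by rewrite /W; ring.
apply: ccvgM; last exact: ccvg_cst.
apply: ccvgM; first exact: ccvg_cst.
exact: (ccvg_harmonic_at0 (rot_diff_quotient aF z1)).
Qed.

(** The integrals of the difference quotients are known from moments, so their limit is found
    without exchanging it with the integral. The exchange is then the conclusion of [fatou_limit],
    not a prerequisite. *)
Let Vlim : ccvg \oo (fun n => disc_integral (V n)) (Complex 0 1 *
  ((Phi^-1)%:C * \sum_(m < size k) conjc k`_m * ((m%:R - j%:R)%:C * mom m (fun z => z ^+ j * F z)))).
Proof.
have AjF := inAMX p1 j AF.
have z2 : `|0 : R| <= pi *+ 2 by rewrite normr0 ltW// pi2_gt0.
have e n : disc_integral (V n) = (Phi^-1)%:C * \sum_(m < size k) conjc k`_m *
    ((((t n)^-1)%:C * (expi ((m%:R - j%:R) * t n) - 1)) * mom m (fun z => z ^+ j * F z)).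
  have A1 := inAMX p1 j (AFt n).
  have i1 := inA_mul_Gp p1 A1 AF; have i2 := inA_mul_Gp p1 AjF AF.
  transitivity (((t n)^-1)%:C * (disc_integral (fun z => z ^+ j * Ft n z * Gp p (F z)) -
      disc_integral (fun z => z ^+ j * F (rot 0 z) * Gp p (F z)))).
    have -> : disc_integral (fun z => z ^+ j * F (rot 0 z) * Gp p (F z)) =
        disc_integral (fun z => z ^+ j * F z * Gp p (F z)).
      by apply: eq_disc_integral => z _; rewrite /rot expi0 mul1r.
    rewrite -disc_integralB// -disc_integralZ; last exact: disc_intgB.
    by apply: eq_disc_integral => z _; rewrite /V; ring.
  rewrite !(variational_MX_rot p1 k0 exF)// -mulrBr -sumrB [LHS]mulrCA; congr (_ * _).
  rewrite mulr_sumr; apply: eq_bigr => m _; rewrite mulr0 expi0; ring.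
rewrite (funext e) mulrCA; apply: ccvgM; first exact: ccvg_cst.
rewrite mulr_sumr; apply: ccvg_sum => m; rewrite mulrCA; apply: ccvgM; first exact: ccvg_cst.
rewrite mulrA; apply: ccvgM; last exact: ccvg_cst.
have -> : Complex 0 1 * (m%:R - j%:R)%:C = Complex 0 (m%:R - j%:R) :> C.
  by apply: complexP; rewrite ?ReM ?ImM /=; ring.
exact: ccvg_harmonic_at0 (ccvg_expi_quotient _).
Qed.

Let normV n z (l : R) : 0 < l -> normc z < 1 ->
  normc (V n z) <= l * X n z + l^-1 * Y n z.
Proof.
move=> l0 z1; have lt0 : 0 < l / t n by rewrite divr_gt0.
have := Gp_mono_amgm p1 (F z) (Ft n z) lt0; rewrite -/(Q n z) -/cp => h.
rewrite /V Normc.normcM normc_Gp// Normc.normcM normcX Normc.normcM normc_real gtr0_norm ?invr_gt0//.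
have zj : normc z ^+ j <= 1 by rewrite exprn_ile1 ?normc_ge0// ltW.
apply: (@le_trans _ _ ((t n)^-1 * (normc (F z - Ft n z) * normc (F z) `^ (p - 1)))).
  rewrite normcB_sym -[leLHS]mulrA [leLHS]mulrA -[leLHS]mulrA -[leRHS]mul1r.
  rewrite !mulrA -!mulrA ler_wpM2r//.
  by rewrite !mulr_ge0 ?invr_ge0 ?normc_ge0 ?powR_ge0// ltW.
have t20 : 0 <= 2^-1 * (t n)^-1 by rewrite mulr_ge0 ?invr_ge0// ltW.
have := ler_wpM2l t20 h.
have tn := t0 n.
have -> : 2^-1 * (t n)^-1 * (2 * (normc (F z - Ft n z) * normc (F z) `^ (p - 1))) =
  (t n)^-1 * (normc (F z - Ft n z) * normc (F z) `^ (p - 1)).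
  by field; rewrite gt_eqF.
move=> /le_trans; apply; rewrite /X /Y le_eqVlt; apply/orP; left; apply/eqP.
by field; rewrite !gt_eqF.
Qed.

Let YY' z : normc z < 1 -> Y n z @[n --> \oo] --> Np p (F z).
Proof.
move=> z1; rewrite (_ : Np p (F z) = 2^-1 * (Np p (F z) + Np p (F z))); last by field.
apply: cvgM; first exact: cvg_cst.
apply: cvgD; first exact: cvg_cst.
apply: (cvg_Np p1).
rewrite -[X in ccvg _ _ (F X)]mul1r.
apply: (locally_lipschitz_ccvg (pseries_lipschitz aF)); last by rewrite mul1r.
apply: ccvgM; last exact: ccvg_cst.
rewrite -[X in ccvg _ _ X]expi0.
have tn : t n @[n --> \oo] --> (0 : R) by exact: cvg_harmonic.
have [e1 e2] := ccvg_expi (0 : R).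
split.
  exact: (@cvg_comp _ _ _ t (fun s => complex.Re (expi s)) _ _ _ tn e1).
exact: (@cvg_comp _ _ _ t (fun s => complex.Im (expi s)) _ _ _ tn e2).
Qed.

Let ReIm_fatou (u : C -> R) : (u = complex.Re (R := R) \/ u = complex.Im (R := R)) ->
  mu2.-integrable D (fun z => (u (Complex 0 1 * W (cplx z)))%:E) /\
  \int[mu2]_(z in D) u (Complex 0 1 * W (cplx z)) = u (Complex 0 1 *
  ((Phi^-1)%:C * \sum_(m < size k) conjc k`_m * ((m%:R - j%:R)%:C * mom m (fun z => z ^+ j * F z)))).
Proof.
move=> uE; have [K hK] := XK.
have u_le w : `|u w| <= normc w.
  by case: uE => ->; [exact: normc_Re|exact: normc_Im].
have mV n : measurable_fun D (fun z => u (V n (cplx z))).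
  by have [[[m1 m2] _] _] := iV n; case: uE => ->.
have mW : measurable_fun D (fun z => u (Complex 0 1 * W (cplx z))).
  by have [[m1 m2] _] := cdregM (cdreg_cst (Complex 0 1)) cW; case: uE => ->.
have lV z : D z -> u (V n (cplx z)) @[n --> \oo] --> u (Complex 0 1 * W (cplx z)).
  by move=> /DiscE/VW [v1 v2]; case: uE => ->.
have nV (l : R) n z : 0 < l -> D z -> `|u (V n (cplx z))| <= l * X n (cplx z) + l^-1 * Y n (cplx z).
  by move=> l0 /DiscE z1; exact: le_trans (u_le _) (normV n l0 z1).
have lI : \int[mu2]_(z in D) u (V n (cplx z)) @[n --> \oo] --> u (Complex 0 1 *
  ((Phi^-1)%:C * \sum_(m < size k) conjc k`_m * ((m%:R - j%:R)%:C * mom m (fun z => z ^+ j * F z)))).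
  by have [v1 v2] := Vlim; case: uE => ->.
split.
  exact: (@fatou_integrable _ _ _ mu2 D measurable_Disc (fun n z => u (V n (cplx z)))
    (fun n z => X n (cplx z)) (fun n z => Y n (cplx z)) _ K pi).
apply: (@fatou_limit _ _ _ mu2 D measurable_Disc (fun n z => u (V n (cplx z)))
    (fun n z => X n (cplx z)) (fun n z => Y n (cplx z)) _ (fun z => Np p (F (cplx z))) K pi) => //.
- exact: AF.2.
- exact: (extremal_apI p1 exF).
- by move=> z /DiscE; exact: YY'.
Qed.

Let iW : disc_intg (fun z => Complex 0 1 * W z).
Proof.
split; first by apply: cdregM; [exact: cdreg_cst|exact: cW].
by split; [have [] := ReIm_fatou (or_introl erefl)|have [] := ReIm_fatou (or_intror erefl)].
Qed.

Let iN z : Complex 0 (-1) * (Complex 0 1 * z) = z :> C.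
Proof. by apply: complexP; rewrite !(ReM, ImM) /=; ring. Qed.

Lemma angular_intg : disc_intg W.
Proof.
have := disc_intgZ (Complex 0 (-1)) iW; congr disc_intg.
by apply/funext => z; rewrite iN.
Qed.

Lemma angular_identity : disc_integral W =
  (Phi^-1)%:C * \sum_(m < size k)
    conjc k`_m * ((m%:R - j%:R)%:C * mom m (fun z => z ^+ j * F z)).
Proof.
rewrite -[RHS]iN -[LHS]iN -(disc_integralZ _ angular_intg); congr (_ * _).
have [_ e1] := ReIm_fatou (or_introl erefl); have [_ e2] := ReIm_fatou (or_intror erefl).
by apply: complexP; [rewrite -e1|rewrite -e2].
Qed.

End monomial.
End angular_derivative.

(** * Integrals off a null set, and one-sided limits of primitives *)

Section null_sets.
Context {d : measure_display} {T : measurableType d} {R : realType}.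
Variables (mu : {measure set T -> \bar R}) (N : set T).
Hypotheses (mN : measurable N) (N0 : mu N = 0%E).
Local Open Scope ereal_scope.
Import HBNNSimple.

(** A simple function below [f] can be multiplied by the indicator of the complement of [N]: its
    integral is unchanged, and it is now below [g] everywhere. *)
Lemma ereal_sup_sintegral_le (f g : T -> \bar R) :
  (forall x, ~ N x -> f x <= g x) -> (forall x, 0 <= g x) ->
  ereal_sup [set sintegral mu h | h in [set h : {nnsfun T >-> R} | forall x, (h x)%:E <= f x]] <=
  ereal_sup [set sintegral mu h | h in [set h : {nnsfun T >-> R} | forall x, (h x)%:E <= g x]].
Proof.
move=> fg g0; apply: ge_ereal_sup => _ [h /= hf <-].
pose h' := proj_nnsfun h (measurableC mN).
have -> : sintegral mu h = sintegral mu h'.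
  rewrite -!integralT_nnsfun; apply: ae_eq_integral => //.
  - by apply/measurable_EFinP.
  - by apply/measurable_EFinP.
  - exists N; split => // x /= /not_implyP[_ hh]; apply: contrapT => nx; apply: hh.
    have xN : x \in ~` N by apply/mem_set.
    by rewrite mindicE /= xN mulr1.
apply: ereal_sup_ubound; exists h' => // x /=; rewrite mindicE /=.
have [xN|xN] := boolP (x \in ~` N); last by rewrite mulr0.
by rewrite mulr1; apply: (le_trans (hf x)); apply: fg; rewrite inE in xN.
Qed.

(* No measurability of [f] and [g] is required: a boundary function of the statement is only
   determined almost everywhere, and Lebesgue measure lives on the Borel sets here. *)
Lemma integral_off_null (D : set T) (f g : T -> \bar R) :
  (forall x, D x -> ~ N x -> f x = g x) ->
  \int[mu]_(x in D) f x = \int[mu]_(x in D) g x.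
Proof.
move=> fg; have e x : ~ N x -> (f \_ D) x = (g \_ D) x.
  by rewrite /patch; case: ifP => // /set_mem Dx; exact: fg.
have ep x : ~ N x -> ((f \_ D)^\+ x = (g \_ D)^\+ x) * ((f \_ D)^\- x = (g \_ D)^\- x).
  by move=> /e h; rewrite !funeposE !funenegE h.
rewrite /integral; congr (_ - _); apply/eqP; rewrite eq_le; apply/andP; split;
  apply: ereal_sup_sintegral_le => // x nx; by rewrite (ep x nx).
Qed.

Lemma cintegral_off_null (D : set T) (f g : T -> R[i]) :
  (forall x, D x -> ~ N x -> f x = g x) -> cintegral mu D f = cintegral mu D g.
Proof.
move=> fg; rewrite /cintegral; congr (_ +i* _); congr fine;
  by apply: integral_off_null => x Dx Nx; rewrite fg.
Qed.

End null_sets.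

Section left_limits.
Context {R : realType}.
Local Notation mu := (@lebesgue_measure R).

(** The integral of [f'] up to [s] is continuous at the endpoint because [f'] is integrable up to
    [b], even though nothing is assumed about [f] at [b] itself. *)
Lemma left_limit_integral (f f' : R -> R) (a b : R) : a < b ->
  (forall x : R, a <= x < b -> is_derive x 1 f (f' x)) ->
  (forall x : R, a <= x < b -> {for x, continuous f'}) ->
  mu.-integrable `[a, b[%classic (fun x => (f' x)%:E) ->
  f s @[s --> b^'-] --> f a + \int[mu]_(x in `[a, b[%classic) f' x.
Proof.
move=> ab df cf' jf.
(* [f'] is uncontrolled at [b]; [g] has the value 0 there and is integrable on the closed
   interval. *)
pose g := f' \_ `[a, b[%classic.
have jg : mu.-integrable `[a, b]%classic (EFin \o g).
  have : mu.-integrable setT (EFin \o g).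
    have := (@integrable_mkcond _ _ _ mu _ _ (measurable_itv _)).1 jf.
    by rewrite restrict_EFin.
  exact: integrableS.
have c := parameterized_integral_cvg_at_left ab jg.
have eb : (\int[mu]_(x in `[a, b[%classic) f' x)%R = (\int[mu]_(x in `[a, b]%classic) g x)%R.
  have {1}-> : `[a, b[%classic = `[a, b]%classic `&` `[a, b[%classic.
    by apply/esym/setIidr; exact: subset_itv_co_cc.
  rewrite /Rintegral integral_mkcondr; congr fine; apply: eq_integral => x _.
  by rewrite /g !patchE; case: ifP.
have c2 : f a + (\int[mu]_(x in `[a, s]%classic) g x)%R @[s --> b^'-] -->
    f a + (\int[mu]_(x in `[a, b]%classic) g x)%R.
  by apply: cvgD; [exact: cvg_cst|exact: c].
rewrite eb; apply: cvg_trans c2.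
apply: near_eq_cvg; near=> s.
have as_ : a < s by near: s; exact: nbhs_left_gt.
have sb : s < b by near: s; exact: nbhs_left_lt.
have [||_ e] := @FTC_closed R f' f a s as_.
- by move=> x /andP[ax xs]; apply: df; rewrite ax (le_lt_trans xs sb).
- by move=> x /andP[ax xs]; apply: cf'; rewrite ax (le_lt_trans xs sb).
have -> : (\int[mu]_(x in `[a, s]%classic) g x)%R = f s - f a.
  transitivity (\int[mu]_(x in `[a, s]%classic) f' x)%R; last by rewrite /Rintegral e.
  apply: eq_Rintegral => x; rewrite inE /= in_itv/= => /andP[ax xs].
  by rewrite /g patchE mem_set//= in_itv/= ax (le_lt_trans xs sb).
by rewrite addrC subrK.
Unshelve. all: by end_near. Qed.

End left_limits.

Lemma integrable_cst_on {d : measure_display} {T : measurableType d} {R : realType}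
    (mu : {measure set T -> \bar R}) (D : set T) (c : R) : measurable D ->
  (mu D < +oo)%E -> mu.-integrable D (fun=> c%:E).
Proof.
move=> mD Dy; apply/integrableP; split; first exact: measurable_cst.
rewrite (integral_cst mu mD `|c%:E|%E) lte_mul_pinfty// ?lee_fin.
Qed.

(** * Behaviour of an analytic function along one radius *)

Section one_radius.
Context {R : realType}.
Local Notation C := R[i].
Local Notation normc := (@Normc.normc R).
Local Notation mu := (@lebesgue_measure R).
Local Notation I := (`[0 : R, 1[%classic).
Variables (p : R) (f d : R -> C).
Hypothesis p1 : 1 < p.
Let p0 : 0 < p. Proof. exact: lt_trans p1. Qed.
Hypothesis df : forall s : R, 0 <= s < 1 -> cderiv f s (d s).
Hypothesis cd : forall s : R, 0 <= s < 1 -> ccvg (nbhs s) d (d s).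
Let b s := normc (d s) * normc (f s) `^ (p - 1).
Hypothesis ib : mu.-integrable I (fun s => (b s)%:E).

Let b0 s : 0 <= b s. Proof. by rewrite mulr_ge0 ?normc_ge0 ?powR_ge0. Qed.

Let mI : measurable I. Proof. exact: measurable_itv. Qed.

Let rcont (g dg : R -> R) (s : R) : is_derive s 1 g (dg s) -> {for s, continuous g}.
Proof. by move=> h; apply: differentiable_continuous; apply/derivable1_diffP; case: h. Qed.

Let cf (s : R) : 0 <= s < 1 -> ccvg (nbhs s) f (f s).
Proof.
move=> /df [h1 h2].
by split; apply: differentiable_continuous; apply/derivable1_diffP; [case: h1|case: h2].
Qed.

Let mcont (g : R -> R) : (forall s : R, 0 <= s < 1 -> {for s, continuous g}) -> measurable_fun I g.
Proof.
move=> cg; apply: subspace_continuous_measurable_fun => //.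
by apply: continuous_in_subspaceT => s; rewrite inE /= in_itv/=; exact: cg.
Qed.

Let u s := Np p (f s).
Let u' s := p * complex.Re (d s * Gp p (f s)).

Let du (s : R) : 0 <= s < 1 -> is_derive s 1 u (u' s).
Proof. by move=> /df; exact: cderiv_Np. Qed.

Let cu' (s : R) : 0 <= s < 1 -> {for s, continuous u'}.
Proof.
move=> s01; apply: cvgM; first exact: cvg_cst.
have h : ccvg (nbhs s) (fun s => d s * Gp p (f s)) (d s * Gp p (f s)).
  by apply: ccvgM; [exact: cd|apply: ccvg_Gp => //; exact: cf].
by case: h.
Qed.

Let u'_le s : `|u' s| <= p * b s.
Proof.
rewrite /u' normrM gtr0_norm// ler_wpM2l ?(ltW p0)//.
by rewrite (le_trans (normc_Re _))// Normc.normcM normc_Gp.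
Qed.

Let ipb : mu.-integrable I (fun s => (p * b s)%:E).
Proof. exact: (@integrable_EFinZl _ _ _ mu I mI p _ ib). Qed.

Let iu' : mu.-integrable I (fun s => (u' s)%:E).
Proof.
apply: le_integrable ipb => //.
  by apply/measurable_EFinP; apply: mcont; exact: cu'.
by move=> s _ /=; rewrite lee_fin (le_trans (u'_le s))// ler_norm.
Qed.

Lemma radial_Np_le r : 0 <= r < 1 ->
  Np p (f r) <= Np p (f 0) + p * \int[mu]_(s in I) b s.
Proof.
have B0 : 0 <= p * \int[mu]_(s in I) b s.
  by rewrite mulr_ge0 ?(ltW p0)// Rintegral_ge0.
move=> /andP[]; rewrite le_eqVlt => /predU1P[<- _|r0 r1]; first by rewrite lerDl.
have sub x : 0 <= x <= r -> 0 <= x < 1.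
  by move=> /andP[x0 xr]; rewrite x0 (le_lt_trans xr r1).
have [i1 e1] := @FTC_closed _ u' u 0 r r0 (fun x h => du (sub x h)) (fun x h => cu' (sub x h)).
have subI : `[0, r]%classic `<=` I.
  by move=> x /=; rewrite !in_itv/=; exact: sub.
have ipr : mu.-integrable `[0, r]%classic (fun s => (p * b s)%:E).
  exact: integrableS ipb.
rewrite -lerBlDl -[leLHS]/(fine ((Np p (f r) - Np p (f 0))%:E)) -e1.
rewrite (le_trans (ler_norm _))//.
rewrite (le_trans (@Rintegral_le_bound _ _ _ mu _ (measurable_itv _) u' (fun s => p * b s) _ ipr _))//.
- by have /measurable_int/measurable_EFinP := i1.
rewrite -(@RintegralZl _ _ _ mu I _ p mI ib).
rewrite /Rintegral fine_le//.
- exact: integrable_fin_num.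
- exact: integrable_fin_num.
apply: ge0_subset_integral => //; first by have /measurable_int := ipb.
by move=> x _; rewrite lee_fin mulr_ge0// ltW.
Qed.

(** The exponent is [j] from [z^j], one from the area factor and one from the [z] of [z F']. The
    derivative [w'] is thus the radial integrand of the area integral in [green_boundary], and [w]
    vanishes at 0. *)
Let w (j : nat) s := s ^+ j.+2 * u s.
Let w' (j : nat) s := j.+2%:R * s ^+ j.+1 * u s + s ^+ j.+2 * u' s.

Let dw j (s : R) : 0 <= s < 1 -> is_derive s 1 (w j) (w' j s).
Proof. by move=> s01; exact: (rderivM (rderivX _ _) (du s01)). Qed.

Let cw' j (s : R) : 0 <= s < 1 -> {for s, continuous (w' j)}.
Proof.
move=> s01; have cX n : {for s, continuous (fun s : R => s ^+ n)} by exact: exprn_continuous.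
apply: cvgD; apply: cvgM.
- by apply: cvgM; [exact: cvg_cst|exact: cX].
- by apply: rcont; exact: du.
- exact: cX.
- exact: cu'.
Qed.

Lemma radial_weighted_integrable (j : nat) : mu.-integrable I (fun s =>
  (j.+2%:R * s ^+ j.+1 * Np p (f s) + s ^+ j.+2 * (p * complex.Re (d s * Gp p (f s))))%:E).
Proof.
have mu1 : (mu I < +oo)%E by rewrite lebesgue_measure_itv/= lte01 oppr0 adde0 ltry.
have ic : mu.-integrable I (fun=> (j.+2%:R * (Np p (f 0) + p * \int[mu]_(s in I) b s))%:E).
  exact: integrable_cst_on.
have i2 : mu.-integrable I (fun s =>
    (j.+2%:R * (Np p (f 0) + p * \int[mu]_(s in I) b s) + p * b s)%:E).
  exact: (@integrableD _ _ _ mu I mI _ _ ic ipb).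
apply: le_integrable i2 => //.
  by apply/measurable_EFinP; apply: mcont => s; exact: cw'.
move=> s /=; rewrite in_itv/= => s01; rewrite lee_fin.
apply: le_trans (ler_norm _); rewrite (le_trans (ler_normD _ _))//.
have /andP[s0 s1] := s01; have sX n : 0 <= s ^+ n <= 1.
  by rewrite exprn_ge0//= exprn_ile1// ltW.
have /andP[sj0 sj1] := sX j.+1; have /andP[sk0 sk1] := sX j.+2.
apply: lerD.
  rewrite ger0_norm ?mulr_ge0 ?Np_ge0// -mulrA ler_wpM2l//.
  by rewrite (le_trans _ (radial_Np_le s01))// ler_piMl ?Np_ge0.
rewrite normrM ger0_norm// (le_trans _ (u'_le s))// ler_piMl//.
Qed.

Lemma radial_weighted_integral (j : nat) (l : R) :
  Np p (f s) @[s --> (1 : R)^'-] --> l ->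
  \int[mu]_(s in I) (j.+2%:R * s ^+ j.+1 * Np p (f s) +
    s ^+ j.+2 * (p * complex.Re (d s * Gp p (f s)))) = l.
Proof.
move=> ul; have c := left_limit_integral ltr01 (@dw j) (@cw' j) (radial_weighted_integrable j).
have c2 : w j s @[s --> (1 : R)^'-] --> 1 ^+ j.+2 * l.
  apply: cvgM => //; apply: cvg_at_left_filter; exact: exprn_continuous.
have := cvg_unique (@Rhausdorff R) c c2.
have -> : w j 0 = 0 by rewrite /w expr0n mul0r.
by rewrite add0r expr1n mul1r => <-.
Qed.

Lemma radial_Np_cvg : exists l : R, Np p (f s) @[s --> (1 : R)^'-] --> l.
Proof. by eexists; exact: left_limit_integral ltr01 du cu' iu'. Qed.

(** [|f|^p] has a limit [L], its derivative being integrable. If [L = 0] then [f] tends to 0.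
    Otherwise [|f|] is bounded below near 1, where integrability of [|f'| |f|^(p-1)] becomes that of
    [f'], so [f] itself converges. *)
Lemma radial_ccvg : exists l : C, ccvg ((1 : R)^'-) f l.
Proof.
have [L uL] := radial_Np_cvg.
have L0 : 0 <= L.
  rewrite -(cvg_lim (@Rhausdorff R) uL); apply: limr_ge.
    by apply/cvg_ex; eexists; exact: uL.
  by apply: nearW => s; exact: Np_ge0.
move: L0; rewrite le_eqVlt => /predU1P[L0|L0].
  exists 0; apply/ccvgP.
  have h : (u s) `^ p^-1 @[s --> (1 : R)^'-] --> (L `^ p^-1 : R).
    apply: cvg_powR uL; [by rewrite invr_gt0|by move=> s; exact: Np_ge0|by rewrite -L0].
  move: h; rewrite -L0 powR0 ?gt_eqF ?invr_gt0//; apply: cvg_trans; apply: near_eq_cvg.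
  apply: nearW => s; rewrite subr0 /u /Np -powRrM mulfV ?gt_eqF// powRr1//.
  exact: normc_ge0.
pose c := ((L / 2) `^ p^-1) `^ (p - 1).
have L2 : 0 < L / 2 by rewrite divr_gt0.
have c0 : 0 < c by rewrite !powR_gt0.
have : \forall s \near (1 : R)^'-, L / 2 <= u s.
  have /cvgrPdist_le/(_ _ L2) := uL.
  by apply: filterS => s; rewrite ler_norml /u => /andP[_ h]; lra.
case=> e /= e0 he.
(* Half of [e] makes the closed endpoint [s0] satisfy the strict inequality of the neighbourhood. *)
pose s0 := Num.max 0 (1 - e / 2).
have s01 : s0 < 1 by rewrite gt_max ltr01/=; lra.
have s00 : 0 <= s0 by rewrite le_max lexx.
have sub x : s0 <= x < 1 -> 0 <= x < 1.
  by move=> /andP[h ->]; rewrite (le_trans s00 h).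
have hL x : s0 <= x < 1 -> L / 2 <= u x.
  move=> /andP[h1 h2]; apply: he => //=; rewrite gtr0_norm; last lra.
  by move: h1; rewrite ge_max => /andP[_]; lra.
have db x : s0 <= x < 1 -> normc (d x) <= c^-1 * b x.
  move=> /hL h; rewrite mulrC ler_pdivlMr// ler_wpM2l ?normc_ge0//.
  apply: ge0_ler_powR; rewrite ?subr_ge0 ?nnegrE ?powR_ge0 ?normc_ge0// ?(ltW p1)//.
  have : (L / 2) `^ p^-1 <= u x `^ p^-1.
    by apply: ge0_ler_powR; rewrite ?invr_ge0 ?nnegrE ?Np_ge0// ltW.
  by rewrite /u /Np -powRrM mulfV ?gt_eqF// powRr1// normc_ge0.
have iI : mu.-integrable `[s0, 1[%classic (fun s => (c^-1 * b s)%:E).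
  apply: (integrableS _ _ _ (@integrable_EFinZl _ _ _ mu I mI c^-1 _ ib)) => //.
have [i1 i2] : cintg mu `[s0, 1[%classic d.
  apply: cintg_bound iI _ => //.
    have m : cmeas I d by split; apply: mcont => s /cd [].
    have subI : `[s0, 1[%classic `<=` I by move=> x /=; rewrite !in_itv/=; exact: sub.
    by case: m => m1 m2; split; [exact: measurable_funS subI m1|exact: measurable_funS subI m2].
eexists (Complex _ _); split => /=.
  by apply: (left_limit_integral s01 _ _ i1) => x /sub h; [case: (df h)|case: (cd h)].
by apply: (left_limit_integral s01 _ _ i2) => x /sub h; [case: (df h)|case: (cd h)].
Qed.

End one_radius.

(** * Integrability on almost every radius *)

Section good_angles.
Context {R : realType}.
Local Notation C := R[i].
Local Notation normc := (@Normc.normc R).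
Local Notation mu := (@lebesgue_measure R).
Local Notation circ := (@circ_dom R).
Local Notation I := (`[0 : R, 1[%classic).
Local Notation J := (`]0 : R, 1[%classic).
Variables (p : R) (a : nat -> C) (F : C -> C).
Hypothesis p1 : 1 < p.
Let p0 : 0 < p. Proof. exact: lt_trans p1. Qed.
Hypothesis aF : forall z : C, normc z < 1 ->
  ccvg \oo (fun N : nat => \sum_(n < N) a n * z ^+ n) (F z).
Hypothesis iE : disc_intg (fun z => z * pderiv a z * Gp p (F z)).

Let g (z : C) : R := normc (z * pderiv a z * Gp p (F z)).
Let f (t s : R) : C := F (s%:C * expi t).
Let d (t s : R) : C := pderiv a (s%:C * expi t) * expi t.
Let b (t s : R) : R := normc (d t s) * normc (f t s) `^ (p - 1).

Let b0 t s : 0 <= b t s. Proof. by rewrite mulr_ge0 ?normc_ge0 ?powR_ge0. Qed.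

Let norm_lt1 (s : R) : 0 <= s < 1 -> `|s| < 1.
Proof. by move=> /andP[s0 s1]; rewrite ger0_norm. Qed.

Lemma radius_cderiv t (s : R) : 0 <= s < 1 -> cderiv (f t) s (d t s).
Proof. by move=> s01; apply: radial_cderiv => //; exact: norm_lt1. Qed.

Let ccvg_ray t (s : R) : ccvg (nbhs s) (fun s : R => s%:C * expi t) (s%:C * expi t).
Proof. by apply: ccvgM; [apply: ccvg_real; exact: cvg_id|exact: ccvg_cst]. Qed.

Lemma radius_cderiv_ccvg t (s : R) : 0 <= s < 1 -> ccvg (nbhs s) (d t) (d t s).
Proof.
move=> s01; apply: ccvgM; last exact: ccvg_cst.
apply: (locally_lipschitz_ccvg (pderiv_lipschitz aF)); first exact: ccvg_ray.
by rewrite normc_pol norm_lt1.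
Qed.

Let radius_ccvg t (s : R) : 0 <= s < 1 -> ccvg (nbhs s) (f t) (f t s).
Proof.
move=> s01; apply: (locally_lipschitz_ccvg (pseries_lipschitz aF)); first exact: ccvg_ray.
by rewrite normc_pol norm_lt1.
Qed.

Let mI : measurable I. Proof. exact: measurable_itv. Qed.

Let mb t : measurable_fun I (b t).
Proof.
have cm (h : R -> C) : (forall s : R, 0 <= s < 1 -> ccvg (nbhs s) h (h s)) -> cmeas I h.
  move=> ch; split; apply: subspace_continuous_measurable_fun => //;
    by apply: continuous_in_subspaceT => s; rewrite inE /= in_itv/= => /ch[].
apply: measurable_funM.
  by apply: measurable_normc; apply: cm => s; exact: radius_cderiv_ccvg.
have h : cmeas I (fun s => Gp p (f t s)).
  by apply: cmeas_Gp; apply: cm => s; exact: radius_ccvg.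
have := measurable_normc h.
by congr measurable_fun; apply/funext => s; rewrite normc_Gp.
Qed.

Let gE t (s : R) : 0 <= s -> s * g (s%:C * expi t) = s ^+ 2 * b t s.
Proof.
move=> s0; rewrite /g Normc.normcM normc_Gp// Normc.normcM normc_pol ger0_norm//.
by rewrite /b /d Normc.normcM normc_expi; ring.
Qed.

(** In polar coordinates the area integrand carries [s^2]: one factor from the area, one from the
    [z] of [z F']. On [[0, 1/2]] the Lipschitz estimates bound [b] by a constant; beyond [1/2] one
    has [1 <= 4 s^2], whence the 4. *)
Let b_bound : exists2 c : R, 0 <= c &
  forall t s : R, 0 <= s < 1 -> b t s <= c + 4 * (s * g (s%:C * expi t)).
Proof.
have h0 : 0 < 2^-1 :> R by rewrite invr_gt0.
have h1 : 2^-1 < 1 :> R by rewrite invf_lt1// ltr1n.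
have bnd (h : C -> C) : locally_lipschitz h ->
    exists2 c : R, 0 <= c & forall z, normc z <= 2^-1 -> normc (h z) <= c.
  move=> /(_ _ h0 h1)[K K0 hK]; exists (K + normc (h 0)); first by rewrite addr_ge0 ?normc_ge0.
  move=> z z2; have n0 : normc (0 : C) <= 2^-1 by rewrite Normc.normc0 ltW.
  have := hK _ _ n0 z2; rewrite subr0 => h2.
  rewrite -(subrK (h 0) (h z)) (le_trans (le_normcD _ _))// lerD2r.
  by apply: (le_trans h2); rewrite ler_piMr// (le_trans z2)// ltW.
have [c1 c10 hc1] := bnd _ (pderiv_lipschitz aF).
have [c2 c20 hc2] := bnd _ (pseries_lipschitz aF).
exists (c1 * c2 `^ (p - 1)); first by rewrite mulr_ge0 ?powR_ge0.
move=> t s /andP[s0 s1].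
have [s2|s2] := leP s 2^-1.
  have ns : normc (s%:C * expi t) <= 2^-1 by rewrite normc_pol ger0_norm.
  have gg : 0 <= 4 * (s * g (s%:C * expi t)) by rewrite !mulr_ge0 ?normc_ge0.
  rewrite (@le_trans _ _ (c1 * c2 `^ (p - 1)))// ?lerDl//.
  apply: ler_pM; rewrite ?normc_ge0 ?powR_ge0//.
    by rewrite /d Normc.normcM normc_expi mulr1 hc1.
  by apply: ge0_ler_powR; rewrite ?subr_ge0 ?nnegrE ?normc_ge0 ?(ltW p1)// hc2.
rewrite gE//; have := b0 t s; set B := b t s => B0.
have : 1 <= 4 * s ^+ 2.
  have := ler_pM (ltW h0) (ltW h0) (ltW s2) (ltW s2); rewrite -!expr2 => h.
  rewrite -ler_pdivrMl//; apply: le_trans h; rewrite expr2 mulr1 -invfM -natrM; exact: lexx.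
have C0 : 0 <= c1 * c2 `^ (p - 1) by rewrite mulr_ge0 ?powR_ge0.
nra.
Qed.

(** By Tonelli the radial integral [S t] of the area integrand is integrable in the angle, hence
    finite off a null set [N]. Through [radial_Np_le], [M t] dominates [|F|^p] on the whole radius,
    which serves both the H^p bound and dominated convergence on circles. *)
Lemma good_angles : exists N : set R, exists M : R -> R,
  [/\ measurable N, mu N = 0%E, mu.-integrable circ (fun t => (M t)%:E) &
  forall t, circ t -> ~ N t -> mu.-integrable I (fun s => (b t s)%:E) /\
    Np p (F 0) + p * \int[mu]_(s in I) b t s <= M t].
Proof.
have [c c0 hc] := b_bound.
have dg : dreg g by apply: cdreg_normc; case: iE.
have jg := polar_integrable dg (disc_intg_normc iE).
have mJ : measurable J by exact: measurable_itv.
pose h (z : R * R) : \bar R := (z.1 * g (pol z))%:E.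
have mh : measurable_fun (J `*` circ) h by exact: measurable_int jg.
have h0 z : (J `*` circ) z -> (0 <= h z)%E.
  move=> [+ _]; rewrite /= in_itv/= => /andP[z0 _].
  by rewrite lee_fin mulr_ge0 ?normc_ge0// ltW.
pose S t := (\int[mu]_(s in J) h (s, t))%E.
have mS : measurable_fun circ S by exact: (measurable_tonelli_rect2 mJ measurable_circ mh h0).
have S0 t : (0 <= S t)%E.
  apply: integral_ge0 => s; rewrite /= in_itv/= => /andP[s0 _].
  by rewrite lee_fin mulr_ge0 ?normc_ge0// ltW.
have iS : mu.-integrable circ S.
  apply/integrableP; split => //.
  have -> : (\int[mu]_(t in circ) `|S t| = \int[mu]_(t in circ) S t)%E.
    by apply: eq_integral => t _; rewrite gee0_abs.
  rewrite -(tonelli_rect2 mJ measurable_circ mh h0).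
  have /integrableP[_] := jg; apply: le_lt_trans.
  rewrite le_eqVlt; apply/orP; left; apply/eqP; apply: eq_integral => z /set_mem Dz.
  by rewrite gee0_abs//; exact: h0.
have [N [mN N0 hN]] := @integrable_ae _ _ _ mu circ measurable_circ S iS.
pose M t := Np p (F 0) + p * (c + 4 * fine (S t)).
exists N, M; split => //.
  have ifS : mu.-integrable circ (fun t => (fine (S t))%:E).
    apply: le_integrable iS => //; first exact: measurable_circ.
      apply/measurable_EFinP; apply: (measurable_comp _ _ (@fine_measurable R setT measurableT)) => //.
    by move=> t _; case: (S t) => [r| |] //; rewrite /= normr0 leey.
  have ic := @integrable_cst_on _ _ _ mu circ (Np p (F 0) + p * c) measurable_circ circ_lty.
  have i4 := @integrable_EFinZl _ _ _ mu circ measurable_circ (p * 4) _ ifS.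
  have := @integrableD _ _ _ mu circ measurable_circ _ _ ic i4.
  apply: eq_integrable; first exact: measurable_circ.
  by move=> t _; rewrite /= -EFinD /M; congr (_%:E); ring.
move=> t ct Nt.
have fS : S t \is a fin_num.
  by apply: contrapT => nS; apply: Nt; apply: hN => /= H; exact: nS (H ct).
have mg : measurable_fun I (fun s => (s ^+ 2 * b t s)%:E).
  by apply/measurable_EFinP; exact: measurable_funM.
have eS : S t = (\int[mu]_(s in I) (s ^+ 2 * b t s)%:E)%E.
  rewrite -integral_itv_obnd_cbnd; last first.
    by apply: measurable_funS mg => // s /=; rewrite !in_itv/= => /andP[/ltW -> ->].
  apply: eq_integral => s; rewrite inE /= in_itv/= => /andP[s0 _].
  by rewrite /h /= -gE ?(ltW s0).
have is2 : mu.-integrable I (fun s => (s ^+ 2 * b t s)%:E).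
  apply/integrableP; split => //; rewrite (_ : (\int[mu]_(s in I) _)%E = S t).
    by rewrite ltey_eq fS.
  by rewrite eS; apply: eq_integral => s _; rewrite gee0_abs// lee_fin mulr_ge0 ?sqr_ge0.
have mu1 : (mu I < +oo)%E by rewrite lebesgue_measure_itv/= lte01 oppr0 adde0 ltry.
have i4 := @integrable_EFinZl _ _ _ mu I mI 4 _ is2.
have ic := @integrable_cst_on _ _ _ mu I c mI mu1.
have i5 : mu.-integrable I (fun s => (c + 4 * (s ^+ 2 * b t s))%:E).
  exact: (@integrableD _ _ _ mu I mI _ _ ic i4).
have bI s : I s -> b t s <= c + 4 * (s ^+ 2 * b t s).
  rewrite /= in_itv/= => s01; rewrite -gE; first exact: hc.
  by case/andP: s01.
have ib : mu.-integrable I (fun s => (b t s)%:E).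
  apply: le_integrable i5 => //; first by apply/measurable_EFinP; exact: mb.
  move=> s Is; rewrite /= lee_fin ger0_norm//; exact: le_trans (bI s Is) (ler_norm _).
split => //; rewrite /M lerD2l ler_wpM2l ?(ltW p0)//.
apply: (@le_trans _ _ (\int[mu]_(s in I) (c + 4 * (s ^+ 2 * b t s)))).
  exact: le_Rintegral.
rewrite (@RintegralD _ _ _ mu I _ _ mI ic i4).
rewrite (@RintegralZl _ _ _ mu I _ 4 mI is2) eS lerD2r.
by rewrite /Rintegral integral_cst// [X in (_ * X)%E]lebesgue_measure_itv/= lte01 oppr0 adde0 mule1.
Qed.

End good_angles.

(** * Boundary values, their Fourier coefficients and Green's formula *)

Section boundary_values.
Context {R : realType}.
Local Notation C := R[i].
Local Notation normc := (@Normc.normc R).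
Local Notation mu := (@lebesgue_measure R).
Local Notation mu2 := (mu \x mu)%E.
Local Notation D := (@Disc R).
Local Notation circ := (@circ_dom R).
Local Notation I := (`[0 : R, 1[%classic).
Local Notation J := (`]0 : R, 1[%classic).

Lemma null_translate (N : set R) (c : R) : measurable N -> mu N = 0%E ->
  mu.-negligible [set t | N (t + c)].
Proof.
move=> mN N0.
have mNc : measurable [set t : R | N (t + c)].
  have m : measurable_fun [set: R] (fun t : R => t + c).
    by apply: measurable_funD => //; exact: measurable_cst.
  by have := m measurableT _ mN; rewrite setTI.
exists [set t | N (t + c)]; split => //.
have mi : measurable_fun [set: R] (fun t : R => (\1_N t)%:E : \bar R).
  by apply/measurable_EFinP; exact: measurable_indic.
have := @ge0_integral_affine R 1 c (fun t => (\1_N t)%:E) ltr01 mi (fun t => ltac:(by rewrite lee_fin)).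
have -> : (\int[mu]_x (\1_N x)%:E = 0)%E.
  by rewrite (@integral_indic _ _ _ mu setT measurableT N mN) setIT; exact: N0.
rewrite mul1e => ->.
rewrite -[X in mu X](setIT) -(@integral_indic _ _ _ mu setT measurableT _ mNc).
apply: eq_integral => t _; rewrite mul1r !indicE; congr (_%:E); congr (nat_of_bool _)%:R.
Qed.

Lemma expi_floor (t : R) : exists n : nat, exists c : R,
  [/\ c = (pi *+ 2) * n%:R \/ c = - ((pi *+ 2) * n%:R), circ (t + c) & expi (t + c) = expi t].
Proof.
have p2 := @pi2_gt0 R.
have eN (n : nat) (s : R) : expi (s + pi *+ 2 * n%:R) = expi s.
  elim: n s => [|n ih] s; first by rewrite mulr0 addr0.
  by rewrite -natr1 mulrDr mulr1 addrA expiD2pi ih.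
have h1 := floor_le (t / (pi *+ 2)); have h2 := floorD1_gt (t / (pi *+ 2)).
rewrite intrD mulr1z in h2.
rewrite ler_pdivlMr// mulrC in h1; rewrite ltr_pdivrMr// mulrC mulrDr mulr1 in h2.
case: (Num.floor (t / (pi *+ 2))) h1 h2 => n h1 h2.
  exists n, (- ((pi *+ 2) * n%:R)); split; first by right.
    rewrite /circ_dom /=; move: h1 h2; rewrite -pmulrn; move: (_ * n%:R) => u h1 h2.
    by apply/andP; split; lra.
  by rewrite -(eN n) subrK.
exists n.+1, ((pi *+ 2) * n.+1%:R); split; first by left.
  rewrite /circ_dom /=; move: h1 h2; rewrite NegzE mulrNz mulrN -pmulrn.
  by move: (_ * n.+1%:R) => u h1 h2; apply/andP; split; lra.
exact: eN.
Qed.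

(** Radial limits are required for almost every real angle, whereas the estimates concern one
    period. The exceptional set is covered by the countably many translates of [N] by multiples of
    [2 pi], in both directions. *)
Lemma ae_radial (P : C -> Prop) (N : set R) : measurable N -> mu N = 0%E ->
  (forall t, circ t -> ~ N t -> P (expi t)) -> {ae mu, forall t : R, P (expi t)}.
Proof.
move=> mN N0 h.
pose A (n : nat) := [set t | N (t + (pi *+ 2) * n%:R)] `|` [set t | N (t + - ((pi *+ 2) * n%:R))].
have nA : mu.-negligible (\bigcup_n A n).
  by apply: negligible_bigcup => n; apply: negligibleU; exact: null_translate.
apply: negligibleS nA => t /= nP.
have [n [c [hc ct e]]] := expi_floor t.
exists n => //; apply: contrapT => nN; apply: nP; rewrite -e; apply: h => // Nt; apply: nN.
by case: hc => hc; [left|right]; rewrite /= -hc.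
Qed.

Lemma periodic_cderiv_integral (q q' : R -> C) : (forall t, cderiv q t (q' t)) ->
  (forall t, ccvg (nbhs t) q' (q' t)) -> q (pi *+ 2) = q 0 ->
  cintg mu circ q' /\ cintegral mu circ q' = 0.
Proof.
move=> dq cq e; rewrite circE.
have [i1 e1] := @FTC_closed R _ _ 0 (pi *+ 2) pi2_gt0 (fun t _ => (dq t).1) (fun t _ => (cq t).1).
have [i2 e2] := @FTC_closed R _ _ 0 (pi *+ 2) pi2_gt0 (fun t _ => (dq t).2) (fun t _ => (cq t).2).
by split => //; rewrite /cintegral /Rintegral e1 e2 e !subrr.
Qed.

Lemma cderivMreal (f : R -> C) (u : R -> R) (x : R) (df : C) (du : R) :
  cderiv f x df -> is_derive x 1 u du ->
  cderiv (fun t => f t * (u t)%:C) x (df * (u x)%:C + f x * du%:C).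
Proof.
move=> [f1 f2] hu; split.
  rewrite (_ : (fun t => _) = fun t => complex.Re (f t) * u t); last first.
    by apply/funext => t; rewrite ReM /= mulr0 subr0.
  by apply: (is_derive_eq (rderivM f1 hu)); rewrite ReD !ReM /=; ring.
rewrite (_ : (fun t => _) = fun t => complex.Im (f t) * u t); last first.
  by apply/funext => t; rewrite ImM /= mulr0 add0r.
by apply: (is_derive_eq (rderivM f2 hu)); rewrite ImD !ImM /=; ring.
Qed.

Variables (p : R) (F : C -> C) (a : nat -> C).
Hypothesis p1 : 1 < p.
Let p0 : 0 < p. Proof. exact: lt_trans p1. Qed.
Hypothesis AF : inA p F.
Hypothesis aF : forall z : C, normc z < 1 ->
  ccvg \oo (fun N : nat => \sum_(n < N) a n * z ^+ n) (F z).
Hypothesis iE : forall j, disc_intg (fun z => z ^+ j * (z * pderiv a z) * Gp p (F z)).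

Let dF : cdreg F. Proof. exact: pseries_cdreg aF. Qed.
Let E z := z * pderiv a z * Gp p (F z).
Let cE : cdreg E.
Proof.
apply: cdregM; last exact: cdreg_Gp.
by apply: cdregM; [exact: cdreg_id|exact: (pderiv_cdreg aF)].
Qed.

(** On each circle [H] is [-i] times the angular derivative of [z^j |F|^p], and a periodic primitive
    makes its integral vanish. Subtracting this zero is what replaces the real part of [z F' G(F)]
    by the full complex quantity. *)
Lemma angular_integral_zero (j : nat) :
  let H z := z ^+ j * ((j%:R * Np p (F z))%:C + (p * complex.Im (E z))%:C * Complex 0 1) in
  disc_intg H /\ disc_integral H = 0.
Proof.
move=> H.
have cH : cdreg H.
  apply: cdregM; first by apply: cdregX; exact: cdreg_id.
  apply: cdregD.
    have h := cdregM (cdreg_cst (j%:R%:C)) (cdregM dF (cdreg_Gp p1 dF)).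
    by apply: eq_cdreg h => z _; rewrite mul_Gp// -rmorphM.
  have h := cdregM (cdreg_cst (p / 2)%:C) (cdregB cE (cdreg_conjc cE)).
  apply: eq_cdreg h => z _.
  by move: (E z) => [x y]; apply: complexP; rewrite ?(ReM, ImM, ReD, ImD, ReN, ImN) /=; field.
have iH : disc_intg H.
  have [_ AN] := AF.
  apply: (disc_intg_bound (g := fun z =>
    j%:R * Np p (F z) + p * normc (z ^+ 0 * (z * pderiv a z) * Gp p (F z)))) => //.
    apply: (@disc_integrableD _ (fun z => j%:R * Np p (F z))
      (fun z => p * normc (z ^+ 0 * (z * pderiv a z) * Gp p (F z)))).
      exact: (@disc_integrableZ _ _ (fun z => Np p (F z))).
    apply: (@disc_integrableZ _ _ (fun z => normc (z ^+ 0 * (z * pderiv a z) * Gp p (F z)))).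
    exact: (disc_intg_normc (iE 0)).
  move=> z z1; rewrite Normc.normcM normcX expr0 mul1r -/(E z).
  apply: (@le_trans _ _ (1 * (j%:R * Np p (F z) + p * normc (E z)))); last by rewrite mul1r.
  apply: ler_pM; rewrite ?exprn_ge0 ?normc_ge0 ?exprn_ile1 ?normc_ge0 ?(ltW z1)//.
  apply: (le_trans (le_normcD _ _)); apply: lerD.
    by rewrite normc_real ger0_norm// mulr_ge0// Np_ge0.
  rewrite Normc.normcM normc_real normrM gtr0_norm//.
  have -> : normc (Complex 0 1 : C) = 1 by rewrite normcE /= expr0n expr1n add0r sqrtr1.
  by rewrite mulr1 ler_wpM2l ?(ltW p0)// normc_Im.
split=> //; have [_ ->] := disc_polar iH.
rewrite -[RHS](cintegral0 mu J); apply: eq_cintegral => r; rewrite /= in_itv/= => r01.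
suff -> : circ_integral r H = 0 by rewrite mulr0.
have rn : `|r| < 1 by rewrite gtr0_norm; case/andP: r01.
(* The constant is [-i r^j]. The derivative of [|F|^p] brings the real part of [i E], that is minus
   the imaginary part of [E]. *)
pose q t := Complex 0 (- r ^+ j) * (expi (j%:R * t) * (Np p (F (r%:C * expi t)))%:C).
apply: (periodic_cderiv_integral (q := q) _ (cH.2 r r01) _).2.
  move=> t; have hN := cderiv_Np p1 (angular_cderiv aF t rn).
  have := cderivMl (Complex 0 (- r ^+ j)) (cderivMreal (cderiv_expiZ j%:R t) hN).
  congr cderiv; rewrite /H -/(E (r%:C * expi t)) exprMn.
  have -> : expi t ^+ j = expi (j%:R * t) by rewrite expiX mulr_natl.
  rewrite -[Complex 0 1 * _ * Gp _ _]mulrA -/(E (r%:C * expi t)).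
  have -> : complex.Re (Complex 0 1 * E (r%:C * expi t)) = - complex.Im (E (r%:C * expi t)).
    by rewrite ReM /= mul0r mul1r sub0r.
  rewrite -rmorphXn /=; move: (E _) (Np _ _) (expi (j%:R * t)) (r ^+ j) => [x y] n [u v] w.
  by apply: complexP; rewrite !(ReM, ImM, ReD, ImD) /=; ring.
have e2 : @expi R (pi *+ 2) = @expi R 0 by rewrite -[pi *+ 2]add0r expiD2pi.
by rewrite /q e2 !mulr_natl -!(expiX _ j) e2.
Qed.

Variables (N : set R) (M : R -> R).
Hypotheses (mN : measurable N) (N0 : mu N = 0%E).
Hypothesis iM : mu.-integrable circ (fun t => (M t)%:E).
Hypothesis good : forall t, circ t -> ~ N t ->
  mu.-integrable I (fun s : R => (normc (pderiv a (s%:C * expi t) * expi t) *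
    normc (F (s%:C * expi t)) `^ (p - 1))%:E) /\
  Np p (F 0) + p * \int[mu]_(s in I) (normc (pderiv a (s%:C * expi t) * expi t) *
    normc (F (s%:C * expi t)) `^ (p - 1)) <= M t.

Let f (t s : R) : C := F (s%:C * expi t).

Let radial_bound t (r : R) : circ t -> ~ N t -> 0 <= r < 1 -> Np p (f t r) <= M t.
Proof.
move=> ct Nt r01; have [ib hM] := good ct Nt; apply: le_trans hM.
have := @radial_Np_le R p (f t) _ p1 (radius_cderiv aF t) (radius_cderiv_ccvg aF t) ib r r01.
by rewrite {2}/f mul0r.
Qed.

Let radial_lim t : circ t -> ~ N t -> exists l, ccvg ((1 : R)^'-) (f t) l.
Proof.
move=> ct Nt; have [ib _] := good ct Nt.
exact: (@radial_ccvg R p (f t) _ p1 (radius_cderiv aF t) (radius_cderiv_ccvg aF t) ib).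
Qed.

Let iaM : mu.-integrable circ (fun t => (`|M t|)%:E).
Proof. exact: (@integrable_norm _ _ _ mu circ _ iM). Qed.

Lemma radial_limit_exists : exists Fb : R -> C, radial_limit F Fb.
Proof.
pose P (w : C) := exists l, ccvg ((1 : R)^'-) (fun r : R => F (r%:C * w)) l.
exists (fun t => xget 0 [set l | ccvg ((1 : R)^'-) (f t) l]).
have [A [mA A0 hA]] := @ae_radial P N mN N0 radial_lim.
exists A; split => // t nt; apply: hA => /= Pt; apply: nt.
exact: (xgetPex 0 Pt).
Qed.

Lemma inA_in_Hp : in_Hp p F.
Proof.
split; first exact: AF.1.
exists ((pi *+ 2)^-1 * \int[mu]_(t in circ) `|M t|) => r /andP[r0 r1].
rewrite EFinM lee_pmul2l ?lte_fin ?invr_gt0 ?pi2_gt0//.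
rewrite /Rintegral fineK; last exact: (@integrable_fin_num _ _ _ mu circ measurable_circ _ iaM).
apply: (@ae_ge0_le_integral _ _ _ mu circ measurable_circ) => //.
- by move=> t _; rewrite lee_fin powR_ge0.
- apply/measurable_EFinP; have r01 : 0 < r < 1 by rewrite r0.
  exact: (measurable_Np p (cintg_cmeas (circ_cintg r01 dF))).
- by have /measurable_int := iaM.
exists N; split => // t /= /not_implyP[ct h]; apply: contrapT => Nt; apply: h.
rewrite lee_fin (le_trans _ (ler_norm _))//; apply: (radial_bound ct Nt).
by rewrite (ltW r0).
Qed.

(** The factor [1/2] keeps the radii positive: they start at [1/2] and increase to 1. *)
Let rn (n : nat) : R := 1 - 2^-1 * n.+1%:R^-1.

Let rn01 n : 0 < rn n < 1.
Proof.
have h : 0 < (n.+1%:R^-1 : R) <= 1 by rewrite invr_gt0 ltr0n/= invf_le1 ?ler1n ?ltr0n.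
by move: h; rewrite /rn; move: (n.+1%:R^-1 : R) => x /andP[x0 x1]; apply/andP; split; lra.
Qed.

Let rn_cvg : rn n @[n --> \oo] --> (1 : R).
Proof.
rewrite (_ : (1 : R) = 1 - 2^-1 * 0); last by rewrite mulr0 subr0.
apply: cvgB; first exact: cvg_cst.
by apply: cvgM; [exact: cvg_cst|exact: cvg_harmonic].
Qed.

Let ccvg_rn (h : R -> C) l : ccvg ((1 : R)^'-) h l -> ccvg \oo (fun n => h (rn n)) l.
Proof.
have u1 : (forall n, rn n < 1) /\ rn n @[n --> \oo] --> (1 : R).
  by split=> // n; have /andP[] := rn01 n.
case=> h1 h2; split; first exact: ((cvg_at_leftP _ _ _).1 h1 _ u1).
exact: ((cvg_at_leftP _ _ _).1 h2 _ u1).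
Qed.

(** Zero on [N] by convention: on all of [circ] it is then a pointwise limit of measurable
    functions, namely [F] on the circles of radius [rn n] cut off by the indicator of the complement
    of [N]. *)
Definition boundary_value t : C :=
  if t \in N then 0 else xget 0 [set l | ccvg ((1 : R)^'-) (f t) l].
Local Notation Fb := boundary_value.

Lemma boundary_value_ccvg t : circ t -> ~ N t ->
  ccvg ((1 : R)^'-) (fun r : R => F (r%:C * expi t)) (Fb t).
Proof.
move=> ct Nt; rewrite /boundary_value memNset//.
exact: (xgetPex 0 (radial_lim ct Nt)).
Qed.

Let Fb_null t : N t -> Fb t = 0.
Proof. by move=> Nt; rewrite /boundary_value mem_set. Qed.

Let ind t : C := (\1_(~` N) t)%:C.
Let ind1 t : ~ N t -> ind t = 1.
Proof. by move=> Nt; rewrite /ind indicE mem_set. Qed.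
Let ind0 t : N t -> ind t = 0.
Proof. by move=> Nt; rewrite /ind indicE memNset //=; apply. Qed.
Let cind : cmeas circ ind.
Proof. by apply: cmeas_real; apply: measurable_indic; exact: measurableC. Qed.

Let circ_cmeas (h : C -> C) n : cdreg h -> cmeas circ (fun t => h ((rn n)%:C * expi t)).
Proof. by move=> ch; exact: (cintg_cmeas (circ_cintg (rn01 n) ch)). Qed.

Lemma boundary_value_cmeas : cmeas circ Fb.
Proof.
apply: (@cmeas_cvg _ _ _ circ (fun n t => ind t * f t (rn n))).
  by move=> n; apply: cmeasM; [exact: cind|exact: circ_cmeas].
move=> t ct; have [Nt|Nt] := pselect (N t).
  rewrite Fb_null//; under eq_fun do rewrite ind0// mul0r; exact: ccvg_cst.
under eq_fun do rewrite ind1// mul1r.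
exact: ccvg_rn (boundary_value_ccvg ct Nt).
Qed.

Lemma boundary_Np_le t : circ t -> Np p (Fb t) <= `|M t|.
Proof.
move=> ct; have [Nt|Nt] := pselect (N t).
  by rewrite Fb_null// /Np Normc.normc0 powR0 ?gt_eqF.
have h : Np p (f t (rn n)) @[n --> \oo] --> Np p (Fb t).
  by apply: cvg_Np => //; exact: ccvg_rn (boundary_value_ccvg ct Nt).
rewrite -(cvg_lim (@Rhausdorff R) h); apply: limr_le.
  by apply/cvg_ex; eexists; exact: h.
apply: nearW => n; apply: le_trans (ler_norm _); apply: radial_bound => //.
by have /andP[/ltW -> ->] := rn01 n.
Qed.

Let i1M : mu.-integrable circ (fun t => (1 + `|M t|)%:E).
Proof.
have ic := @integrable_cst_on _ _ _ mu circ 1 measurable_circ circ_lty.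
exact: (@integrableD _ _ _ mu circ measurable_circ _ _ ic iaM).
Qed.

Lemma boundary_Np_integrable : mu.-integrable circ (fun t => (Np p (Fb t))%:E).
Proof.
apply: (le_integrable _ _ _ iaM); first exact: measurable_circ.
  by apply/measurable_EFinP; exact: (measurable_Np p boundary_value_cmeas).
move=> t ct; rewrite /= lee_fin normr_id ger0_norm ?Np_ge0//; exact: boundary_Np_le.
Qed.

Lemma boundary_value_cintg : cintg mu circ Fb.
Proof.
apply: (@cintg_bound _ _ _ mu circ measurable_circ _ _ boundary_value_cmeas i1M) => t ct.
apply: le_trans (le_1powR p1 (normc_ge0 _)) _.
by rewrite lerD2l; exact: boundary_Np_le.
Qed.

(** Both sides are multiples of the Taylor coefficient of index [m] of [z^j F]: the circles of
    radius tending to 1 give [2 pi] times it, the disc gives [pi / (m + 1)] times it. *)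
Lemma boundary_moment (j m : nat) :
  cintegral mu circ (fun t => Fb t * (expi t ^+ j * conjc (expi t) ^+ m)) =
  (2 * m.+1%:R)%:C * mom m (fun z => z ^+ j * F z).
Proof.
have [b hb] := analyticMX j AF.1.
pose h (z : C) := z ^+ j * F z * conjc z ^+ m.
have ch : cdreg h.
  apply: cdregM; last by apply: cdregX; apply: cdreg_conjc; exact: cdreg_id.
  by apply: cdregM => //; apply: cdregX; exact: cdreg_id.
have jf := inA_disc_intg p1 (inAMX p1 j AF).
rewrite (mom_coef m hb jf).
have l1 : ccvg \oo (fun n => circ_integral (rn n) h) ((pi *+ 2 * 1 ^+ m.*2)%:C * b m).
  rewrite (_ : (fun n => _) = fun n => (pi *+ 2 * rn n ^+ m.*2)%:C * b m); last first.
    by apply/funext => n; exact: (circ_coef hb m (rn01 n)).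
  apply: ccvgM; last exact: ccvg_cst.
  apply: ccvg_real; apply: cvgM; first exact: cvg_cst.
  exact: (@cvg_comp _ _ _ rn (fun x : R => x ^+ m.*2) _ _ _ rn_cvg (@exprn_continuous R m.*2 1)).
have l2 : ccvg \oo (fun n => circ_integral (rn n) h)
    (cintegral mu circ (fun t => Fb t * (expi t ^+ j * conjc (expi t) ^+ m))).
  rewrite (_ : (fun n => _) = fun n => cintegral mu circ
      (fun t => ind t * h ((rn n)%:C * expi t))); last first.
    apply/funext => n; apply: (@cintegral_off_null _ _ _ mu N mN N0 circ) => t _ Nt.
    by rewrite ind1// mul1r.
  have ce (q : nat) : cmeas circ (fun t : R => expi t ^+ q).
    apply: cmeasX; have c1 := cmeas_real (measurable_funTS (@measurable_cos R)) (D := circ).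
    by split; apply: measurable_funTS; [exact: measurable_cos|exact: measurable_sin].
  apply: (@cintegral_dominated _ _ _ mu circ measurable_circ _ _ (fun t => 1 + `|M t|)) => //.
  - by move=> n; apply: cmeasM; [exact: cind|exact: circ_cmeas].
  - apply: cmeasM; first exact: boundary_value_cmeas.
    apply: cmeasM; first exact: ce.
    by apply: cmeasX; apply: cmeas_conjc; exact: (ce 1).
  - move=> t ct; have [Nt|Nt] := pselect (N t).
      by rewrite Fb_null// mul0r; under eq_fun do rewrite ind0// mul0r; exact: ccvg_cst.
    under eq_fun do rewrite ind1// mul1r.
    have ct1 : ccvg \oo (fun n => (rn n)%:C * expi t) (expi t).
      rewrite -[X in ccvg _ _ X]mul1r; apply: ccvgM; last exact: ccvg_cst.
      exact: ccvg_real.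
    rewrite mulrA [Fb t * _]mulrC; apply: ccvgM; last by apply: ccvgX; exact: ccvg_conjc.
    apply: ccvgM; first exact: ccvgX.
    exact: ccvg_rn (boundary_value_ccvg ct Nt).
  - move=> n t ct; have [Nt|Nt] := pselect (N t).
      by rewrite ind0// mul0r Normc.normc0 addr_ge0.
    have /andP[r0 r1] := rn01 n.
    have z1 : normc ((rn n)%:C * expi t) <= 1 by rewrite normc_pol gtr0_norm// ltW.
    rewrite ind1// mul1r /h Normc.normcM Normc.normcM !normcX normc_conjc.
    apply: (@le_trans _ _ (1 * normc (F ((rn n)%:C * expi t)) * 1)).
      by rewrite !ler_pM ?mulr_ge0 ?exprn_ge0 ?normc_ge0 ?exprn_ile1 ?normc_ge0.
    rewrite mul1r mulr1 (le_trans (le_1powR p1 (normc_ge0 _)))// lerD2l.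
    apply: le_trans (ler_norm _); apply: (radial_bound ct Nt).
    by rewrite (ltW r0).
rewrite (ccvg_unique l2 l1) expr1n mulr1 mulrA -rmorphM /=; congr (_%:C * _).
have : m.+1%:R != 0 :> R by rewrite pnatr_eq0.
by move: (m.+1%:R : R) (pi : R) => x y x0; field.
Qed.

(** Off [N], the fundamental theorem for [s^(j+2) |F|^p] on a radius produces [|F|^p] at the
    boundary point. Multiplied by [e^(ijt)] and integrated over the angle, the radial integrals form
    the disc integral in polar coordinates. *)
Lemma green_boundary (j : nat) :
  let H z := z ^+ j * (j.+2%:R * Np p (F z) + p * complex.Re (E z))%:C in
  disc_intg H /\
  cintegral mu circ (fun t => (Np p (Fb t))%:C * expi t ^+ j) = disc_integral H.
Proof.
move=> H.
have cH : cdreg H.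
  apply: cdregM; first by apply: cdregX; exact: cdreg_id.
  have h1 := cdregM (cdreg_cst (j.+2%:R%:C)) (cdregM dF (cdreg_Gp p1 dF)).
  have h2 := cdregM (cdreg_cst (p / 2)%:C) (cdregD cE (cdreg_conjc cE)).
  apply: eq_cdreg (cdregD h1 h2) => z _; rewrite mul_Gp//.
  by move: (E z) (Np p (F z)) => [x y] n; apply: complexP;
    rewrite ?(ReM, ImM, ReD, ImD, ReN, ImN) /=; field.
have iH : disc_intg H.
  apply: (disc_intg_bound (g := fun z =>
    j.+2%:R * Np p (F z) + p * normc (z ^+ 0 * (z * pderiv a z) * Gp p (F z)))) => //.
    apply: (@disc_integrableD _ (fun z => j.+2%:R * Np p (F z))
      (fun z => p * normc (z ^+ 0 * (z * pderiv a z) * Gp p (F z)))).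
      by apply: (@disc_integrableZ _ _ (fun z => Np p (F z))); exact: AF.2.
    apply: (@disc_integrableZ _ _ (fun z => normc (z ^+ 0 * (z * pderiv a z) * Gp p (F z)))).
    exact: (disc_intg_normc (iE 0)).
  move=> z z1; rewrite Normc.normcM normcX expr0 mul1r -/(E z) normc_real.
  apply: (@le_trans _ _ (1 * (j.+2%:R * Np p (F z) + p * normc (E z)))); last by rewrite mul1r.
  apply: ler_pM; rewrite ?exprn_ge0 ?normc_ge0 ?exprn_ile1 ?normc_ge0 ?(ltW z1)//.
  apply: (le_trans (ler_normD _ _)); apply: lerD.
    by rewrite ger0_norm// mulr_ge0// Np_ge0.
  by rewrite normrM gtr0_norm// ler_wpM2l ?(ltW p0)// normc_Re.
split=> //.
(* One real argument serves both components: [uM] says that [u] lets real factors out, so [e^(ijt)]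
   enters only through the constant [u (expi t ^+ j)] on each radius. *)
suff key (u : C -> R) : (u = complex.Re (R := R) \/ u = complex.Im (R := R)) ->
    \int[mu]_(t in circ) u ((Np p (Fb t))%:C * expi t ^+ j) =
    \int[mu2]_(z in D) u (H (cplx z)).
  by apply: complexP; [exact: (key _ (or_introl erefl))|exact: (key _ (or_intror erefl))].
move=> uE.
have uM w x : u (w * x%:C) = u w * x.
  by case: uE => ->; rewrite ?ReM ?ImM /=; ring.
have du : dreg (fun z => u (H z)) by case: uE => ->; [exact: cdreg_Re|exact: cdreg_Im].
have iu : mu2.-integrable D (fun z => (u (H (cplx z)))%:E).
  by case: iH => _ [i1 i2]; case: uE => ->.
have mI : measurable I by exact: measurable_itv.
have mJ : measurable J by exact: measurable_itv.
congr fine; rewrite (polar_Disc du).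
rewrite (@fubini_rect2 _ J circ mJ measurable_circ (fun z => z.1 * u (H (pol z))) (polar_integrable du iu)).
apply: (@integral_off_null _ _ _ mu N mN N0 circ) => t ct Nt.
pose W (s : R) := j.+2%:R * s ^+ j.+1 * Np p (f t s) +
  s ^+ j.+2 * (p * complex.Re (pderiv a (s%:C * expi t) * expi t * Gp p (f t s))).
have [ib _] := good ct Nt.
have iW : mu.-integrable I (fun s => (W s)%:E).
  exact: (@radial_weighted_integrable R p (f t) _ p1 (radius_cderiv aF t) (radius_cderiv_ccvg aF t) ib j).
have eW : \int[mu]_(s in I) W s = Np p (Fb t).
  apply: (@radial_weighted_integral R p (f t) _ p1 (radius_cderiv aF t) (radius_cderiv_ccvg aF t) ib j).
  by apply: cvg_Np => //; exact: boundary_value_ccvg.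
have iuW := @integrable_EFinZl _ _ _ mu I mI (u (expi t ^+ j)) _ iW.
transitivity (\int[mu]_(s in J) (u (expi t ^+ j) * W s)%:E)%E; last first.
  apply: eq_integral => r; rewrite inE /= in_itv/= => /andP[r0 r1].
  congr (_%:E); rewrite /H /pol /= exprMn.
  have -> : (r%:C) ^+ j * expi t ^+ j * (j.+2%:R * Np p (F (r%:C * expi t)) +
      p * complex.Re (E (r%:C * expi t)))%:C =
    expi t ^+ j * (r ^+ j * (j.+2%:R * Np p (F (r%:C * expi t)) +
      p * complex.Re (E (r%:C * expi t))))%:C.
    by rewrite [in RHS]rmorphM /= rmorphXn /=; ring.
  rewrite uM mulrCA; congr (_ * _); rewrite /W /f.
  have -> : E (r%:C * expi t) =
      r%:C * (pderiv a (r%:C * expi t) * expi t * Gp p (F (r%:C * expi t))).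
    by rewrite /E; ring.
  rewrite ReMl !exprS.
  by move: (complex.Re _) (Np _ _) (r ^+ j) (j.+2%:R : R) => x y v c; ring.
rewrite integral_itv_obnd_cbnd; last first.
  have /measurable_int m := iuW; apply: measurable_funS m => // s /=.
  by rewrite !in_itv/= => /andP[/ltW -> ->].
rewrite -[RHS]fineK; last exact: (@integrable_fin_num _ _ _ mu I mI _ iuW).
congr (_%:E); rewrite mulrC uM -eW.
by rewrite -(@RintegralZl _ _ _ mu I _ (u (expi t ^+ j)) mI iW).
Qed.

End boundary_values.

(** * Polynomials on the circle and comparison of coefficients *)

Section polynomials_on_circle.
Context {R : realType}.
Local Notation C := R[i].
Local Notation normc := (@Normc.normc R).
Local Notation mu := (@lebesgue_measure R).

Lemma cintg_mul_bounded {d : measure_display} {T : measurableType d}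
    (nu : {measure set T -> \bar R}) (A : set T) (f g : T -> C) : measurable A ->
  cintg nu A f -> cmeas A g -> (forall x, A x -> normc (g x) <= 1) ->
  cintg nu A (fun x => f x * g x).
Proof.
move=> mA jf mg g1.
apply: (@cintg_bound _ _ _ nu A mA _ (fun x => normc (f x))).
- by apply: cmeasM mg; exact: cintg_cmeas jf.
- exact: cintg_normc.
- by move=> x Ax; rewrite Normc.normcM ler_piMr ?normc_ge0// g1.
Qed.

Lemma mulr_sum_sum (x : C) (n m : nat) (f g : nat -> C) :
  x * (\sum_(j < n) f j) * (\sum_(i < m) g i) = \sum_(j < n) \sum_(i < m) x * f j * g i.
Proof.
rewrite -mulrA mulr_suml mulr_sumr; apply: eq_bigr => j _.
by rewrite mulrA mulr_sumr.
Qed.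

Lemma cmeas_expi (A : set R) : cmeas A (@expi R).
Proof. by split; apply: measurable_funTS; [exact: measurable_cos|exact: measurable_sin]. Qed.

Lemma integral_pow01 (m : nat) : mu.-integrable [set t : R | 0 <= t <= 1] (fun t => (t ^+ m)%:E) /\
  \int[mu]_(t in [set t : R | 0 <= t <= 1]) t ^+ m = m.+1%:R^-1.
Proof.
rewrite (_ : [set t : R | 0 <= t <= 1] = `[0, 1]%classic); last first.
  by apply/seteqP; split => t /=; rewrite in_itv.
have m0 : m.+1%:R != 0 :> R by rewrite pnatr_eq0.
have dF (x : R) : 0 <= x <= 1 -> is_derive x 1 (fun t : R => m.+1%:R^-1 * t ^+ m.+1) (x ^+ m).
  move=> _; apply: (is_derive_eq (rderivZ m.+1%:R^-1 (rderivX m x))).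
  by rewrite mulrA mulVf// mul1r.
have [i e] := FTC_closed ltr01 dF (fun x _ => @exprn_continuous R m x).
split=> //; rewrite /Rintegral e /= expr1n expr0n /= mulr0 subr0 mulr1//.
Qed.

Lemma Kfun_sum (k : {poly C}) (z : C) :
  Kfun k z = \sum_(m < size k) k`_m * z ^+ m * (m.+1%:R^-1)%:C.
Proof.
have mI : measurable [set t : R | 0 <= t <= 1].
  rewrite (_ : [set t : R | 0 <= t <= 1] = `[0, 1]%classic) //.
have it (m : nat) : cintg mu [set t : R | 0 <= t <= 1] (fun t => (t ^+ m)%:C).
  by split; [exact: (integral_pow01 m).1|exact: integrable0].
transitivity (cintegral mu [set t : R | 0 <= t <= 1]
    (fun t => \sum_(m < size k) (k`_m * z ^+ m) * (t ^+ m)%:C)).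
  apply: eq_cintegral => t _; rewrite horner_coef; apply: eq_bigr => m _.
  by rewrite exprMn -rmorphXn /=; ring.
rewrite (@cintegral_sum _ _ _ mu _ mI); last by move=> m; apply: cintgZ.
apply: eq_bigr => m _; rewrite (@cintegralZ _ _ _ mu _ mI _ _ (it m)); congr (_ * _).
by rewrite Re_cintegral_real (integral_pow01 m).2.
Qed.

Lemma deriv_mulX_horner (h : {poly C}) (z : C) :
  ('X * h)^`().[z] = \sum_(j < size h) j.+1%:R * h`_j * z ^+ j.
Proof.
have -> : ('X * h)^`() = \poly_(j < size h) (j.+1%:R * h`_j).
  apply/polyP => j; rewrite coef_poly coef_deriv coefXM /= mulr_natl.
  by case: ltnP => // hj; rewrite nth_default// mul0rn.
exact: horner_poly.
Qed.

End polynomials_on_circle.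

Section boundary_identity.
Context {R : realType}.
Local Notation C := R[i].
Local Notation normc := (@Normc.normc R).
Variables (p : R) (k : {poly C}) (F : C -> C) (a : nat -> C).
Hypotheses (p1 : 1 < p) (k0 : k != 0) (exF : extremal p k F).
Hypothesis aF : forall z : C, normc z < 1 ->
  ccvg \oo (fun N : nat => \sum_(n < N) a n * z ^+ n) (F z).
Local Notation Phi := (phi_norm p k).
Let AF : inA p F := extremal_inA p1 exF.
Let iE j := angular_intg p1 k0 exF aF j.

(** Since the real part of [E = z F' G(F)] is [E] minus [i] times its imaginary part, subtracting
    the null integral of [angular_integral_zero] leaves [2 (j + 1) |F|^p + p E]. The variational
    identity evaluates the first term on the moments and contributes [2 (j + 1)]; the angular
    identity contributes [p (m - j)]. *)
Lemma extremal_green (j : nat) :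
  disc_integral (fun z => z ^+ j * (j.+2%:R * Np p (F z) +
    p * complex.Re (z * pderiv a z * Gp p (F z)))%:C) =
  (Phi^-1)%:C * \sum_(m < size k) conjc k`_m *
    ((2 * j.+1%:R + p * (m%:R - j%:R))%:C * mom m (fun z => z ^+ j * F z)).
Proof.
have [iH H0] := angular_integral_zero p1 AF aF iE j.
have iV := inA_mul_Gp p1 (inAMX p1 j AF) AF.
have j2 : j.+2%:R = j%:R + 2 :> R by rewrite -addn2 natrD.
have j1 : j.+1%:R = j%:R + 1 :> R by rewrite -natr1.
transitivity (disc_integral (fun z => (2 * j.+1%:R)%:C * (z ^+ j * F z * Gp p (F z)) +
    p%:C * (z ^+ j * (z * pderiv a z) * Gp p (F z)) -
    z ^+ j * ((j%:R * Np p (F z))%:C +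
      (p * complex.Im (z * pderiv a z * Gp p (F z)))%:C * Complex 0 1))).
  apply: eq_disc_integral => z _.
  rewrite -[_ * F z * _]mulrA mul_Gp// -[z ^+ j * _ * Gp p _]mulrA j1 j2.
  move: (z * pderiv a z * Gp p (F z)) (Np p (F z)) (z ^+ j) => [x y] n [u v].
  by apply: complexP; rewrite !(ReM, ImM, ReD, ImD, ReN, ImN) /=; ring.
rewrite disc_integralB//; last by apply: disc_intgD; exact: disc_intgZ.
rewrite H0 subr0 disc_integralD; try exact: disc_intgZ.
rewrite !disc_integralZ// (variational_mom p1 k0 exF (inAMX p1 j AF)).
rewrite (angular_identity p1 k0 exF aF j) [X in X + _]mulrCA [X in _ + X]mulrCA -mulrDr.
congr (_ * _); rewrite !mulr_sumr -big_split; apply: eq_bigr => m _ /=.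
have -> : (2 * j.+1%:R + p * (m%:R - j%:R))%:C =
    (2 * j.+1%:R)%:C + p%:C * (m%:R - j%:R)%:C :> C.
  by apply: complexP; rewrite ?(ReD, ImD, ReM, ImM) /=; ring.
by move: (2 * j.+1%:R)%:C (m%:R - j%:R)%:C => x y; ring.
Qed.

End boundary_identity.

Theorem theorem2p1 (R : realType) (p : R) (k : {poly R[i]}) (F : R[i] -> R[i]) :
  1 < p -> k != 0 -> extremal p k F ->
  in_Hp p F /\
  (exists Fb : R -> R[i], radial_limit F Fb) /\
  forall Fb : R -> R[i], radial_limit F Fb ->
  forall h : {poly R[i]},
    ((pi *+ 2)^-1)%:C *
      cintegral (@leb1 R) (@circ_dom R)
        (fun t => (Normc.normc (Fb t) `^ p)%:C * h.[expi t])
    = ((pi *+ 2 * phi_norm p k)^-1)%:C *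
      cintegral (@leb1 R) (@circ_dom R)
        (fun t => Fb t *
           ((p / 2)%:C * h.[expi t] * conjc k.[expi t]
            + (1 - p / 2)%:C * ('X * h)^`().[expi t] * conjc (Kfun k (expi t)))).
Proof.
move=> p1 k0 exF.
have AF := extremal_inA p1 exF; have [a aF] := AF.1.
have iE j := angular_intg p1 k0 exF aF j.
have iE0 : disc_intg (fun z => z * pderiv a z * Gp p (F z)).
  by have := iE 0; congr disc_intg; apply/funext => z; rewrite expr0 mul1r.
have [N [M [mN N0 iM hg]]] := good_angles p1 aF iE0.
split; first exact: (inA_in_Hp p1 AF aF mN N0 iM hg).
split; first exact: (radial_limit_exists p1 aF mN N0 hg).
move=> Fb [A [mA A0 hA]] h.
pose B := boundary_value F N.
pose mu := @lebesgue_measure R; pose circ := @circ_dom R.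
(* The given [Fb] is constrained only off [A], and [boundary_value] is a radial limit only off [N].
   Outside the union both are limits of [F] on the same radius and so agree; [Fb] itself need not be
   measurable. *)
have mNA : measurable (N `|` A) by exact: measurableU.
have NA0 : mu (N `|` A) = 0%E by rewrite -[RHS]N0; exact: (@measureU0 _ _ _ (@lebesgue_measure R)).
have FbE t : circ t -> ~ (N `|` A) t -> Fb t = B t.
  move=> ct /not_orP[Nt At].
  have c1 : ccvg (at_left (1 : R)) (fun r : R => F (r%:C * expi t)) (Fb t).
    by apply: contrapT => nc; apply: At; exact: hA.
  exact: (ccvg_unique c1 (boundary_value_ccvg p1 aF hg ct Nt)).
rewrite /leb1 -/mu -/circ.
have mc : measurable circ := @measurable_circ R.
have cB : cintg mu circ B by exact: (boundary_value_cintg p1 aF mN iM hg).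
have iN : cintg mu circ (fun t => (Np p (B t))%:C).
  by split; [exact: (boundary_Np_integrable p1 aF mN iM hg)|exact: integrable0].
have ce (j m : nat) : cmeas circ (fun t : R => expi t ^+ j * conjc (expi t) ^+ m).
  by apply: cmeasM; apply: cmeasX; [|apply: cmeas_conjc]; exact: cmeas_expi.
have ne (j m : nat) (t : R) : circ t -> Normc.normc (expi t ^+ j * conjc (expi t) ^+ m) <= 1.
  by move=> _; rewrite Normc.normcM !normcX normc_conjc normc_expi !expr1n mulr1.
have iBe (j m : nat) : cintg mu circ (fun t => B t * (expi t ^+ j * conjc (expi t) ^+ m)).
  exact: (@cintg_mul_bounded R _ _ mu circ B (fun t => expi t ^+ j * conjc (expi t) ^+ m) mc cB (ce j m) (ne j m)).
have iNe (j : nat) : cintg mu circ (fun t => (Np p (B t))%:C * expi t ^+ j).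
  have := @cintg_mul_bounded R _ _ mu circ (fun t => (Np p (B t))%:C) (fun t => expi t ^+ j * conjc (expi t) ^+ 0) mc iN (ce j 0) (ne j 0).
  by congr cintg; apply/funext => t; rewrite expr0 mulr1.
pose X (j m : nat) := mom m (fun z => z ^+ j * F z).
have -> : cintegral mu circ (fun t => (Normc.normc (Fb t) `^ p)%:C * h.[expi t]) =
    \sum_(j < size h) h`_j * ((phi_norm p k)^-1)%:C * \sum_(m < size k) conjc k`_m *
      ((2 * j.+1%:R + p * (m%:R - j%:R))%:C * X j m).
  transitivity (cintegral mu circ
      (fun t => \sum_(j < size h) h`_j * ((Np p (B t))%:C * expi t ^+ j))).
    apply: (@cintegral_off_null _ _ _ mu _ mNA NA0) => t ct nt.
    rewrite FbE// horner_coef mulr_sumr; apply: eq_bigr => j _.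
    by rewrite mulrCA.
  rewrite (@cintegral_sum _ _ _ mu _ mc); last by move=> j; exact: cintgZ.
  apply: eq_bigr => j _; rewrite (@cintegralZ _ _ _ mu _ mc _ _ (iNe j)) -[RHS]mulrA.
  congr (_ * _); have [_ ->] := green_boundary p1 AF aF iE mN N0 hg j.
  exact: (extremal_green p1 k0 exF aF j).
have -> : cintegral mu circ (fun t => Fb t *
     ((p / 2)%:C * h.[expi t] * conjc k.[expi t]
      + (1 - p / 2)%:C * ('X * h)^`().[expi t] * conjc (Kfun k (expi t)))) =
    \sum_(j < size h) h`_j * \sum_(m < size k) conjc k`_m *
      ((2 * j.+1%:R + p * (m%:R - j%:R))%:C * X j m).
  (* The coefficient of [e^(ijt) e^(-imt)] in the bracket: [j + 1] comes from [(z h)'] and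
     [1 / (m + 1)] from [K]. The factor [2 (m + 1)] of [boundary_moment] turns it into [p (m + 1) +
     (2 - p) (j + 1) = 2 (j + 1) + p (m - j)], the coefficient found in [extremal_green]. *)
  pose c (j m : nat) : R := p / 2 + (1 - p / 2) * j.+1%:R / m.+1%:R.
  transitivity (cintegral mu circ (fun t => \sum_(j < size h) \sum_(m < size k)
      (h`_j * conjc k`_m * (c j m)%:C) * (B t * (expi t ^+ j * conjc (expi t) ^+ m)))).
    apply: (@cintegral_off_null _ _ _ mu _ mNA NA0) => t ct nt.
    rewrite FbE// deriv_mulX_horner conjc_horner horner_coef Kfun_sum rmorph_sum.
    move: (expi t) (B t) => e b.
    rewrite (mulr_sum_sum _ _ _ (fun i => h`_i * e ^+ i) (fun i => conjc k`_i * conjc e ^+ i)).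
    rewrite (mulr_sum_sum _ _ _ (fun j => j.+1%:R * h`_j * e ^+ j)
      (fun m => conjc (k`_m * e ^+ m * (m.+1%:R^-1)%:C))).
    rewrite -big_split mulr_sumr; apply: eq_bigr => j _.
    rewrite -big_split mulr_sumr; apply: eq_bigr => m _.
    have -> : conjc (k`_m * e ^+ m * (m.+1%:R^-1)%:C) =
        conjc k`_m * conjc e ^+ m * (m.+1%:R^-1)%:C.
      by rewrite !rmorphM rmorphXn; congr (_ * _); apply: complexP; rewrite /= ?oppr0.
    have -> : (c j m)%:C = (p / 2)%:C + (1 - p / 2)%:C * j.+1%:R * (m.+1%:R^-1)%:C.
      have -> : j.+1%:R = (j.+1%:R : R)%:C :> R[i] by rewrite rmorph_nat.
      rewrite /c; move: (j.+1%:R : R) (m.+1%:R^-1 : R) (p / 2) => x y q.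
      by apply: complexP; rewrite ?(ReD, ImD, ReM, ImM) /=; ring.
    rewrite /=; ring.
  rewrite (@cintegral_sum _ _ _ mu _ mc); last first.
    by move=> j; apply: (@cintg_sum _ _ _ mu circ mc) => m; exact: cintgZ.
  apply: eq_bigr => j _; rewrite (@cintegral_sum _ _ _ mu _ mc); last by move=> m; exact: cintgZ.
  rewrite mulr_sumr; apply: eq_bigr => m _.
  rewrite (@cintegralZ _ _ _ mu _ mc _ _ (iBe j m)).
  rewrite (boundary_moment p1 AF aF mN N0 iM hg j m) -/(X j m).
  rewrite -!mulrA; congr (_ * (_ * _)); rewrite mulrA -rmorphM /=; congr (_%:C * _).
  have m0 : m.+1%:R != 0 :> R by rewrite pnatr_eq0.
  have -> : (m%:R : R) = m.+1%:R - 1 by rewrite -natr1 addrK.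
  have -> : (j%:R : R) = j.+1%:R - 1 by rewrite -natr1 addrK.
  by rewrite /c; move: (m.+1%:R : R) m0 (j.+1%:R : R) => x x0 y; field.
rewrite invfM rmorphM /= -!mulrA; congr (_ * _); rewrite mulr_sumr.
by apply: eq_bigr => j _; rewrite -mulrA mulrCA.
Qed.
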